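(* Let $\vartheta_0\in\mathbb{R}$, $T_*=\sup_{\vartheta\le\vartheta_0}T(\vartheta)$, $T\in[0,T_* )$, and let $\vartheta<\vartheta_0$ be such that $T<T(\vartheta)$. Assume that $\phi\in L^1(\mathbb{R}^d)\cap L^\infty(\mathbb{R}^d)$. Let $r_0\in\mathcal{K}_{\vartheta_0}$ and consider, for $\varepsilon>0$, the solutions $k^{(\varepsilon)}_{t,\mathrm{ren}}$ and $r_t$ (classical solutions in $\mathcal{K}_\vartheta$ on $[0,T(\vartheta))$) of the problems $$\frac{d}{dt}k^{(\varepsilon)}_{t,\mathrm{ren}}=L_{\varepsilon,\mathrm{ren}}k^{(\varepsilon)}_{t,\mathrm{ren}},\quad k^{(\varepsilon)}_{t,\mathrm{ren}}|_{t=0}=r_0,\qquad\text{and}\qquad\frac{d}{dt}r_t=L_Vr_t,\quad r_t|_{t=0}=r_0.$$ Then $k^{(\varepsilon)}_{t,\mathrm{ren}}\to r_t$ in $\mathcal{K}_\vartheta$ as $\varepsilon\to0^+$, uniformly on $[0,T]$; that is, $\sup_{t\in[0,T]}\|k^{(\varepsilon)}_{t,\mathrm{ren}}-r_t\|_\vartheta\to0$.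
   Context: Data. $a:\mathbb{R}^d\to[0,+\infty)$ and $\phi:\mathbb{R}^d\to[0,+\infty)$ are measurable, $a(x)=a(-x)$, $\phi(x)=\phi(-x)$, $0<\alpha:=\int_{\mathbb{R}^d}a(x)\,dx<\infty$, $\langle\phi\rangle:=\int_{\mathbb{R}^d}\phi(x)\,dx<\infty$. For fixed $\vartheta_0$ and $\vartheta\le\vartheta_0$, $$T(\vartheta)=\frac{\vartheta_0-\vartheta}{2\alpha}\exp\left(-\langle\phi\rangle e^{-\vartheta}\right).$$ Finite configurations. $\Gamma_0=\bigsqcup_{n\ge 0}\Gamma^{(n)}$, where $\Gamma^{(0)}=\{\emptyset\}$ and $\Gamma^{(n)}=\{\eta\subset\mathbb{R}^d:|\eta|=n\}$, with the Borel $\sigma$-field of the disjoint union topology ($\Gamma^{(n)}$ is identified with the symmetrization of $\{(x_1,\dots,x_n):x_i\ne x_j,\ i\neq j\}$). A measurable $k:\Gamma_0\to\mathbb{R}$ is identified with a sequence of symmetric functions $k^{(n)}:(\mathbb{R}^d)^n\to\mathbb{R}$, $k(\{x_1,\dots,x_n\})=k^{(n)}(x_1,\dots,x_n)$, with $k^{(0)}$ constant. The Lebesgue-Poisson measure on $\Gamma_0$ is $\lambda=\delta_\emptyset+\sum_{n\ge1}\frac1{n!}m^{(n)}$, where $m^{(n)}$ is the restriction of $dx_1\cdots dx_n$ to $\Gamma^{(n)}$. Single points $x$ are also written for the configurations $\{x\}$. For $f:\mathbb{R}^d\to\mathbb{R}$, $e(f,\eta)=\prod_{x\in\eta}f(x)$,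 $e(f,\emptyset)=1$. Operators. For $\varepsilon>0$ let $t^{(\varepsilon)}_x(y)=e^{-\varepsilon\phi(x-y)}-1$, $\tau^{(\varepsilon)}_x(y)=t^{(\varepsilon)}_x(y)+1$, and $$(L_{\varepsilon,\mathrm{ren}}k)(\eta)=\sum_{y\in\eta}\int_{\mathbb{R}^d}a(x-y)\,e(\tau^{(\varepsilon)}_y,\eta\setminus y\cup x)\left(\int_{\Gamma_0}e(\varepsilon^{-1}t^{(\varepsilon)}_y,\xi)\,k(\xi\cup x\cup\eta\setminus y)\,\lambda(d\xi)\right)dx$$ $$\qquad-\int_{\Gamma_0}k(\xi\cup\eta)\left(\sum_{x\in\eta}\int_{\mathbb{R}^d}a(x-y)\,e(\tau^{(\varepsilon)}_y,\eta)\,e(\varepsilon^{-1}t^{(\varepsilon)}_y,\xi)\,dy\right)\lambda(d\xi),$$ $$(L_Vk)(\eta)=\sum_{y\in\eta}\int_{\mathbb{R}^d}a(x-y)\int_{\Gamma_0}e(-\phi(y-\cdot),\xi)\,k(\xi\cup x\cup\eta\setminus y)\,\lambda(d\xi)\,dx$$ $$\qquad-\int_{\Gamma_0}k(\xi\cup\eta)\sum_{x\in\eta}\int_{\mathbb{R}^d}a(x-y)\,e(-\phi(y-\cdot),\xi)\,dy\,\lambda(d\xi).$$ Spaces and solutions. For $\vartheta\in\mathbb{R}$, $\mathcal{K}_\vartheta$ is the Banach space of ($\lambda$-a.e. classes of) $k:\Gamma_0\to\mathbb{R}$ with $\|k\|_\vartheta=\sup_{n\ge0}e^{\vartheta n}\nu_n(k)<\infty$,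 $\nu_0(k)=|k^{(0)}|$, $\nu_n(k)=\|k^{(n)}\|_{L^\infty((\mathbb{R}^d)^n)}$. For $L\in\{L_{\varepsilon,\mathrm{ren}},L_V\}$, a classical solution of $\frac{d}{dt}k_t=Lk_t$ in $\mathcal{K}_\vartheta$ on a time interval $I$ is a map $I\ni t\mapsto k_t\in\mathcal{K}_\vartheta$ which is continuous on $I$, continuously differentiable on the interior of $I$, takes values in $\{k\in\mathcal{K}_\vartheta:Lk\in\mathcal{K}_\vartheta\}$, and satisfies the equation and the initial condition. For initial data in $\mathcal{K}_{\vartheta_0}$ both problems have unique classical solutions in $\mathcal{K}_\vartheta$ on $[0,T(\vartheta))$. *)

(* Defs.v *)
From HB Require Import structures.
From mathcomp Require Import all_boot all_order all_algebra finmap.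
From mathcomp Require Import all_classical all_reals all_analysis.
From mathcomp Require Import measurable_realfun.

Set Implicit Arguments.
Unset Strict Implicit.
Unset Printing Implicit Defensive.

Import Order.TTheory GRing.Theory Num.Theory.
Import numFieldNormedType.Exports.

Local Open Scope classical_set_scope.
Local Open Scope ring_scope.

Lemma sigma_finite_pushforward d1 d2 (T1 : measurableType d1)
    (T2 : measurableType d2) (R : realType)
    (m : {measure set T1 -> \bar R}) (f : T1 -> T2) (g : T2 -> T1) :
  sigma_finite setT m ->
  measurable_fun setT f -> measurable_fun setT g -> cancel f g ->
  exists m' : {sigma_finite_measure set T2 -> \bar R},
    (m' : set T2 -> \bar R) = pushforward m f.
Proof.
move=> msf mf mg fK.
pose p : {measure set T2 -> \bar R} :=
  measure_function_pushforward__canonical__measure_function_Measure m mf.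
have sf : sigma_finite setT (pushforward m f).
  have [F FT Fm] := msf.
  exists (fun i => g @^-1` F i).
    by rewrite -preimage_bigcup -FT preimage_setT.
  move=> i; have [mF Fy] := Fm i; split.
    by rewrite -[X in measurable X]setTI; exact: mg.
  rewrite /pushforward -comp_preimage (_ : g \o f = id)//.
  by apply/funext => x /=; rewrite fK.
pose i := @Measure_isSigmaFinite.Build _ T2 R p sf.
pose q := HB.pack_for {sigma_finite_measure set T2 -> \bar R}
  (pushforward m f) i.
by exists (q mf).
Qed.

Lemma sigma_finite_product d1 d2 (T1 : measurableType d1)
    (T2 : measurableType d2) (R : realType)
    (m1 : {sigma_finite_measure set T1 -> \bar R})
    (m2 : {sigma_finite_measure set T2 -> \bar R}) :
  sigma_finite setT (m1 \x m2)%E.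
Proof.
have /sigma_finiteP[F [TF ndF Foo]] := sigma_finiteT m1.
have /sigma_finiteP[G [TG ndG Goo]] := sigma_finiteT m2.
exists (fun n => F n `*` G n).
 rewrite -setXTT TF TG predeqE => -[x y]; split.
    move=> [/= [n _ Fnx] [k _ Gky]]; exists (maxn n k) => //; split.
    - by move: x Fnx; exact/subsetPset/ndF/leq_maxl.
    - by move: y Gky; exact/subsetPset/ndG/leq_maxr.
  by move=> [n _ []/= ? ?]; split; exists n.
move=> k; have [? ?] := Foo k; have [? ?] := Goo k.
split; first exact: measurableX.
by rewrite product_measure1E// lte_mul_pinfty// ge0_fin_numE.
Qed.

Section power_measure.
Context d (T : measurableType d) (R : realType).
Variable mu : {sigma_finite_measure set T -> \bar R}.

Fixpoint power_measure (n : nat) : set (n.-tuple T) -> \bar R :=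
  match n with
  | 0 => dirac [tuple]
  | m.+1 => pushforward (product_measure1 mu (@power_measure m))
                        (fun p : T * m.-tuple T => [tuple of p.1 :: p.2])
  end.

Lemma power_measure_ok n :
  exists m : {sigma_finite_measure set (n.-tuple T) -> \bar R},
    (m : set _ -> \bar R) = @power_measure n.
Proof.
elim: n => [|n [m mE]]; first by exists (dirac [tuple]).
rewrite /= -mE.
apply: (@sigma_finite_pushforward _ _ _ _ R (mu \x m)%E
  (fun p => [tuple of p.1 :: p.2])
  (fun t : n.+1.-tuple T => (thead t, [tuple of behead t]))).
- exact: sigma_finite_product.
- by apply: measurable_cons; [exact: measurable_fst|exact: measurable_snd].
- apply/measurable_fun_pairP => /=; split; last exact: measurable_behead.
  exact: measurable_tnth.
- by move=> [x t] /=; rewrite theadE; congr pair; apply: val_inj.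
Qed.

Variable n : nat.
Let pm := @power_measure n.

Let power_measure0 : pm set0 = 0%E.
Proof. by rewrite /pm; have [m <-] := power_measure_ok n; rewrite measure0. Qed.

Let power_measure_ge0 A : (0 <= pm A)%E.
Proof. by rewrite /pm; have [m <-] := power_measure_ok n. Qed.

Let power_measure_sigma_additive : semi_sigma_additive pm.
Proof.
rewrite /pm; have [m <-] := power_measure_ok n.
exact: measure_semi_sigma_additive.
Qed.

HB.instance Definition _ := isMeasure.Build _ _ _ (@power_measure n)
  power_measure0 power_measure_ge0 power_measure_sigma_additive.

Let power_measure_sigma_finite : sigma_finite setT pm.
Proof.
rewrite /pm; have [m <-] := power_measure_ok n; exact: sigma_finiteT.
Qed.

HB.instance Definition _ := Measure_isSigmaFinite.Build _ _ _ (@power_measure n)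
  power_measure_sigma_finite.

End power_measure.
Arguments power_measure {d T R} mu n.

(* The product sigma-algebra of row vectors, as for n.-tuple T in the library;
   on 'rV[R]_n with R : realType it is the Borel sigma-algebra of R^n. *)
Definition rV_display : measure_display -> measure_display.
Proof. exact. Qed.

Section measurable_rV.
Context d (T : measurableType d) (n : nat).

Definition rV_measurable : set (set 'rV[T]_n) :=
  g_sigma_preimage (fun (i : 'I_n) (x : 'rV[T]_n) => x ord0 i).

Let rV0 : rV_measurable set0.
Proof. exact: sigma_algebra0. Qed.

Let rVC A : rV_measurable A -> rV_measurable (~` A).
Proof. exact: sigma_algebraC. Qed.

Let rV_bigcup (F : (set 'rV[T]_n)^nat) : (forall i, rV_measurable (F i)) ->
  rV_measurable (\bigcup_i (F i)).
Proof. exact: sigma_algebra_bigcup. Qed.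

HB.instance Definition _ := @isMeasurable.Build (rV_display d)
  'rV[T]_n rV_measurable rV0 rVC rV_bigcup.

Lemma measurable_rV_coord (i : 'I_n) :
  measurable_fun [set: 'rV[T]_n] (fun x : 'rV[T]_n => x ord0 i).
Proof.
move=> _ Y mY; rewrite setTI; apply: sub_sigma_algebra => /=.
rewrite -bigcup_seq/=; exists i => /=; first by rewrite mem_index_enum.
by exists Y => //; rewrite setTI.
Qed.

Lemma measurable_fun_rVP d1 (T1 : measurableType d1) (f : T1 -> 'rV[T]_n) :
  (forall i, measurable_fun setT (fun x => f x ord0 i)) -> measurable_fun setT f.
Proof.
move=> mf; have sub : g_sigma_preimage
    (fun i x => f x ord0 i) `<=` (@measurable _ T1).
  apply: smallest_sub; first exact: sigma_algebra_measurable.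
  rewrite -bigcup_seq => A [i _] [B mB <-]; exact: mf.
move=> _ A mA; apply: sub.
rewrite (_ : (fun i x => f x ord0 i) =
  fun i => (fun y : 'rV[T]_n => y ord0 i) \o f)// g_sigma_preimage_comp.
by exists A.
Qed.

End measurable_rV.

Section lebesgue_rV.
Context (R : realType) (d : nat).

Definition row_of_tuple (t : d.-tuple (measurableTypeR R)) : 'rV[R]_d :=
  \row_i tnth t i.

Definition lebesgue_rV : set 'rV[R]_d -> \bar R :=
  pushforward (power_measure (@lebesgue_measure R) d) row_of_tuple.

Lemma lebesgue_rV_ok :
  exists m : {sigma_finite_measure set 'rV[R]_d -> \bar R},
    (m : set _ -> \bar R) = lebesgue_rV.
Proof.
apply: (@sigma_finite_pushforward _ _ _ _ _ _ row_of_tuple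
  (fun x : 'rV[R]_d => [tuple x ord0 i | i < d])).
- exact: sigma_finiteT.
- apply: measurable_fun_rVP => i.
  rewrite (_ : (fun _ => _) = fun t => tnth t i).
    exact: measurable_tnth.
  by apply/funext => t; rewrite mxE.
- apply/measurable_fun_tnthP => i.
  rewrite (_ : _ \o _ = fun x : 'rV[R]_d => x ord0 i).
    exact: measurable_rV_coord.
  by apply/funext => x /=; rewrite tnth_mktuple.
- by move=> t; apply: eq_from_tnth => i; rewrite tnth_mktuple mxE.
Qed.

Let lebesgue_rV0 : lebesgue_rV set0 = 0%E.
Proof. by have [m <-] := lebesgue_rV_ok; rewrite measure0. Qed.

Let lebesgue_rV_ge0 A : (0 <= lebesgue_rV A)%E.
Proof. by have [m <-] := lebesgue_rV_ok. Qed.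

Let lebesgue_rV_sigma_additive : semi_sigma_additive lebesgue_rV.
Proof.
by have [m <-] := lebesgue_rV_ok; exact: measure_semi_sigma_additive.
Qed.

HB.instance Definition _ := isMeasure.Build _ _ _ lebesgue_rV
  lebesgue_rV0 lebesgue_rV_ge0 lebesgue_rV_sigma_additive.

Let lebesgue_rV_sigma_finite : sigma_finite setT lebesgue_rV.
Proof. by have [m <-] := lebesgue_rV_ok; exact: sigma_finiteT. Qed.

HB.instance Definition _ := Measure_isSigmaFinite.Build _ _ _ lebesgue_rV
  lebesgue_rV_sigma_finite.

End lebesgue_rV.
Arguments lebesgue_rV {R d}.

Section configurations.
Context (R : realType) (d : nat).

Definition Gamma0 : Type := {fset 'rV[R]_d}.
HB.instance Definition _ := Choice.on Gamma0.
HB.instance Definition _ := isPointed.Build Gamma0 fset0.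

Definition conf_of_tuple n (x : n.-tuple 'rV[R]_d) : Gamma0 :=
  [fset z in tval x]%fset.

Lemma measurable_uniq_tuple n :
  measurable [set x : n.-tuple 'rV[R]_d | uniq x].
Proof.
rewrite (_ : [set x | _] = \bigcap_(p in [set p : 'I_n * 'I_n | p.1 != p.2])
  \bigcup_(l in [set: 'I_d]) [set x : n.-tuple 'rV[R]_d |
    tnth x p.1 ord0 l != tnth x p.2 ord0 l]); last first.
  apply/seteqP; split=> x /=.
    move=> /tuple_uniqP ux [i j] /= ij; apply: contrapT => h.
    move/eqP : ij; apply; apply: ux; apply/rowP => l; apply/eqP.
    by apply/negPn/negP => xl; apply: h; exists l.
  move=> h; apply/tuple_uniqP => i j xij; apply/eqP/negPn/negP => ij.
  by have [l _ /=] := h (i, j) ij; rewrite xij eqxx.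
apply: fin_bigcap_measurable; first exact: finite_finset.
move=> [i j] _ /=; apply: fin_bigcup_measurable; first exact: finite_finset.
move=> l _ /=.
rewrite -[X in measurable X]setTI.
have mc (k : 'I_n) : measurable_fun setT
    (fun x : n.-tuple 'rV[R]_d => tnth x k ord0 l : R).
  apply: (measurableT_comp (@measurable_rV_coord _ R d l)).
  exact: measurable_tnth.
have := @measurable_neg _ _ _ _ (measurable_fun_eqr (mc i) (mc j)).
by move/(_ measurableT [set true] I); congr measurable.
Qed.

(* The Borel sigma-field of the disjoint union topology: A is measurable iff, for
   all n, the trace of A on the n-point configurations corresponds to a Borel
   (symmetric) subset of the off-diagonal part of (R^d)^n. *)
Definition Gamma0_measurable : set (set Gamma0) :=
  [set A | forall n, measurable
    [set x : n.-tuple 'rV[R]_d | uniq x /\ A (conf_of_tuple x)]].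

Let Gamma0_measurable0 : Gamma0_measurable set0.
Proof.
move=> n; rewrite (_ : [set _ | _] = set0); first exact: measurable0.
by apply/seteqP; split=> x // [].
Qed.

Let Gamma0_measurableC A : Gamma0_measurable A -> Gamma0_measurable (~` A).
Proof.
move=> mA n; rewrite (_ : [set _ | _] =
    [set x : n.-tuple 'rV[R]_d | uniq x] `\`
    [set x : n.-tuple 'rV[R]_d | uniq x /\ A (conf_of_tuple x)]).
  exact: measurableD (@measurable_uniq_tuple n) (mA n).
apply/seteqP; split=> x /= [ux nA]; split=> //.
  by move=> [_ /nA].
by move=> Ax; apply: nA.
Qed.

Let Gamma0_measurable_bigcup (F : (set Gamma0)^nat) :
  (forall i, Gamma0_measurable (F i)) -> Gamma0_measurable (\bigcup_i F i).
Proof.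
move=> mF n; rewrite (_ : [set _ | _] =
    \bigcup_i [set x : n.-tuple 'rV[R]_d | uniq x /\ F i (conf_of_tuple x)]).
  by apply: bigcup_measurable => i _; exact: mF.
apply/seteqP; split=> x /=; first by move=> [ux [i _ Fi]]; exists i.
by move=> [i _ [ux Fi]]; split=> //; exists i.
Qed.

HB.instance Definition _ := @isMeasurable.Build default_measure_display
  Gamma0 Gamma0_measurable
  Gamma0_measurable0 Gamma0_measurableC Gamma0_measurable_bigcup.

End configurations.

Section lebesgue_conf.
Context (R : realType) (d : nat).
Local Notation Gamma0 := (Gamma0 R d).

(* The restriction m^(n) of Lebesgue measure to the off-diagonal part of
   (R^d)^n, carried over to Gamma0. *)
Definition lebesgue_conf (n : nat) (A : set Gamma0) : \bar R :=
  power_measure lebesgue_rV n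
    [set x : n.-tuple 'rV[R]_d | uniq x /\ A (conf_of_tuple x)].

Section lebesgue_conf_measure.
Variable n : nat.

Let lebesgue_conf0 : lebesgue_conf n set0 = 0%E.
Proof.
rewrite /lebesgue_conf (_ : [set _ | _] = set0) ?measure0//.
by apply/seteqP; split=> x // [].
Qed.

Let lebesgue_conf_ge0 A : (0 <= lebesgue_conf n A)%E.
Proof. exact: measure_ge0. Qed.

Let lebesgue_conf_sigma_additive : semi_sigma_additive (lebesgue_conf n).
Proof.
move=> F mF tF mUF; rewrite /lebesgue_conf.
rewrite [X in _ --> power_measure _ _ X](_ : _ =
    \bigcup_i [set x : n.-tuple 'rV[R]_d | uniq x /\ F i (conf_of_tuple x)]).
  apply: measure_semi_sigma_additive.
  - by move=> i; exact: mF.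
  - apply/trivIsetP => i j _ _ ij; rewrite -subset0 => x /= [[_ Fi] [_ Fj]].
    by move/eqP : ij; apply; apply: (tF i j I I); exists (conf_of_tuple x).
  - by apply: bigcup_measurable => i _; exact: mF.
apply/seteqP; split=> x /=; first by move=> [ux [i _ Fi]]; exists i.
by move=> [i _ [ux Fi]]; split=> //; exists i.
Qed.

HB.instance Definition _ := isMeasure.Build _ _ _ (lebesgue_conf n)
  lebesgue_conf0 lebesgue_conf_ge0 lebesgue_conf_sigma_additive.

End lebesgue_conf_measure.
End lebesgue_conf.
Arguments lebesgue_conf {R d} n.

(* The n = 0 summand is the Dirac mass at the empty configuration, since
   power_measure lebesgue_rV 0 is the Dirac mass at the empty tuple. *)
Definition lebesgue_poisson (R : realType) (d : nat) :
    set (Gamma0 R d) -> \bar R :=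
  mseries (fun n => mscale (n`!%:R^-1)%:nng (lebesgue_conf n)) 0.

HB.instance Definition _ (R : realType) (d : nat) :=
  Measure.on (@lebesgue_poisson R d).

Arguments lebesgue_poisson {R d}.

Section spaces.
Context (R : realType) (d : nat).
Implicit Types k : Gamma0 R d -> R.

Definition nu (n : nat) k : \bar R :=
  if n is 0 then `|k fset0|%:E
  else ('N[power_measure lebesgue_rV n]_+oo
         [(fun x : n.-tuple 'rV[R]_d => (k (conf_of_tuple x))%:E)])%E.

Definition Knorm (theta : R) k : \bar R :=
  ereal_sup [set ((expR (theta * n%:R))%:E * nu n k)%E | n in [set: nat]].

(* An element of the Banach space K_theta is the lambda-a.e. class of a function
   in Kspace theta; below, elements of K_theta are given by representatives. *)
Definition Kspace (theta : R) : set (Gamma0 R d -> R) :=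
  [set k | measurable_fun setT k /\ (Knorm theta k < +oo)%E].

(* The solution concept on the time interval [0, b) for dk/dt = L k, k(0) = k0:
   continuous on [0, b), continuously differentiable on ]0, b[ (with derivative
   dk), limits being taken in the norm of K_theta. *)
Definition classical_solution (theta b : R)
    (L : (Gamma0 R d -> R) -> (Gamma0 R d -> R)) (k0 : Gamma0 R d -> R)
    (k : R -> Gamma0 R d -> R) : Prop :=
  [/\ forall t : R, t \in `[0, b[ -> Kspace theta (k t) /\ Kspace theta (L (k t)),
      forall t : R, t \in `[0, b[ ->
        Knorm theta (k s \- k t) @[s --> within `[0, b[ (nbhs t)] --> 0%E,
      exists dk : R -> Gamma0 R d -> R,
        [/\ forall t : R, t \in `]0, b[ -> Kspace theta (dk t),
            forall t : R, t \in `]0, b[ ->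
              Knorm theta ((h^-1 \*: (k (t + h) \- k t)) \- dk t)
                @[h --> 0^'] --> 0%E,
            forall t : R, t \in `]0, b[ ->
              Knorm theta (dk s \- dk t) @[s --> t] --> 0%E
          & forall t : R, t \in `]0, b[ ->
              {ae lebesgue_poisson, forall eta, dk t eta = L (k t) eta}]
    & {ae lebesgue_poisson, forall eta, k 0 eta = k0 eta}].

End spaces.

Section operators.
Context (R : realType) (d : nat).
Implicit Types (a phi f : 'rV[R]_d -> R) (k : Gamma0 R d -> R)
  (eta xi : Gamma0 R d).

Definition econf f eta : R := \prod_(x <- eta) f x.

Definition teps phi (eps : R) (x y : 'rV[R]_d) : R :=
  expR (- (eps * phi (x - y))) - 1.

Definition taueps phi (eps : R) (x y : 'rV[R]_d) : R := teps phi eps x y + 1.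

Definition Lren a phi (eps : R) k eta : R :=
  \sum_(y <- eta) (\int[lebesgue_rV]_x
      (a (x - y) * econf (taueps phi eps y) (x |` (eta `\ y))%fset *
       (\int[lebesgue_poisson]_xi
          (econf (fun z => eps^-1 * teps phi eps y z) xi *
           k (xi `|` (x |` (eta `\ y)))%fset))))
  - \int[lebesgue_poisson]_xi
      (k (xi `|` eta)%fset *
       \sum_(x <- eta) (\int[lebesgue_rV]_y
          (a (x - y) * econf (taueps phi eps y) eta *
           econf (fun z => eps^-1 * teps phi eps y z) xi))).

Definition LV a phi k eta : R :=
  \sum_(y <- eta) (\int[lebesgue_rV]_x
      (a (x - y) *
       (\int[lebesgue_poisson]_xi
          (econf (fun z => - phi (y - z)) xi *
           k (xi `|` (x |` (eta `\ y)))%fset))))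
  - \int[lebesgue_poisson]_xi
      (k (xi `|` eta)%fset *
       \sum_(x <- eta) (\int[lebesgue_rV]_y
          (a (x - y) * econf (fun z => - phi (y - z)) xi))).

Definition Tmax a phi (theta0 theta : R) : R :=
  (theta0 - theta) / (2 * \int[lebesgue_rV]_x a x) *
  expR (- ((\int[lebesgue_rV]_x phi x) * expR (- theta))).

(* Extended real-valued, as it is +oo when phi = 0 almost everywhere. *)
Definition Tstar a phi (theta0 : R) : \bar R :=
  ereal_sup [set (Tmax a phi theta0 theta)%:E | theta in `]-oo, theta0]].

End operators.

(* Main.v *)
Require Import Defs.
From HB Require Import structures.
From mathcomp Require Import all_boot all_order all_algebra finmap.
From mathcomp Require Import all_classical all_reals all_analysis.
From mathcomp Require Import measurable_realfun ess_sup_inf.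
From mathcomp Require Import ring lra.

Set Implicit Arguments.
Unset Strict Implicit.
Unset Printing Implicit Defensive.

Import Order.TTheory GRing.Theory Num.Theory.
Import numFieldNormedType.Exports.

Local Open Scope classical_set_scope.
Local Open Scope ring_scope.

(** Both equations have the form [k' = L k], where [L] sums, over the points [y] of
a configuration, gain and loss terms for the jumps between [x] and [y] with
kernel [a], and averages [k] over additional points [xi] with a weight bounded by
the product of [phi (y - z)] over the points [z] of [xi]. Integrating this product against the
Lebesgue-Poisson measure gives an exponential, and the sum over the points of
the configuration gives a factor [n]. As [n * exp (- delta * n)] is at most
[1 / (e * delta)], the operator [L] maps the space of weight [t1] to that of
weight [t2 < t1] with norm at most [m t1 / (e * (t1 - t2))], where
[m t = 2 * alpha * exp (c * exp (- t))], with [alpha] and [c] the integrals of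
[a] and [phi] ([Kbound_hop]). This bound is the same for the limit operator and
for all values of [eps].

_Taylor series._ Distributing the loss of weight from [theta0] to [theta]
over the [j] applications of [L] shows that [L^j r0 / j!] has norm at most
[B0 * (m theta / (theta0 - theta))^j] in the space of weight [theta]
([Kbound_taylor]). The Taylor series at [0] therefore converges there for
[t < (theta0 - theta) / m theta], which is [Tmax], and its tails are small
uniformly in [eps] and in [t <= T < Tmax].

_Solutions are equal to their Taylor series_ ([solution_taylor]). The
remainders [w_N] of a solution satisfy [w_(N+1)' = L w_N]. Integrating this
relation repeatedly, again with a loss of weight spread over all the steps, shows
that on a short time interval [w_N] tends to [0] in a space of slightly smaller
weight [theta'] ([remainder_decay]). So the solution is there the sum of
the series; but the difference of two partial sums is bounded in the space of
weight [theta], and that bound is a pointwise one, so it passes to the limit with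
the weight [theta] and not only [theta']. Hence nothing is lost at the end of the
short interval, and the argument can be restarted from there
([remainder_step]).

_Comparison._ It remains to compare the finitely many first coefficients. The
factors of the two operators differ by [O(eps)] because [phi] is bounded
([weight_le_renB]), so that their difference is [O(eps)] from each space of the
scale to the larger ones ([Lren_LV]); by induction on [j] the [j]-th coefficients
differ by [O(eps)] ([taylor_perturbation]).

_Configurations as sequences._ The measure theory is carried out on finite
sequences of points, where the Lebesgue-Poisson measure becomes [poisson_seqs].
Since points are null sets, almost every sequence has no repetition, and
[conf], which forgets the order of a sequence, identifies the integrals over the
two spaces ([lebesgue_poissonE]). The elements of the spaces
of the scale are bounded only almost everywhere, while [L] evaluates them at
configurations obtained by adding and moving points; that these avoid a given
null set almost surely is the content of [ae_cat_product]. *)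

(** * Finite sequences as a measurable space *)

Lemma measurable_preimage d1 d2 (X : measurableType d1) (Y : measurableType d2)
    (f : X -> Y) (A : set Y) :
  measurable_fun setT f -> measurable A -> measurable (f @^-1` A).
Proof. by move=> mf mA; rewrite -[X in measurable X]setTI; exact: mf. Qed.

Definition seqs_display : measure_display -> measure_display.
Proof. exact. Qed.

(** A copy of [seq T], to carry the sigma-algebra of the disjoint union of the
powers of [T]. *)
Definition seqs (T : Type) : Type := seq T.
HB.instance Definition _ (T : choiceType) := Choice.on (seqs T).
HB.instance Definition _ (T : choiceType) := isPointed.Build (seqs T) [::].

Section seqs_measurable.
Context d (T : measurableType d).

Definition seqs_measurable : set (set (seqs T)) :=
  [set A | forall n, measurable [set x : n.-tuple T | A (tval x)]].

Let seqs_measurable0 : seqs_measurable set0.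
Proof. by move=> n; exact: measurable0. Qed.

Let seqs_measurableC A : seqs_measurable A -> seqs_measurable (~` A).
Proof. by move=> mA n; exact: measurableC (mA n). Qed.

Let seqs_measurable_bigcup (F : (set (seqs T))^nat) :
  (forall i, seqs_measurable (F i)) -> seqs_measurable (\bigcup_i F i).
Proof.
move=> mF n; rewrite (_ : [set _ | _] =
    \bigcup_i [set x : n.-tuple T | F i (tval x)]).
  by apply: bigcup_measurable => i _; exact: mF.
by apply/seteqP; split=> x.
Qed.

HB.instance Definition _ := @isMeasurable.Build (seqs_display d) (seqs T)
  seqs_measurable seqs_measurable0 seqs_measurableC seqs_measurable_bigcup.

Lemma measurable_tval n :
  measurable_fun setT (fun x : n.-tuple T => tval x : seqs T).
Proof. by move=> _ A mA; rewrite setTI; exact: mA. Qed.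

Lemma measurable_seqs_size n : measurable [set s : seqs T | size s = n].
Proof.
move=> m; have [->|mn] := eqVneq m n.
  rewrite (_ : [set _ | _] = setT)//; apply/seteqP; split=> x //= _.
  by rewrite size_tuple.
rewrite (_ : [set _ | _] = set0)//; apply/seteqP; split=> x //=.
by rewrite size_tuple => /eqP; rewrite (negPf mn).
Qed.

(** A measurable left inverse of the inclusion of the [n]-tuples; sequences of
another length are truncated or padded with the default point. *)
Definition tuple_of_seqs n (s : seqs T) : n.-tuple T :=
  [tuple nth point s i | i < n].

Lemma tuple_of_seqsK n (s : seqs T) : size s = n -> tuple_of_seqs n s = s :> seq T.
Proof.
move=> sn; apply: (@eq_from_nth _ point); first by rewrite size_tuple.
move=> i; rewrite size_tuple => ni.
by rewrite -[i]/(nat_of_ord (Ordinal ni)) -tnth_nth tnth_mktuple.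
Qed.

Lemma tval_tuple_of_seqs n (x : n.-tuple T) : tuple_of_seqs n (tval x) = x.
Proof. by apply: val_inj => /=; rewrite tuple_of_seqsK// size_tuple. Qed.

Lemma measurable_tuple_of_seqs n : measurable_fun setT (@tuple_of_seqs n).
Proof.
apply/measurable_fun_tnthP => i.
rewrite (_ : _ \o _ = fun s : seqs T => nth point s i); last first.
  by apply/funext => s /=; rewrite tnth_mktuple.
move=> _ A mA; rewrite setTI; suff : seqs_measurable ((fun s : seqs T => nth point s i) @^-1` A) by [].
move=> m.
have [im|mi] := ltnP i m.
  rewrite (_ : [set _ | _] = (fun x => tnth x (Ordinal im)) @^-1` A).
    by rewrite -[X in measurable X]setTI; exact: (measurable_tnth _).
  by apply/seteqP; split=> x /=; rewrite (tnth_nth point).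
have [Ap|Ap] := pselect (A point).
  rewrite (_ : [set _ | _] = setT)//; apply/seteqP; split=> x //= _.
  by rewrite nth_default// size_tuple.
rewrite (_ : [set _ | _] = set0)//; apply/seteqP; split=> x //=.
by rewrite nth_default// size_tuple.
Qed.

(** Products with countable disjoint unions of measurable spaces are disjoint
unions of products, and the retractions [tuple_of_seqs] make this effective: a set
is the countable union of its parts of given length, each of which is read on
tuples. *)
Lemma measurable_fun_seqsP d1 d2 (X : measurableType d1) (Y : measurableType d2)
    (f : X * seqs T -> Y) :
  (forall n, measurable_fun setT (fun p : X * n.-tuple T => f (p.1, tval p.2))) ->
  measurable_fun setT f.
Proof.
move=> mf _ A mA; rewrite setTI.
rewrite (_ : f @^-1` A = \bigcup_n ((snd @^-1` [set s : seqs T | size s = n]) `&`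
   ((fun p : X * seqs T => f (p.1, tval (tuple_of_seqs n p.2))) @^-1` A))).
  apply: bigcup_measurable => n _; apply: measurableI.
    by apply: measurable_preimage (measurable_seqs_size n); exact: measurable_snd.
  apply: measurable_preimage mA.
  apply: (measurableT_comp (mf n) (g := fun p => (p.1, tuple_of_seqs n p.2))) => //.
  apply: measurable_fun_pair; first exact: measurable_fst.
  by apply: (measurableT_comp (@measurable_tuple_of_seqs n)); exact: measurable_snd.
apply/seteqP; split=> [[x s] /= Af|[x s] /= [n _ [/= sn]]].
  by exists (size s) => //=; split=> //=; rewrite tuple_of_seqsK.
by rewrite tuple_of_seqsK.
Qed.

(** By induction on the length of the sequence: on [(n+1)]-tuples, [f] is [G]
composed with the restriction of [f] to [n]-tuples. *)
Lemma measurable_fun_foldr d1 d2 (X : measurableType d1) (Y : measurableType d2)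
    (f : X * seqs T -> Y) (G : X * (T * (seqs T * Y)) -> Y) :
  measurable_fun setT (fun x => f (x, [::])) -> measurable_fun setT G ->
  (forall x z s, f (x, z :: s) = G (x, (z, (s, f (x, s))))) ->
  measurable_fun setT f.
Proof.
move=> mf0 mG fE; apply: measurable_fun_seqsP; elim=> [|n ih].
  rewrite (_ : (fun _ => _) = (fun x => f (x, [::])) \o fst).
    exact: measurableT_comp measurable_fst.
  by apply/funext => -[x t] /=; rewrite tuple0.
rewrite (_ : (fun _ => _) = (fun p : X * n.+1.-tuple T =>
    G (p.1, (thead p.2, (behead p.2 : seqs T, f (p.1, behead p.2)))))).
  apply: (measurableT_comp mG).
  have mb : measurable_fun setT
      (fun p : X * n.+1.-tuple T => [tuple of behead p.2] : n.-tuple T).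
    by apply: (measurableT_comp (@measurable_behead _ T n)); exact: measurable_snd.
  apply: measurable_fun_pair; first exact: measurable_fst.
  apply: measurable_fun_pair.
    by apply: (measurableT_comp (measurable_tnth ord0)); exact: measurable_snd.
  apply: measurable_fun_pair.
    exact: (measurableT_comp (@measurable_tval n) mb).
  apply: (measurableT_comp ih (g := fun p : X * n.+1.-tuple T => (p.1, [tuple of behead p.2] : n.-tuple T))).
  by apply: measurable_fun_pair; [exact: measurable_fst|exact: mb].
by apply/funext => -[x t] /=; case/tupleP: t => z t; rewrite fE theadE.
Qed.

Lemma measurable_seqs_cons d1 (X : measurableType d1) (f : X -> T) (g : X -> seqs T) :
  measurable_fun setT f -> measurable_fun setT g ->
  measurable_fun setT (fun x => f x :: g x : seqs T).
Proof.
move=> mf mg.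
apply: (measurableT_comp (f := fun p : T * seqs T => p.1 :: p.2 : seqs T)
   (g := fun x => (f x, g x))); last exact: measurable_fun_pair.
apply: measurable_fun_seqsP => n /=.
apply: (measurableT_comp (@measurable_tval n.+1)
   (g := fun p : T * n.-tuple T => [tuple of p.1 :: p.2])).
by apply: measurable_cons; [exact: measurable_fst|exact: measurable_snd].
Qed.

End seqs_measurable.

Section seqs_operations.
Context d (T : measurableType d).

Lemma measurable_seqs_cat :
  measurable_fun setT (fun p : seqs T * seqs T => p.1 ++ p.2 : seqs T).
Proof.
pose f (p : seqs T * seqs T) : seqs T := p.2 ++ p.1.
suff mf : measurable_fun setT f.
  apply: (measurableT_comp mf (g := fun p => (p.2, p.1))).
  by apply: measurable_fun_pair; [exact: measurable_snd|exact: measurable_fst].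
apply: (@measurable_fun_foldr _ T _ _ _ _ _
  (fun q : seqs T * (T * (seqs T * seqs T)) => q.2.1 :: q.2.2.2 : seqs T)) => //.
  exact: measurable_id.
apply: measurable_seqs_cons.
  by apply: (measurableT_comp measurable_fst); exact: measurable_snd.
apply: (measurableT_comp measurable_snd).
by apply: (measurableT_comp measurable_snd); exact: measurable_snd.
Qed.

Lemma measurable_fun_seqs1 d1 (Y : measurableType d1) (f : seqs T -> Y)
    (G : T * (seqs T * Y) -> Y) :
  measurable_fun setT G ->
  (forall z s, f (z :: s) = G (z, (s, f s))) -> measurable_fun setT f.
Proof.
move=> mG fE.
have mf : measurable_fun setT (fun p : unit * seqs T => f p.2).
  apply: (@measurable_fun_foldr _ T _ _ _ _ _ (fun q : unit * (T * (seqs T * Y)) => G q.2)).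
  - exact: (measurable_cst (f [::])).
  - by apply: (measurableT_comp mG); exact: measurable_snd.
  - by move=> x z s /=; exact: fE.
apply: (measurableT_comp mf (g := fun s => (tt, s))).
by apply: measurable_fun_pair => //; exact: measurable_id.
Qed.

Lemma measurable_fun_size d1 (Y : measurableType d1) (g : nat -> Y) :
  measurable_fun setT (fun s : seqs T => g (size s)).
Proof.
have mf : measurable_fun setT (fun p : unit * seqs T => g (size p.2)).
  apply: measurable_fun_seqsP => n /=.
  rewrite (_ : (fun _ => _) = cst (g n)); first exact: measurable_cst.
  by apply/funext => -[u x] /=; rewrite size_tuple.
apply: (measurableT_comp mf (g := fun s => (tt, s))).
by apply: measurable_fun_pair => //; exact: measurable_id.
Qed.

Lemma measurable_seqs_prod (R : realType) d1 (X : measurableType d1)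
    (g : X * T -> R) : measurable_fun setT g ->
  measurable_fun setT (fun p : X * seqs T => \prod_(z <- p.2) g (p.1, z)).
Proof.
move=> mg; apply: (@measurable_fun_foldr _ T _ _ _ _ _
  (fun q : X * (T * (seqs T * R)) => g (q.1, q.2.1) * q.2.2.2)).
- rewrite (_ : (fun _ => _) = cst 1); first exact: measurable_cst.
  by apply/funext => x; rewrite big_nil.
- apply: measurable_funM.
    apply: (measurableT_comp mg); apply: measurable_fun_pair.
      exact: measurable_fst.
    by apply: (measurableT_comp measurable_fst); exact: measurable_snd.
  apply: (measurableT_comp measurable_snd).
  by apply: (measurableT_comp measurable_snd); exact: measurable_snd.
- by move=> x z s /=; rewrite big_cons.
Qed.

Lemma measurable_seqs_sum (R : realType) d1 (X : measurableType d1)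
    (g : X * T -> R) : measurable_fun setT g ->
  measurable_fun setT (fun p : X * seqs T => \sum_(z <- p.2) g (p.1, z)).
Proof.
move=> mg; apply: (@measurable_fun_foldr _ T _ _ _ _ _
  (fun q : X * (T * (seqs T * R)) => g (q.1, q.2.1) + q.2.2.2)).
- rewrite (_ : (fun _ => _) = cst 0); first exact: measurable_cst.
  by apply/funext => x; rewrite big_nil.
- apply: measurable_funD.
    apply: (measurableT_comp mg); apply: measurable_fun_pair.
      exact: measurable_fst.
    by apply: (measurableT_comp measurable_fst); exact: measurable_snd.
  apply: (measurableT_comp measurable_snd).
  by apply: (measurableT_comp measurable_snd); exact: measurable_snd.
- by move=> x z s /=; rewrite big_cons.
Qed.

Lemma measurable_seqs_has d1 (X : measurableType d1) (g : X * T -> bool) :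
  measurable_fun setT g ->
  measurable_fun setT (fun p : X * seqs T => has (fun z => g (p.1, z)) p.2).
Proof.
move=> mg; apply: (@measurable_fun_foldr _ T _ _ _ _ _
  (fun q : X * (T * (seqs T * bool)) => g (q.1, q.2.1) || q.2.2.2)) => //.
apply: measurable_or.
  apply: (measurableT_comp mg); apply: measurable_fun_pair.
    exact: measurable_fst.
  by apply: (measurableT_comp measurable_fst); exact: measurable_snd.
apply: (measurableT_comp measurable_snd).
by apply: (measurableT_comp measurable_snd); exact: measurable_snd.
Qed.

Hypothesis meq : measurable_fun setT (fun p : T * T => p.1 == p.2).

Lemma measurable_seqs_mem :
  measurable_fun setT (fun p : T * seqs T => p.1 \in p.2).
Proof.
have := measurable_seqs_has meq; congr measurable_fun.
by apply/funext => -[x s] /=; rewrite -has_pred1; apply: eq_has => z /=.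
Qed.

Lemma measurable_seqs_filter :
  measurable_fun setT (fun p : T * seqs T => [seq z <- p.2 | z != p.1] : seqs T).
Proof.
apply: (@measurable_fun_foldr _ T _ _ _ _ _
  (fun q : T * (T * (seqs T * seqs T)) =>
    if q.2.1 == q.1 then q.2.2.2 else (q.2.1 :: q.2.2.2 : seqs T))) => //.
- have m1 : measurable_fun setT (fun q : T * (T * (seqs T * seqs T)) => q.2.1).
    by apply: (measurableT_comp measurable_fst); exact: measurable_snd.
  have m2 : measurable_fun setT (fun q : T * (T * (seqs T * seqs T)) => q.2.2.2).
    apply: (measurableT_comp measurable_snd).
    by apply: (measurableT_comp measurable_snd); exact: measurable_snd.
  apply: measurable_fun_ifT => //.
    apply: (measurableT_comp meq (g := fun q => (q.2.1, q.1))).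
    by apply: measurable_fun_pair => //; exact: measurable_fst.
  exact: measurable_seqs_cons.
- by move=> x z s /=; case: eqVneq.
Qed.

Lemma measurable_seqs_rem :
  measurable_fun setT (fun p : T * seqs T => rem p.1 p.2 : seqs T).
Proof.
apply: (@measurable_fun_foldr _ T _ _ _ _ _
  (fun q : T * (T * (seqs T * seqs T)) =>
    if q.2.1 == q.1 then q.2.2.1 else (q.2.1 :: q.2.2.2 : seqs T))) => //.
have m1 : measurable_fun setT (fun q : T * (T * (seqs T * seqs T)) => q.2.1).
  by apply: (measurableT_comp measurable_fst); exact: measurable_snd.
have m2 : measurable_fun setT (fun q : T * (T * (seqs T * seqs T)) => q.2.2).
  by apply: (measurableT_comp measurable_snd); exact: measurable_snd.
apply: measurable_fun_ifT => //.
- apply: (measurableT_comp meq (g := fun q => (q.2.1, q.1))).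
  by apply: measurable_fun_pair => //; exact: measurable_fst.
- by apply: (measurableT_comp measurable_fst).
- by apply: measurable_seqs_cons => //; apply: (measurableT_comp measurable_snd).
Qed.

Lemma measurable_seqs_undup : measurable_fun setT (fun s : seqs T => undup s : seqs T).
Proof.
apply: (@measurable_fun_seqs1 _ _ _
  (fun q : T * (seqs T * seqs T) =>
    if q.1 \in q.2.1 then q.2.2 else (q.1 :: q.2.2 : seqs T))) => //.
have m2 : measurable_fun setT (fun q : T * (seqs T * seqs T) => q.2.2).
  by apply: (measurableT_comp measurable_snd); exact: measurable_snd.
apply: measurable_fun_ifT => //.
  apply: (measurableT_comp measurable_seqs_mem (g := fun q => (q.1, q.2.1))).
  apply: measurable_fun_pair; first exact: measurable_fst.
  by apply: (measurableT_comp measurable_fst); exact: measurable_snd.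
by apply: measurable_seqs_cons => //; exact: measurable_fst.
Qed.

Lemma measurable_seqs_uniq : measurable_fun setT (fun s : seqs T => uniq s).
Proof.
apply: (@measurable_fun_seqs1 _ _ _ (fun q : T * (seqs T * bool) => (q.1 \notin q.2.1) && q.2.2)) => //.
apply: measurable_and.
  apply: measurable_neg.
  apply: (measurableT_comp measurable_seqs_mem (g := fun q => (q.1, q.2.1))).
  apply: measurable_fun_pair; first exact: measurable_fst.
  by apply: (measurableT_comp measurable_fst); exact: measurable_snd.
by apply: (measurableT_comp measurable_snd); exact: measurable_snd.
Qed.

End seqs_operations.

(** * The Poisson measure on finite sequences *)

Section power_measure_integral.
Local Open Scope ereal_scope.
Context d (T : measurableType d) (R : realType).
Variable mu : {sigma_finite_measure set T -> \bar R}.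

Lemma measurable_tuple_cons n :
  measurable_fun setT (fun p : T * n.-tuple T => [tuple of p.1 :: p.2]).
Proof. by apply: measurable_cons; [exact: measurable_fst|exact: measurable_snd]. Qed.

Lemma ge0_integral_power_measure0 (f : 0.-tuple T -> \bar R) :
  (forall x, 0 <= f x) -> \int[power_measure mu 0]_x f x = f [tuple].
Proof.
move=> f0; have mf : measurable_fun setT f.
  rewrite (_ : f = cst (f [tuple])); first exact: measurable_cst.
  by apply/funext => x; rewrite tuple0.
by rewrite [LHS](integral_dirac _ measurableT mf) diracT mul1e.
Qed.

Lemma ge0_integral_power_measureS n (f : n.+1.-tuple T -> \bar R) :
  measurable_fun setT f -> (forall x, 0 <= f x) ->
  \int[power_measure mu n.+1]_x f x =
  \int[mu \x power_measure mu n]_p f [tuple of p.1 :: p.2].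
Proof.
move=> mf f0.
rewrite [LHS](ge0_integral_pushforward (@measurable_tuple_cons n)
  (mu \x power_measure mu n) measurableT mf)//.
Qed.

Lemma ge0_integral_power_measureS1 n (f : n.+1.-tuple T -> \bar R) :
  measurable_fun setT f -> (forall x, 0 <= f x) ->
  \int[power_measure mu n.+1]_x f x =
  \int[mu]_z \int[power_measure mu n]_t f [tuple of z :: t].
Proof.
move=> mf f0; rewrite ge0_integral_power_measureS//.
rewrite (fubini_tonelli1 (fun p : T * n.-tuple T => f [tuple of p.1 :: p.2]))//.
exact: (measurableT_comp mf (@measurable_tuple_cons n)).
Qed.

Lemma measurable_seqs_prod1 (g : T -> R) : measurable_fun setT g ->
  measurable_fun setT (fun x : seqs T => (\prod_(z <- x) g z)%R).
Proof.
move=> mg.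
have mp := @measurable_seqs_prod _ T R _ unit (fun p => g p.2)
  (measurableT_comp mg measurable_snd).
apply: (@measurableT_comp _ _ _ _ _ _ _ _
  (fun x : seqs T => (tt, x)) mp).
by apply: measurable_fun_pair => //; exact: measurable_id.
Qed.

Lemma measurable_prod_tuple n (g : T -> R) : measurable_fun setT g ->
  measurable_fun setT (fun x : n.-tuple T => (\prod_(z <- x) g z)%R).
Proof.
by move=> mg; exact: (measurableT_comp (measurable_seqs_prod1 mg) (@measurable_tval _ T n)).
Qed.

Lemma ge0_integral_power_measure_prod n (g : T -> R) (c : R) :
  measurable_fun setT g -> (forall z, 0 <= g z)%R ->
  \int[mu]_z (g z)%:E = c%:E ->
  \int[power_measure mu n]_x (\prod_(z <- x) g z)%:E = (c ^+ n)%:E.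
Proof.
move=> mg g0 gc; elim: n => [|n ih].
  rewrite ge0_integral_power_measure0 ?big_nil//.
  by move=> x; rewrite lee_fin prodr_ge0.
rewrite ge0_integral_power_measureS1; last 2 first.
- by apply/measurable_EFinP; exact: measurable_prod_tuple.
- by move=> x; rewrite lee_fin prodr_ge0.
under eq_integral => z _.
  under eq_integral => t _ do rewrite big_cons EFinM.
  rewrite ge0_integralZl ?lee_fin//; last 2 first.
  - by apply/measurable_EFinP; exact: measurable_prod_tuple.
  - by move=> x _; rewrite lee_fin prodr_ge0.
  rewrite ih muleC.
  over.
rewrite ge0_integralZl_EFin//; last 3 first.
- by move=> x _; rewrite lee_fin.
- exact/measurable_EFinP.
- rewrite exprn_ge0// -lee_fin -gc; apply: integral_ge0 => x _.
  by rewrite lee_fin.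
by rewrite gc -EFinM exprSr.
Qed.

End power_measure_integral.

Section poisson_seqs.
Local Open Scope ereal_scope.
Context d (T : measurableType d) (R : realType).
Variable mu : {sigma_finite_measure set T -> \bar R}.

Definition power_seqs n (A : set (seqs T)) : \bar R :=
  power_measure mu n [set x | A (tval x)].

Section power_seqs_measure.
Variable n : nat.

Let power_seqs0 : power_seqs n set0 = 0.
Proof. by rewrite /power_seqs (_ : [set _ | _] = set0)// measure0. Qed.

Let power_seqs_ge0 A : 0 <= power_seqs n A.
Proof. exact: measure_ge0. Qed.

Let power_seqs_sigma_additive : semi_sigma_additive (power_seqs n).
Proof.
move=> F mF tF mUF.
apply: (@measure_semi_sigma_additive _ _ _ (power_measure mu n)
   (fun i => [set x : n.-tuple T | F i (tval x)])).
- by move=> i; exact: mF.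
- apply/trivIsetP => i j _ _ ij; rewrite -subset0 => x /= [Fi Fj].
  by move/eqP : ij; apply; apply: (tF i j I I); exists (tval x).
- by apply: bigcup_measurable => i _; exact: mF.
Qed.

HB.instance Definition _ := isMeasure.Build _ _ _ (power_seqs n)
  power_seqs0 power_seqs_ge0 power_seqs_sigma_additive.

End power_seqs_measure.

(** The Lebesgue-Poisson measure before the order and the multiplicity of the
points are forgotten. *)
Definition poisson_seqs : set (seqs T) -> \bar R :=
  mseries (fun n => mscale ((n`!%:R^-1)%:nng)%R (power_seqs n)) 0.

HB.instance Definition _ := Measure.on poisson_seqs.

Lemma poisson_seqsE A :
  poisson_seqs A = \sum_(0 <= n <oo) (n`!%:R^-1)%:E * power_seqs n A.
Proof. by []. Qed.

(** The Poisson measure is a sum of multiples, by positive factors, of the powers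
of [mu]. *)
Lemma poisson_seqs0P A :
  poisson_seqs A = 0 <-> forall n, power_measure mu n [set x | A (tval x)] = 0.
Proof.
rewrite poisson_seqsE; split=> [A0 n|A0]; last first.
  by apply: eseries0 => n _ _; rewrite /power_seqs A0 mule0.
have : (n`!%:R^-1)%:E * power_seqs n A = 0.
  apply/eqP; rewrite eq_le mule_ge0// ?lee_fin// andbT.
  rewrite -[leRHS]A0.
  rewrite (nneseriesD1 (n := n))//; last first.
    by move=> k _; rewrite mule_ge0// lee_fin.
  by rewrite leeDl// nneseries_ge0// => k _ _; rewrite mule_ge0// lee_fin.
move/eqP; rewrite mule_eq0 => /orP[/eqP[/eqP]|/eqP//].
by rewrite invr_eq0 pnatr_eq0 -leqn0 leqNgt fact_gt0.
Qed.

Let poisson_seqs_sigma_finite : sigma_finite setT poisson_seqs.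
Proof.
have F_ n : {F : (set (n.-tuple T))^nat | setT = \bigcup_i F i &
    forall i, measurable (F i) /\ power_measure mu n (F i) < +oo}.
  by apply: cid2; have [F] := sigma_finiteT (power_measure mu n); exists F.
pose F n := s2val (F_ n).
pose G (k : nat) : set (seqs T) := if choice.unpickle k is Some (n, i) then
  [set s | size s = n /\ F n i (tuple_of_seqs n s)] else set0.
exists G.
  apply/seteqP; split=> // s _.
  have : [set: (size s).-tuple T] (tuple_of_seqs (size s) s) by [].
  rewrite (s2valP (F_ (size s))) => -[i _ Fi].
  by exists (choice.pickle (size s, i)) => //; rewrite /G choice.pickleK.
move=> k; rewrite /G; case: (choice.unpickle k) => [[n i]|]; last first.
  by split; [exact: measurable0|rewrite measure0 ltry].
have [mF Foo] := s2valP' (F_ n) i.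
have mG : measurable [set s : seqs T | size s = n /\ F n i (tuple_of_seqs n s)].
  apply: measurableI; first exact: measurable_seqs_size.
  exact: measurable_preimage (@measurable_tuple_of_seqs _ T n) mF.
split => //; rewrite poisson_seqsE (nneseriesD1 (n := n))//; last first.
  by move=> m _; rewrite mule_ge0// lee_fin.
rewrite eseries0 ?adde0; last first.
  move=> m _ /andP[_ /negPf mn]; rewrite /power_seqs (_ : [set _ | _] = set0) ?measure0 ?mule0//.
  by apply/seteqP; split=> x //= [] /eqP; rewrite size_tuple mn.
apply: lte_mul_pinfty; rewrite ?lee_fin//.
apply: le_lt_trans Foo; rewrite /power_seqs.
apply: (le_measure (power_measure mu n)); rewrite ?inE//.
by move=> x /= []; rewrite tval_tuple_of_seqs.
Qed.

HB.instance Definition _ := Measure_isSigmaFinite.Build _ _ _ poisson_seqs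
  poisson_seqs_sigma_finite.

Lemma ge0_integral_power_seqs n (f : seqs T -> \bar R) :
  measurable_fun setT f -> (forall s, 0 <= f s) ->
  \int[power_seqs n]_s f s = \int[power_measure mu n]_x f (tval x).
Proof.
move=> mf f0.
exact: (ge0_integral_pushforward (@measurable_tval _ T n) (power_measure mu n)
  measurableT mf).
Qed.

Lemma ge0_integral_poisson_seqs (f : seqs T -> \bar R) :
  measurable_fun setT f -> (forall s, 0 <= f s) ->
  \int[poisson_seqs]_s f s =
  \sum_(0 <= n <oo) (n`!%:R^-1)%:E * \int[power_measure mu n]_x f (tval x).
Proof.
move=> mf f0; rewrite [LHS]ge0_integral_measure_series//.
apply: eq_eseriesr => n _; rewrite ge0_integral_mscale//=.
by congr (_ * _); exact: ge0_integral_power_seqs.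
Qed.

(** The integral of a product over an [n]-tuple is [c ^ n], and the weights
[1 / n!] turn the sum over [n] into an exponential series. *)
Lemma ge0_integral_poisson_seqs_prod (g : T -> R) (c : R) :
  measurable_fun setT g -> (forall z, 0 <= g z)%R ->
  \int[mu]_z (g z)%:E = c%:E ->
  \int[poisson_seqs]_s (\prod_(z <- s) g z)%:E = (expR c)%:E.
Proof.
move=> mg g0 gc; rewrite ge0_integral_poisson_seqs; last 2 first.
- by apply/measurable_EFinP; exact: measurable_seqs_prod1.
- by move=> s; rewrite lee_fin prodr_ge0.
under eq_eseriesr do rewrite (ge0_integral_power_measure_prod _ mg g0 gc) -EFinM.
rewrite /expR -EFin_lim; last exact: is_cvg_series_exp_coeff.
apply: congr_lim; apply/funext => n /=.
rewrite /series/= -sumEFin; apply: eq_bigr => i _.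
by rewrite /exp_coeff/= mulrC.
Qed.

End poisson_seqs.

(** * Null sets of the Poisson measure *)

Section null_sets.
Local Open Scope ereal_scope.

Lemma ae_imply d (X : measurableType d) (R : realType)
    (m : {measure set X -> \bar R}) (P Q : set X) :
  (forall x, P x -> Q x) -> {ae m, forall x, P x} -> {ae m, forall x, Q x}.
Proof. by move=> PQ; apply: filterS. Qed.

Lemma measure0P d (X : measurableType d) (R : realType)
    (m : {measure set X -> \bar R}) (N : set X) : measurable N ->
  m N = 0 <-> {ae m, forall x, ~ N x}.
Proof.
move=> mN; rewrite -(negligibleP m mN).
suff E : ~` [set x | ~ N x] = N by rewrite -{1}E.
by apply/seteqP; split=> x /=; [exact: contrapT|move=> Nx; apply].
Qed.

Lemma integral_eq0P d (X : measurableType d) (R : realType)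
    (m : {measure set X -> \bar R}) (f : X -> \bar R) :
  measurable_fun setT f -> (forall x, 0 <= f x) ->
  \int[m]_x f x = 0 <-> {ae m, forall x, f x = 0}.
Proof.
move=> mf f0; have [h1 h2] := ae_eq_integral_abs m measurableT mf.
have E : \int[m]_x `|f x| = \int[m]_x f x.
  by apply: eq_integral => x _; rewrite gee0_abs.
rewrite E in h1 h2; split=> [/h1|h]; first by apply: filterS => x; exact.
by apply: h2; move: h; apply: filterS => x + _.
Qed.

Context d1 d2 (X : measurableType d1) (Y : measurableType d2) (R : realType).
Variable m1 : {sigma_finite_measure set X -> \bar R}.
Variable m2 : {sigma_finite_measure set Y -> \bar R}.
Implicit Types A : set (X * Y).

Lemma measurable_xsection_set A x : measurable A -> measurable [set y | A (x, y)].
Proof.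
move=> mA; apply: (measurable_preimage (f := fun y => (x, y))) => //.
by apply: measurable_fun_pair.
Qed.

Lemma measurable_ysection_set A y : measurable A -> measurable [set x | A (x, y)].
Proof.
move=> mA; apply: (measurable_preimage (f := fun x => (x, y))) => //.
Qed.

Lemma measurable_measure_xsection A : measurable A ->
  measurable_fun setT (fun x => m2 [set y | A (x, y)]).
Proof.
move=> mA; have := measurable_fun_xsection m2 mA; congr measurable_fun.
by apply/funext => x /=; congr (m2 _); apply/seteqP; split=> y; rewrite /xsection/= inE.
Qed.

Lemma measurable_measure_ysection A : measurable A ->
  measurable_fun setT (fun y => m1 [set x | A (x, y)]).
Proof.
move=> mA; have := measurable_fun_ysection m1 mA; congr measurable_fun.
by apply/funext => x /=; congr (m1 _); apply/seteqP; split=> y; rewrite /ysection/= inE.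
Qed.

Lemma product_measure0P1 A : measurable A ->
  (m1 \x m2) A = 0 <-> {ae m1, forall x, m2 [set y | A (x, y)] = 0}.
Proof.
move=> mA; rewrite -integral_eq0P//; last exact: measurable_measure_xsection.
suff -> : (m1 \x m2) A = \int[m1]_x m2 [set y | A (x, y)] by [].
apply: eq_integral => x _ /=; congr (m2 _).
by apply/seteqP; split=> y; rewrite /xsection/= inE.
Qed.

Lemma product_measure0P2 A : measurable A ->
  (m1 \x m2) A = 0 <-> {ae m2, forall y, m1 [set x | A (x, y)] = 0}.
Proof.
move=> mA; rewrite -integral_eq0P//; last exact: measurable_measure_ysection.
rewrite -{1}[A]setIT -integral_indic//.
rewrite (fubini_tonelli2 (EFin \o \1_A)); last 2 first.
- by apply/measurable_EFinP; exact: measurable_indic.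
- by move=> p /=; rewrite lee_fin.
suff -> : fubini_G m1 (EFin \o \1_A) = fun y => m1 [set x | A (x, y)] by [].
apply/funext => y; rewrite /fubini_G.
by rewrite -[X in _ = m1 X]setIT -integral_indic//; exact: measurable_ysection_set.
Qed.

End null_sets.

Section null_seqs.
Local Open Scope ereal_scope.
Context d (T : measurableType d) (R : realType).
Variable mu : {sigma_finite_measure set T -> \bar R}.
Implicit Types (A N : set (seqs T)).
Local Notation Lambda := (poisson_seqs mu).

Lemma measurable_cons_l N z : measurable N -> measurable [set s : seqs T | N (z :: s)].
Proof.
move=> mN; apply: (measurable_preimage (f := fun s : seqs T => z :: s : seqs T)) => //.
by apply: measurable_seqs_cons.
Qed.

Lemma measurable_cons_set N :
  measurable N -> measurable [set p : T * seqs T | N (p.1 :: p.2)].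
Proof.
move=> mN.
apply: (measurable_preimage (f := fun p : T * seqs T => p.1 :: p.2 : seqs T)) => //.
by apply: measurable_seqs_cons; [exact: measurable_fst|exact: measurable_snd].
Qed.

Lemma measurable_measure_cons N : measurable N ->
  measurable [set s : seqs T | mu [set z | N (z :: s)] != 0].
Proof.
move=> mN.
have mf := measurable_measure_ysection mu (measurable_cons_set mN).
have := measurable_preimage mf (measurableC (emeasurable_set1 0)).
by congr measurable; apply/seteqP; split=> s /= /eqP.
Qed.

Lemma measurable_cons_tuple n N : measurable N ->
  measurable [set p : T * n.-tuple T | N (p.1 :: p.2)].
Proof.
by move=> mN; exact: (measurable_preimage (@measurable_tuple_cons _ T n) (mN n.+1)).
Qed.

Lemma power_measure_cons n N : power_measure mu n.+1 [set x | N (tval x)] =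
  (mu \x power_measure mu n) [set p : T * n.-tuple T | N (p.1 :: p.2)].
Proof. by []. Qed.

Lemma poisson_seqs0_nil N : measurable N ->
  power_measure mu 0 [set x | N (tval x)] = 0 <-> ~ N [::].
Proof.
move=> mN; rewrite /= diracE; case: (boolP (_ \in _)); rewrite ?inE/=.
  by move=> N0; split => [/eqP|/(_ N0)//]; rewrite onee_eq0.
by rewrite notin_setE.
Qed.

(** Recursive description of the null sets, by the first point: the measure on
[(n+1)]-tuples is the product of [mu] and the measure on [n]-tuples. *)
Lemma poisson_seqs0_cons1 N : measurable N -> Lambda N = 0 <->
  ~ N [::] /\ {ae mu, forall z, Lambda [set s | N (z :: s)] = 0}.
Proof.
move=> mN; rewrite poisson_seqs0P; split.
  move=> h; split; first by apply/(poisson_seqs0_nil mN); exact: h.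
  have : {ae mu, forall z, forall n,
      power_measure mu n [set t | N (z :: tval t)] = 0}.
    apply: ae_foralln => n; have := h n.+1; rewrite power_measure_cons.
    move/(product_measure0P1 mu (power_measure mu n)); apply.
    exact: measurable_cons_tuple.
  by apply: filterS => z hz; apply/poisson_seqs0P.
move=> [N0 h] [|n]; first exact/poisson_seqs0_nil.
rewrite power_measure_cons; apply/(product_measure0P1 mu (power_measure mu n)).
  exact: measurable_cons_tuple.
by move: h; apply: filterS => z /poisson_seqs0P/(_ n).
Qed.

(** The same description with the first point integrated before the others. *)
Lemma poisson_seqs0_cons2 N : measurable N -> Lambda N = 0 <->
  ~ N [::] /\ {ae Lambda, forall s, mu [set z | N (z :: s)] = 0}.
Proof.
move=> mN; have mM := measurable_measure_cons mN.
have -> : {ae Lambda, forall s, mu [set z | N (z :: s)] = 0} <->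
    Lambda [set s | mu [set z | N (z :: s)] != 0] = 0.
  rewrite measure0P//; split=> h.
    by apply: (ae_imply _ h) => s /= ->; rewrite eqxx.
  by apply: (ae_imply _ h) => s /= /negP; rewrite negbK => /eqP.
rewrite !poisson_seqs0P; split.
  move=> h; split; first by apply/(poisson_seqs0_nil mN); exact: h.
  move=> n; apply/(measure0P (power_measure mu n) (mM n)).
  have := h n.+1; rewrite power_measure_cons.
  move/(product_measure0P2 mu (power_measure mu n)) => /(_ (measurable_cons_tuple mN)).
  by apply: filterS => s /= ->; rewrite eqxx.
move=> [N0 h] [|n]; first exact/poisson_seqs0_nil.
rewrite power_measure_cons; apply/(product_measure0P2 mu (power_measure mu n)).
  exact: measurable_cons_tuple.
have := h n; move/(measure0P (power_measure mu n) (mM n)).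
by apply: filterS => s /negP; rewrite negbK => /eqP.
Qed.

End null_seqs.

Section almost_every_configuration.
Local Open Scope ereal_scope.
Context d (T : measurableType d) (R : realType).
Variable mu : {sigma_finite_measure set T -> \bar R}.
Implicit Types (A N : set (seqs T)).
Local Notation Lambda := (poisson_seqs mu).
Hypothesis meq : measurable_fun setT (fun p : T * T => p.1 == p.2).
Hypothesis mu1 : forall z, mu [set z] = 0.

Lemma ae_imply2 d' (X : measurableType d') (m : {measure set X -> \bar R})
    (P Q S : set X) : (forall x, P x -> Q x -> S x) ->
  {ae m, forall x, P x} -> {ae m, forall x, Q x} -> {ae m, forall x, S x}.
Proof. by move=> PQS; apply: filterS2. Qed.

Lemma measurable_set1_eq (z : T) : measurable [set z].
Proof.
have mz : measurable_fun setT (fun x => x == z).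
  exact: (measurableT_comp meq (g := fun x => (x, z))).
have := @measurable_preimage _ _ _ _ _ [set true] mz I.
by congr measurable; apply/seteqP; split=> x /= /eqP.
Qed.

Lemma measurable_uniq_seqs : measurable [set s : seqs T | uniq s].
Proof.
have := @measurable_preimage _ _ _ _ _ [set true] (measurable_seqs_uniq meq) I.
by congr measurable.
Qed.

Lemma measurable_pairwise (r : rel T) :
  measurable_fun setT (fun p : T * T => r p.1 p.2) ->
  measurable [set s : seqs T | pairwise r s].
Proof.
move=> mr.
have mp : measurable_fun setT (fun s : seqs T => pairwise r s).
  have mall : measurable_fun setT (fun p : T * seqs T => all (r p.1) p.2).
    have mn : measurable_fun setT (fun p : T * T => ~~ r p.1 p.2) by exact: measurable_neg.
    have := measurable_neg (measurable_seqs_has mn).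
    congr measurable_fun; apply/funext => -[x s] /=.
    by rewrite -all_predC; apply: eq_all => z /=; rewrite negbK.
  apply: (@measurable_fun_seqs1 _ _ _ _ _
    (fun q : T * (seqs T * bool) => all (r q.1) q.2.1 && q.2.2)) => //.
  apply: measurable_and.
    apply: (measurableT_comp mall (g := fun q : T * (seqs T * bool) => (q.1, q.2.1))).
    apply: measurable_fun_pair; first exact: measurable_fst.
    by apply: (measurableT_comp measurable_fst); exact: measurable_snd.
  by apply: (measurableT_comp measurable_snd); exact: measurable_snd.
have := @measurable_preimage _ _ _ _ _ [set true] mp I.
by congr measurable.
Qed.

(** By induction on the length: the points related to each member of a given
sequence form a set of full measure, as a finite intersection of such sets. *)
Lemma poisson_seqs_not_pairwise (r : rel T) :
  measurable_fun setT (fun p : T * T => r p.1 p.2) ->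
  (forall y, {ae mu, forall z, r z y}) ->
  Lambda [set s : seqs T | ~ pairwise r s] = 0.
Proof.
move=> mr r0; have mN := measurableC (measurable_pairwise mr).
have all_r (s : seq T) : {ae mu, forall z, all (r z) s}.
  elim: s => [|y s ih]; first exact: aeW.
  by move: (r0 y) ih; apply: ae_imply2 => z /= -> ->.
apply/poisson_seqs0P; elim=> [|n ih]; first by apply/(poisson_seqs0_nil mu mN) => /=; apply.
rewrite (power_measure_cons mu n [set s : seqs T | ~ pairwise r s]).
apply/(product_measure0P2 mu (power_measure mu n)).
  exact: measurable_cons_tuple.
have /(measure0P (power_measure mu n) (mN n)) := ih.
apply: ae_imply => t /= /contrapT ut.
apply/measure0P.
  exact: (measurable_ysection_set (tval t : seqs T) (measurable_cons_set mN)).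
by apply: ae_imply (all_r t) => z zt /=; rewrite zt ut.
Qed.

Lemma poisson_seqs_not_uniq : Lambda [set s : seqs T | ~ uniq s] = 0.
Proof.
have -> : [set s : seqs T | ~ uniq s] = [set s : seqs T | ~ pairwise [rel x y | x != y] s].
  by apply/seteqP; split=> s /=; rewrite uniq_pairwise.
apply: poisson_seqs_not_pairwise; first exact: measurable_neg.
move=> y; have : {ae mu, forall z, ~ [set y] z}.
  by apply/(measure0P mu (measurable_set1_eq y)); exact: mu1.
by apply: ae_imply => z /= zy; exact/eqP.
Qed.

Lemma measurable_cat_set N :
  measurable N -> measurable [set p : seqs T * seqs T | N (p.2 ++ p.1)].
Proof.
move=> mN; apply: (measurable_preimage _ mN
   (f := fun p : seqs T * seqs T => p.2 ++ p.1 : seqs T)).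
apply: (measurableT_comp (@measurable_seqs_cat _ T) (g := fun p => (p.2, p.1))).
by apply: measurable_fun_pair; [exact: measurable_snd|exact: measurable_fst].
Qed.

(** The points of [xi] are removed from the concatenation one at a time, each
removal being an instance of [poisson_seqs0_cons2]. *)
Lemma ae_cat N : measurable N -> Lambda N = 0 ->
  {ae Lambda, forall s, Lambda [set xi | N (xi ++ s)] = 0}.
Proof.
have : forall m N, measurable N -> Lambda N = 0 ->
    {ae Lambda, forall s, power_measure mu m [set xi | N (tval xi ++ s)] = 0}.
  elim=> [|m ih] {}N mN N0.
    have /measure0P -/(_ mN) := N0; apply: ae_imply => s Ns.
    by apply/(poisson_seqs0_nil mu (measurable_xsection_set s (measurable_cat_set mN))).
  have [_] := (poisson_seqs0_cons2 mu mN).1 N0.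
  move=> h.
  have mM := measurable_measure_cons mu mN.
  have M0 : Lambda [set s | mu [set z | N (z :: s)] != 0] = 0.
    apply/measure0P => //; apply: ae_imply h => s /= ->.
    by rewrite eqxx.
  have := ih _ mM M0; apply: ae_imply => s hs.
  have mNs := measurable_xsection_set s (measurable_cat_set mN).
  rewrite (power_measure_cons mu m [set xi | N (xi ++ s)]).
  apply/(product_measure0P2 mu (power_measure mu m)).
    exact: measurable_cons_tuple.
  have mMs := measurable_xsection_set s (measurable_cat_set mM).
  have /(measure0P (power_measure mu m) (mMs m)) := hs.
  by apply: ae_imply => t /= /negP; rewrite negbK => /eqP.
move=> h mN N0.
have : {ae Lambda, forall s, forall m,
    power_measure mu m [set xi | N (tval xi ++ s)] = 0}.
  by apply: ae_foralln => m; exact: h.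
by apply: ae_imply => s hs; apply/poisson_seqs0P.
Qed.

Lemma measurable_measure_cat N : measurable N ->
  measurable [set s : seqs T | Lambda [set xi | N (xi ++ s)] != 0].
Proof.
move=> mN; have mf := measurable_measure_xsection Lambda (measurable_cat_set mN).
have := measurable_preimage mf (measurableC (emeasurable_set1 0)).
by congr measurable; apply/seteqP; split=> s /= /eqP.
Qed.

Lemma measurable_has_rem N : measurable N ->
  measurable [set s : seqs T | exists2 y, y \in s & N (rem y s)].
Proof.
move=> mN.
pose g (p : seqs T * T) : bool := rem p.2 p.1 \in N.
have mg : measurable_fun setT g.
  apply: (@measurable_fun_bool _ _ _ _ true).
  rewrite setTI.
  have := @measurable_preimage _ _ _ _ (fun p : seqs T * T => rem p.2 p.1 : seqs T) N.
  rewrite (_ : g @^-1` _ = (fun p : seqs T * T => rem p.2 p.1 : seqs T) @^-1` N); last first.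
    by apply/seteqP; split=> p /=; [exact: set_mem|exact: mem_set].
  apply => //.
  apply: (measurableT_comp (measurable_seqs_rem meq) (g := fun p => (p.2, p.1))).
  by apply: measurable_fun_pair; [exact: measurable_snd|exact: measurable_fst].
have mh := measurable_seqs_has mg.
have mh' : measurable_fun setT (fun s : seqs T => has (fun z => g (s, z)) s).
  by apply: (measurableT_comp mh (g := fun s : seqs T => (s, s))); apply: measurable_fun_pair.
have := @measurable_preimage _ _ _ _ _ [set true] mh' I.
congr measurable; apply/seteqP; split=> s /=.
  by move=> /hasP[y ys] /set_mem; exists y.
by move=> [y ys Ny]; apply/hasP; exists y => //; exact: mem_set.
Qed.

(** By induction on the length: for a fixed first point [z], removing [z] leaves
the tail, and removing another point leaves [z] in front, so that the claim for the
tails concerns the slice of [N] at [z]. *)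
Lemma ae_rem N : measurable N -> Lambda N = 0 ->
  {ae Lambda, forall s : seqs T, forall y, y \in s -> ~ N (rem y s)}.
Proof.
move=> mN N0; suff : Lambda [set s : seqs T | exists2 y, y \in s & N (rem y s)] = 0.
  move/(measure0P Lambda (measurable_has_rem mN)); apply: ae_imply => s h y ys Ny.
  by apply: h; exists y.
apply/poisson_seqs0P => n; elim: n N mN N0 => [|n ih] N mN N0.
  by apply/(poisson_seqs0_nil mu (measurable_has_rem mN)); case.
rewrite (power_measure_cons mu n [set s : seqs T | exists2 y, y \in s & N (rem y s)]).
have mB := measurable_has_rem mN.
apply/(product_measure0P1 mu (power_measure mu n)).
  exact: measurable_cons_tuple.
have [_] := (poisson_seqs0_cons1 mu mN).1 N0.
apply: ae_imply => z Nz0.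
have mNz := measurable_cons_l z mN.
have mBz := measurable_cons_l z mB.
have mBz' := measurable_has_rem mNz.
apply/(measure0P (power_measure mu n) (mBz n)).
have /(measure0P (power_measure mu n) (mN n)) := (poisson_seqs0P mu N).1 N0 n.
have /(measure0P (power_measure mu n) (mBz' n)) := ih _ mNz Nz0.
apply: ae_imply2 => t h1 h2 /= [y].
have [->|zy] := eqVneq z y; first by move=> _; exact: h2.
rewrite inE eq_sym (negPf zy)/= => yt Nzy; apply: h1.
by exists y.
Qed.

(** The configurations at which a hopping operator evaluates its argument, namely
[xi] added to [s], and [xi] added to [s] with one of its points [y] moved to [x],
avoid a given null set almost surely. *)
Lemma ae_cat_product N : measurable N -> Lambda N = 0 ->
  {ae Lambda, forall s : seqs T,
     (mu \x Lambda) [set p | N (p.2 ++ s)] = 0 /\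
     forall y, y \in s -> (mu \x Lambda) [set p | N (p.2 ++ p.1 :: rem y s)] = 0}.
Proof.
move=> mN N0.
have mN1 := measurable_measure_cat mN.
have N10 : Lambda [set s | Lambda [set xi | N (xi ++ s)] != 0] = 0.
  apply/measure0P => //; apply: ae_imply (ae_cat mN N0) => s /= ->.
  by rewrite eqxx.
have mN2 := measurable_measure_cons mu mN1.
have N20 : Lambda [set s | mu [set z | Lambda [set xi | N (xi ++ (z :: s))] != 0] != 0] = 0.
  apply/measure0P => //.
  apply: ae_imply ((poisson_seqs0_cons2 mu mN1).1 N10).2 => s /= ->.
  by rewrite eqxx.
have := ae_rem mN2 N20; have := ae_cat mN N0; apply: ae_imply2 => s h1 h2; split.
  apply/(product_measure0P1 mu Lambda).
    have mNs := measurable_xsection_set s (measurable_cat_set mN).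
    exact: (measurable_preimage (f := snd) measurable_snd mNs).
  by apply: aeW => z.
move=> y ys; apply/(product_measure0P1 mu Lambda).
  have mf : measurable_fun setT
      (fun p : T * seqs T => p.2 ++ p.1 :: rem y s : seqs T).
    apply: (measurableT_comp (@measurable_seqs_cat _ T)
      (g := fun p : T * seqs T => (p.2, p.1 :: rem y s : seqs T))).
    apply: measurable_fun_pair; first exact: measurable_snd.
    by apply: measurable_seqs_cons => //; exact: measurable_fst.
  exact: measurable_preimage mf mN.
have /negP := h2 y ys; rewrite negbK => /eqP h3.
have mz := measurable_ysection_set (rem y s : seqs T) (measurable_cons_set mN1).
have /(measure0P mu mz) := h3.
by apply: ae_imply => z /= /negP; rewrite negbK => /eqP.
Qed.

Lemma ae_insert_product N : measurable N -> Lambda N = 0 ->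
  {ae Lambda, forall s : seqs T, (mu \x Lambda) [set p | N (p.2 ++ p.1 :: s)] = 0}.
Proof.
move=> mN N0.
have mN1 := measurable_measure_cat mN.
have N10 : Lambda [set s | Lambda [set xi | N (xi ++ s)] != 0] = 0.
  apply/measure0P => //; apply: ae_imply (ae_cat mN N0) => s /= ->.
  by rewrite eqxx.
apply: ae_imply ((poisson_seqs0_cons2 mu mN1).1 N10).2 => s h.
apply/(product_measure0P1 mu Lambda).
  have mf : measurable_fun setT (fun p : T * seqs T => p.2 ++ p.1 :: s : seqs T).
    apply: (measurableT_comp (@measurable_seqs_cat _ T)
      (g := fun p : T * seqs T => (p.2, p.1 :: s : seqs T))).
    apply: measurable_fun_pair; first exact: measurable_snd.
    by apply: measurable_seqs_cons => //; exact: measurable_fst.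
  exact: measurable_preimage mf mN.
have mz := measurable_ysection_set s (measurable_cons_set mN1).
have /(measure0P mu mz) := h.
by apply: ae_imply => z /= /negP; rewrite negbK => /eqP.
Qed.

End almost_every_configuration.

(** * Lebesgue measure on row vectors *)

Section lebesgue_rV_theory.
Context (R : realType) (d : nat).

Lemma measurable_fun_eq_rV :
  measurable_fun setT (fun p : 'rV[R]_d * 'rV[R]_d => p.1 == p.2).
Proof.
apply: (@measurable_fun_bool _ _ _ _ true); rewrite setTI.
rewrite (_ : _ @^-1` _ = \bigcap_(l in [set: 'I_d])
  [set p : 'rV[R]_d * 'rV[R]_d | p.1 ord0 l == p.2 ord0 l]); last first.
  apply/seteqP; split=> p /=; first by move=> /eqP pE l _ /=; rewrite pE.
  by move=> h; apply/eqP/rowP => l; exact/eqP/(h l).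
apply: fin_bigcap_measurable; first exact: finite_finset.
move=> l _; rewrite -[X in measurable X]setTI.
have m1 : measurable_fun setT (fun p : 'rV[R]_d * 'rV[R]_d => p.1 ord0 l : R).
  exact: (measurableT_comp (@measurable_rV_coord _ R d l) measurable_fst).
have m2 : measurable_fun setT (fun p : 'rV[R]_d * 'rV[R]_d => p.2 ord0 l : R).
  exact: (measurableT_comp (@measurable_rV_coord _ R d l) measurable_snd).
have := measurable_fun_eqr m1 m2.
by move/(_ measurableT [set true] I); congr measurable.
Qed.

Lemma measurable_rVB :
  measurable_fun setT (fun p : 'rV[R]_d * 'rV[R]_d => p.1 - p.2).
Proof.
apply: measurable_fun_rVP => i.
rewrite (_ : (fun _ => _) =
    fun p : 'rV[R]_d * 'rV[R]_d => p.1 ord0 i - p.2 ord0 i : R); last first.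
  by apply/funext => p; rewrite !mxE.
apply: measurable_funB.
  exact: (measurableT_comp (@measurable_rV_coord _ R d i) measurable_fst).
exact: (measurableT_comp (@measurable_rV_coord _ R d i) measurable_snd).
Qed.

Lemma measurable_row_of_tuple : measurable_fun setT (@row_of_tuple R d).
Proof.
apply: measurable_fun_rVP => i.
rewrite (_ : (fun _ => _) = fun t => tnth t i); first exact: measurable_tnth.
by apply/funext => t; rewrite mxE.
Qed.

Lemma ge0_integral_lebesgue_rV (f : 'rV[R]_d -> \bar R) :
  measurable_fun setT f -> (forall x, 0 <= f x)%E ->
  (\int[lebesgue_rV]_x f x =
   \int[power_measure (@lebesgue_measure R) d]_t f (row_of_tuple t))%E.
Proof.
move=> mf f0; exact: (ge0_integral_pushforward measurable_row_of_tuple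
  (power_measure (@lebesgue_measure R) d) measurableT mf).
Qed.

End lebesgue_rV_theory.

Section lebesgue_rV_translation.
Context (R : realType).

Lemma lebesgue_rV_set1 d (z : 'rV[R]_d) : (0 < d)%N -> lebesgue_rV [set z] = 0%E.
Proof.
move=> d0; rewrite /lebesgue_rV /pushforward.
case: d d0 z => // n _ z.
have m1 : measurable ([set z ord0 ord0] : set (measurableTypeR R)) by exact: measurable_set1.
pose B : set ((measurableTypeR R) * n.-tuple (measurableTypeR R)) := [set z ord0 ord0] `*` setT.
have mB : measurable B by exact: measurableX.
apply/eqP; rewrite eq_le measure_ge0 andbT.
have B0 : (lebesgue_measure \x power_measure (@lebesgue_measure R) n)%E B = 0%E.
  rewrite [LHS](product_measure1E lebesgue_measure (power_measure lebesgue_measure n) m1)//.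
  apply: etrans (mul0e _); congr (_ * _)%E.
  exact: lebesgue_measure_set1.
rewrite -B0.
apply: (le_measure (lebesgue_measure \x power_measure (@lebesgue_measure R) n)%E).
- rewrite inE.
  have mz := measurable_set1_eq (@measurable_fun_eq_rV R n.+1) z.
  have mr' := measurable_preimage (@measurable_row_of_tuple R n.+1) mz.
  exact: (measurable_preimage (@measurable_tuple_cons _ (measurableTypeR R) n) mr').
- by rewrite inE.
- move=> [x t] /= zE; split => //=.
  by rewrite -zE mxE.
Qed.

(** The shifted measure agrees with Lebesgue measure on intervals. *)
Lemma lebesgue_measure_shift (c : R) (A : set (measurableTypeR R)) :
  measurable A ->
  lebesgue_measure [set x : measurableTypeR R | A (x + c)] = lebesgue_measure A.
Proof.
have mf : measurable_fun setT
    ((fun x : R => x + c) : measurableTypeR R -> measurableTypeR R).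
  by apply: measurable_funD => //; exact: measurable_cst.
move=> mA; symmetry.
apply: (@lebesgue_measure_unique R
  (measure_function_pushforward__canonical__measure_function_Measure lebesgue_measure mf)) => //.
move=> _ [[a b] _ <-]/=; rewrite /pushforward/=.
rewrite (_ : _ @^-1` _ = [set` `]a - c, b - c]]); last first.
  by apply/seteqP; split => x /=; rewrite !in_itv/= ltrBlDr lerBrDr.
by rewrite !lebesgue_measure_itv/= !lte_fin ltrD2r -!EFinB opprB addrA subrK.
Qed.

Lemma ge0_integral_lebesgue_shift (c : R) (f : measurableTypeR R -> \bar R) :
  measurable_fun setT f -> (forall x, 0 <= f x)%E ->
  (\int[lebesgue_measure]_x f ((x : R) + c)%R = \int[lebesgue_measure]_x f x)%E.
Proof.
have mg : measurable_fun setT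
    ((fun x : R => x + c) : measurableTypeR R -> measurableTypeR R).
  by apply: measurable_funD => //; exact: measurable_cst.
move=> mf f0.
rewrite -[LHS](ge0_integral_pushforward mg lebesgue_measure measurableT mf)//.
apply: eq_measure_integral => A mA _.
exact: lebesgue_measure_shift.
Qed.

Definition shift_tuple n (c t : n.-tuple (measurableTypeR R)) :
    n.-tuple (measurableTypeR R) :=
  [tuple (tnth t i : R) + tnth c i | i < n].

Lemma measurable_shift_tuple n (c : n.-tuple (measurableTypeR R)) :
  measurable_fun setT (shift_tuple c).
Proof.
apply/measurable_fun_tnthP => i.
rewrite (_ : _ \o _ = fun t : n.-tuple (measurableTypeR R) =>
    (tnth t i : R) + tnth c i); last first.
  by apply/funext => s /=; rewrite tnth_mktuple.
apply: measurable_funD; last exact: measurable_cst.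
exact: measurable_tnth.
Qed.

Lemma ge0_integral_power_measure_shift n (c : n.-tuple (measurableTypeR R))
    (f : n.-tuple (measurableTypeR R) -> \bar R) :
  measurable_fun setT f -> (forall x, 0 <= f x)%E ->
  (\int[power_measure (@lebesgue_measure R) n]_t f (shift_tuple c t) =
   \int[power_measure (@lebesgue_measure R) n]_t f t)%E.
Proof.
elim: n c f => [|n ih] c f mf f0.
  by rewrite !ge0_integral_power_measure0// (tuple0 (shift_tuple _ _)).
case/tupleP: c => c0 c.
have sE (z : measurableTypeR R) (t : n.-tuple (measurableTypeR R)) :
    shift_tuple [tuple of c0 :: c] [tuple of z :: t] =
    [tuple of ((z : R) + c0 : measurableTypeR R) :: shift_tuple c t].
  apply: eq_from_tnth => i; rewrite tnth_mktuple.
  case: (unliftP ord0 i) => [j ->|->]; last by rewrite !tnth0.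
  by rewrite !tnthS tnth_mktuple.
have mfz (z : measurableTypeR R) : measurable_fun setT
    (fun t : n.-tuple (measurableTypeR R) => f [tuple of z :: t]).
  apply: (measurableT_comp mf).
  by apply: measurable_cons => //; exact: measurable_id.
have mF : measurable_fun setT (fun z : measurableTypeR R =>
    \int[power_measure (@lebesgue_measure R) n]_t f [tuple of z :: t])%E.
  apply: (measurable_fun_fubini_tonelli_F (m2 := power_measure (@lebesgue_measure R) n)
    (fun p : measurableTypeR R * n.-tuple (measurableTypeR R) => f [tuple of p.1 :: p.2])) => //.
  exact: (measurableT_comp mf (@measurable_tuple_cons _ _ n)).
rewrite ge0_integral_power_measureS1//; last first.
  by apply: (measurableT_comp mf); exact: measurable_shift_tuple.
apply: etrans (esym (ge0_integral_power_measureS1 lebesgue_measure mf f0)).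
apply: etrans (ge0_integral_lebesgue_shift c0 mF _); last first.
  by move=> x; exact: integral_ge0.
apply: eq_integral => z _; rewrite -[RHS](ih c)//.
by apply: eq_integral => t _; rewrite sE.
Qed.

Lemma measurable_rV_shift d (c : 'rV[R]_d) : measurable_fun setT (fun x : 'rV[R]_d => x + c).
Proof.
apply: measurable_fun_rVP => i.
rewrite (_ : (fun _ => _) = fun x : 'rV[R]_d => x ord0 i + c ord0 i : R); last first.
  by apply/funext => x; rewrite mxE.
apply: measurable_funD; last exact: measurable_cst.
exact: measurable_rV_coord.
Qed.

Lemma ge0_integral_lebesgue_rV_shift d (c : 'rV[R]_d) (f : 'rV[R]_d -> \bar R) :
  measurable_fun setT f -> (forall x, 0 <= f x)%E ->
  (\int[lebesgue_rV]_x f (x + c)%R = \int[lebesgue_rV]_x f x)%E.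
Proof.
move=> mf f0; rewrite !ge0_integral_lebesgue_rV//; last first.
  by apply: (measurableT_comp mf); exact: measurable_rV_shift.
have mfr := measurableT_comp mf (@measurable_row_of_tuple R d).
apply: etrans (ge0_integral_power_measure_shift
  [tuple c ord0 i : measurableTypeR R | i < d] mfr _); last by move=> t; exact: f0.
apply: eq_integral => t _; congr f; apply/rowP => i.
by rewrite !mxE tnth_mktuple tnth_mktuple.
Qed.

End lebesgue_rV_translation.

(** * Configurations read on sequences *)

(** An exceptional null set is assembled from one for each length. *)
Lemma ae_poisson_seqs_slices d (T : measurableType d) (R : realType)
    (mu : {sigma_finite_measure set T -> \bar R}) (P : set (seqs T)) :
  {ae poisson_seqs mu, forall s, P s} <->
  forall n, {ae power_measure mu n, forall x, P (tval x)}.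
Proof.
split=> [[N [mN N0 PN]] n|h].
  exists [set x | N (tval x)]; split; first exact: mN.
    by move/poisson_seqs0P : N0; exact.
  by move=> x /= nP; exact: PN.
have N_ n : {N : set (n.-tuple T) | measurable N /\ power_measure mu n N = 0%E &
    forall x : n.-tuple T, ~ P (tval x) -> N x}.
  by apply: cid2; have [N [mN N0 PN]] := h n; exists N.
pose N : set (seqs T) := [set s | s2val (N_ (size s)) (tuple_of_seqs (size s) s)].
have NE n : [set x : n.-tuple T | N (tval x)] = s2val (N_ n).
  apply/seteqP; split => x; rewrite /N/= size_tuple tval_tuple_of_seqs//.
exists N; split.
- suff : seqs_measurable N by [].
  by move=> n; rewrite NE; exact: (s2valP (N_ n)).1.
- by apply/poisson_seqs0P => n; rewrite NE; exact: (s2valP (N_ n)).2.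
- by move=> s nP; rewrite /N/=; apply: (s2valP' (N_ (size s))); rewrite tuple_of_seqsK.
Qed.

Section configurations_as_sequences.
Context (R : realType) (d : nat).
Hypothesis d_gt0 : (0 < d)%N.
Local Notation T := 'rV[R]_d.
Local Notation Gamma0 := (Gamma0 R d).
Local Notation mu := (@lebesgue_rV R d).
Local Notation Lambda := (poisson_seqs mu).

Definition conf (s : seqs T) : Gamma0 := [fset z in (s : seq T)]%fset.

Lemma mem_conf (s : seq T) z : (z \in conf s) = (z \in s).
Proof. by rewrite /conf inE. Qed.

Lemma conf_undup (s : seq T) : conf (undup s) = conf s.
Proof. by apply/fsetP => z; rewrite !mem_conf mem_undup. Qed.

Lemma conf_cat (s t : seq T) : conf (s ++ t) = (conf s `|` conf t)%fset.
Proof. by apply/fsetP => z; rewrite in_fsetU !mem_conf mem_cat. Qed.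

Lemma conf_cons (x : T) (s : seq T) : conf (x :: s) = (x |` conf s)%fset.
Proof. by apply/fsetP => z; rewrite in_fset1U !mem_conf inE. Qed.

Lemma conf_filter (y : T) (s : seq T) :
  conf [seq z <- s | z != y] = (conf s `\ y)%fset.
Proof. by apply/fsetP => z; rewrite in_fsetD1 !mem_conf mem_filter. Qed.

Lemma perm_conf (s : seq T) : perm_eq (conf s) (undup s).
Proof.
apply: uniq_perm; rewrite ?undup_uniq ?fset_uniq// => z.
by rewrite mem_undup; exact: mem_conf.
Qed.

Lemma measurable_conf : measurable_fun setT conf.
Proof.
move=> _ A mA; rewrite setTI.
have mB : measurable [set s : seqs T | uniq s /\ A (conf s)] by exact: mA.
have mu := measurable_seqs_undup (@measurable_fun_eq_rV R d).
have := measurable_preimage mu mB.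
congr measurable; apply/seteqP; split=> s /=.
  by move=> [_]; rewrite conf_undup.
by rewrite conf_undup undup_uniq.
Qed.

(** The sigma-algebra of the configurations is defined by the traces of the
preimages under [conf] on the tuples without repetition. *)
Lemma measurable_fun_conf d1 (Y : measurableType d1) (f : Gamma0 -> Y) :
  measurable_fun setT f <-> measurable_fun setT (f \o conf).
Proof.
split=> [mf|mf _ A mA]; first exact: measurableT_comp mf measurable_conf.
rewrite setTI; suff : Gamma0_measurable (f @^-1` A) by [].
move=> n.
have := measurableI _ _ (measurable_uniq_seqs (@measurable_fun_eq_rV R d))
  (measurable_preimage mf mA).
by move/(_ n).
Qed.

(** The left-hand side counts only the sequences without repetition, which have
full measure because points are null sets. *)
Lemma lebesgue_poissonE (A : set Gamma0) : measurable A ->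
  lebesgue_poisson A = Lambda (conf @^-1` A).
Proof.
move=> mA; rewrite poisson_seqsE; apply: eq_eseriesr => n _.
congr (_ * _)%E; rewrite /power_seqs /lebesgue_conf.
have mcA := measurable_preimage measurable_conf mA.
have mU := measurable_uniq_seqs (@measurable_fun_eq_rV R d).
have U0 := (poisson_seqs0P mu [set s | ~ uniq s]).1 (poisson_seqs_not_uniq
  (@measurable_fun_eq_rV R d) (fun z => lebesgue_rV_set1 z d_gt0)) n.
pose pm := power_measure mu n.
pose B : set (n.-tuple T) := [set x | A (conf (tval x))].
pose U : set (n.-tuple T) := [set x | uniq (tval x)].
have mB : measurable B by exact: mcA.
have mU' : measurable U by exact: mU.
have BU0 : pm (B `\` U) = 0%E.
  apply/eqP; rewrite eq_le measure_ge0 andbT -[leRHS]U0.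
  apply: (le_measure (power_measure mu n)); rewrite ?inE.
  - exact: measurableD.
  - exact: (measurableC mU n).
  - by move=> x [].
have BE : pm B = pm (B `&` U).
  by rewrite -[RHS]add0e -BU0; exact: (measureDI (power_measure mu n) mB mU').
by apply: etrans (esym BE); rewrite setIC.
Qed.

Lemma ge0_integral_lebesgue_poisson (f : Gamma0 -> \bar R) :
  measurable_fun setT f -> (forall eta, 0 <= f eta)%E ->
  (\int[lebesgue_poisson]_eta f eta = \int[Lambda]_s f (conf s))%E.
Proof.
move=> mf f0.
rewrite -[RHS](ge0_integral_pushforward measurable_conf Lambda measurableT mf)//.
apply: eq_measure_integral => [|m A mA _]; first exact: measurable_conf.
exact: lebesgue_poissonE.
Qed.

Lemma Rintegral_lebesgue_poisson (f : Gamma0 -> R) : measurable_fun setT f ->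
  \int[lebesgue_poisson]_eta f eta = \int[Lambda]_s f (conf s).
Proof.
move=> /measurable_EFinP mf; rewrite /Rintegral; congr fine.
rewrite [LHS]integralE [RHS]integralE; congr (_ - _)%E.
  apply: etrans (ge0_integral_lebesgue_poisson (measurable_funepos mf) _) _ => //.
  by apply: eq_integral => s _; rewrite ?funeposE ?funenegE.
apply: etrans (ge0_integral_lebesgue_poisson (measurable_funeneg mf) _) _ => //.
  by apply: eq_integral => s _; rewrite ?funeposE ?funenegE.
Qed.

Lemma ae_lebesgue_poisson (P : set Gamma0) :
  {ae lebesgue_poisson, forall eta, P eta} -> {ae Lambda, forall s, P (conf s)}.
Proof.
move=> [N [mN N0 PN]]; exists (conf @^-1` N); split.
- exact: measurable_preimage measurable_conf mN.
- by rewrite -lebesgue_poissonE.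
- by move=> s /= nP; apply: PN.
Qed.

(** The closed ball of radius [B] of the space of weight [theta], read on
sequences. *)
Definition Kbound (theta B : R) (k : Gamma0 -> R) : Prop :=
  {ae Lambda, forall s, `|k (conf s)| <= B * expR (- (theta * (size s)%:R))}.

Lemma nu_le n (k : Gamma0 -> R) (c : R) : 0 <= c -> (nu n k <= c%:E)%E <->
  {ae power_measure mu n, forall x, `|k (conf (tval x))| <= c}.
Proof.
move=> c0; case: n => [|n].
  have E : conf (tval ([tuple] : 0.-tuple T)) = fset0.
    by apply/fsetP => z; rewrite mem_conf in_fset0.
  rewrite /nu lee_fin; split=> [kc|].
    by apply: aeW => x; rewrite tuple0 E.
  move=> [N [mN N0 kN]]; rewrite leNgt; apply/negP => ck.
  have : N [tuple] by apply: kN => /=; rewrite E leNgt ck.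
  move=> NN; move: N0; rewrite /= diracE mem_set//= => /eqP.
  by rewrite onee_eq0.
rewrite /nu unlock; case: ifPn => [mu0|].
  split; first by move/ess_supP; apply: ae_imply => x /=; rewrite lee_fin.
  by move=> h; apply/ess_supP; apply: ae_imply h => x /=; rewrite lee_fin.
rewrite -leNgt measure_le0 => /eqP m0; rewrite lee_fin c0; split=> // _.
exact: measure0_ae.
Qed.

(** The supremum over [n] and the essential suprema over the [n]-point
configurations amount to one bound almost everywhere on sequences. *)
Lemma Knorm_le theta (B : R) (k : Gamma0 -> R) : 0 <= B ->
  (Knorm theta k <= B%:E)%E <-> Kbound theta B k.
Proof.
move=> B0.
have E n : ((expR (theta * n%:R))%:E * nu n k <= B%:E)%E =
    (nu n k <= (B * expR (- (theta * n%:R)))%:E)%E.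
  by rewrite expRN [B * _]mulrC EFinM lee_pdivlMl ?expR_gt0.
have B0n n : 0 <= B * expR (- (theta * n%:R)) by rewrite mulr_ge0// expR_ge0.
rewrite /Kbound ae_poisson_seqs_slices; split=> h.
  move=> n; have : (nu n k <= (B * expR (- (theta * n%:R)))%:E)%E.
    rewrite -E; apply: le_trans h; apply: ereal_sup_ubound.
    by exists n.
  by move/(nu_le n k (B0n n)); apply: ae_imply => x; rewrite size_tuple.
apply: ge_ereal_sup => _ [n _ <-]; rewrite E; apply/(nu_le n k (B0n n)).
by have := h n; apply: ae_imply => x; rewrite size_tuple.
Qed.

End configurations_as_sequences.

(** * Iterated integrals *)

Section iterated_integrals.
Context d1 d2 (X : measurableType d1) (Y : measurableType d2) (R : realType).
Variable m1 : {sigma_finite_measure set X -> \bar R}.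
Variable m2 : {sigma_finite_measure set Y -> \bar R}.
Implicit Types f : X * Y -> R.

Lemma measurable_slice_r f y : measurable_fun setT f ->
  measurable_fun setT (fun x => f (x, y)).
Proof. by move=> mf; apply: (measurableT_comp mf); exact: measurable_fun_pair. Qed.

Lemma measurable_Rintegral_l f : measurable_fun setT f ->
  measurable_fun setT (fun x => \int[m2]_y f (x, y)).
Proof.
move=> /measurable_EFinP mf.
have mp := measurable_fun_fubini_tonelli_F (m2 := m2) _ (measurable_funepos mf) (fun=> funepos_ge0 _ _).
have mn := measurable_fun_fubini_tonelli_F (m2 := m2) _ (measurable_funeneg mf) (fun=> funeneg_ge0 _ _).
have := measurableT_comp (@fine_measurable R setT measurableT) (emeasurable_funB mp mn).
congr measurable_fun; apply/funext => x /=; rewrite /Rintegral [in RHS]integralE.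
congr fine; congr (_ - _)%E; apply: eq_integral => y _.
  by rewrite !funeposE.
by rewrite !funenegE.
Qed.

Lemma measurable_Rintegral_r f : measurable_fun setT f ->
  measurable_fun setT (fun y => \int[m1]_x f (x, y)).
Proof.
move=> /measurable_EFinP mf.
have mp := measurable_fun_fubini_tonelli_G (m1 := m1) _ (measurable_funepos mf) (fun=> funepos_ge0 _ _).
have mn := measurable_fun_fubini_tonelli_G (m1 := m1) _ (measurable_funeneg mf) (fun=> funeneg_ge0 _ _).
have := measurableT_comp (@fine_measurable R setT measurableT) (emeasurable_funB mp mn).
congr measurable_fun; apply/funext => x /=; rewrite /Rintegral [in RHS]integralE.
congr fine; congr (_ - _)%E; apply: eq_integral => y _.
  by rewrite !funeposE.
by rewrite !funenegE.
Qed.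

Lemma le_normr_Rintegral_ereal d (Z : measurableType d)
    (m : {measure set Z -> \bar R}) (f : Z -> R) : measurable_fun setT f ->
  (`|\int[m]_z f z|%:E <= \int[m]_z `|(f z)%:E|)%E.
Proof.
move=> mf; apply: (@le_trans _ _ `|\int[m]_z (f z)%:E|%E).
  by rewrite /Rintegral; case: (\int[m]_z (f z)%:E)%E => //=; rewrite normr0 leey.
by apply: le_abse_integral => //; exact/measurable_EFinP.
Qed.

Lemma integrable_Rintegral_r f : measurable_fun setT f ->
  (m1 \x m2)%E.-integrable setT (EFin \o f) ->
  m2.-integrable setT (EFin \o (fun y => \int[m1]_x f (x, y))).
Proof.
move=> mf; move/measurable_EFinP: (mf) => mf' /(integrable21ltyP m1 m2 mf') foo.
apply/integrableP; split; first exact/measurable_EFinP/measurable_Rintegral_r.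
apply: le_lt_trans foo; apply: ge0_le_integral => //.
- by apply/measurableT_comp => //; exact/measurable_EFinP/measurable_Rintegral_r.
- apply: (measurable_fun_fubini_tonelli_G (m1 := m1) (fun p => `|(f p)%:E|%E)) => //.
  exact: measurableT_comp.
- by move=> x _; apply: le_normr_Rintegral_ereal; exact: measurable_slice_r.
Qed.

Lemma Rintegral_prod_l f : measurable_fun setT f ->
  (m1 \x m2)%E.-integrable setT (EFin \o f) ->
  \int[(m1 \x m2)%E]_p f p = \int[m1]_x \int[m2]_y f (x, y).
Proof.
move=> mf intf; rewrite /Rintegral -(integral12_prod_meas1 intf); congr fine.
apply: ae_eq_integral => //.
- exact: (measurable_fubini_F intf).
- exact/measurable_EFinP/measurable_Rintegral_l.
- apply: ae_imply (ae_integrable1 intf) => x intfx _.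
  by rewrite fineK//; exact: (integrable_fin_num measurableT intfx).
Qed.

Lemma Rintegral_prod_r f : measurable_fun setT f ->
  (m1 \x m2)%E.-integrable setT (EFin \o f) ->
  \int[(m1 \x m2)%E]_p f p = \int[m2]_y \int[m1]_x f (x, y).
Proof.
move=> mf intf; rewrite /Rintegral -(integral21_prod_meas1 intf); congr fine.
apply: ae_eq_integral => //.
- exact: (measurable_fubini_G intf).
- exact/measurable_EFinP/measurable_Rintegral_r.
- apply: ae_imply (ae_integrable2 intf) => x intfx _.
  by rewrite fineK//; exact: (integrable_fin_num measurableT intfx).
Qed.

End iterated_integrals.

Section Rintegral_theory.
Context d (X : measurableType d) (R : realType).
Variable m : {measure set X -> \bar R}.

(** Stated with the integrability of the product, which is what Fubini's theorem
provides; when the constant vanishes, both sides are zero. *)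
Lemma integrable_RintegralZl (c : R) (f : X -> R) :
  m.-integrable setT (EFin \o (fun x => c * f x)) ->
  \int[m]_x (c * f x) = c * \int[m]_x f x.
Proof.
have [->|c0] := eqVneq c 0.
  rewrite mul0r => _; under eq_Rintegral do rewrite mul0r.
  by rewrite Rintegral_cst// mul0r.
move=> /(integrableZl measurableT c^-1) intf; apply: RintegralZl => //.
apply: eq_integrable intf => // x _ /=.
by rewrite -EFinM mulKf.
Qed.

Lemma Rintegral_sum (I : eqType) (s : seq I) (f : I -> X -> R) :
  (forall i, i \in s -> m.-integrable setT (EFin \o f i)) ->
  m.-integrable setT (EFin \o (fun x => \sum_(i <- s) f i x)) /\
  \int[m]_x (\sum_(i <- s) f i x) = \sum_(i <- s) \int[m]_x f i x.
Proof.
elim: s => [|i s ih] intf.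
  under eq_fun do rewrite big_nil; rewrite big_nil.
  split; first exact: integrable0.
  by rewrite Rintegral_cst// mul0r.
have [intS SE] := ih (fun j js => intf j (@mem_behead _ (i :: s) j js)).
have inti := intf i (mem_head _ _).
split.
  apply: eq_integrable (integrableD measurableT inti intS) => // x _ /=.
  by rewrite big_cons EFinD.
rewrite big_cons -SE -RintegralD//.
by apply: eq_Rintegral => x _; rewrite big_cons.
Qed.

Lemma ae_eq_Rintegral (f g : X -> R) :
  measurable_fun setT f -> measurable_fun setT g ->
  {ae m, forall x, f x = g x} -> \int[m]_x f x = \int[m]_x g x.
Proof.
move=> mf mg fg; rewrite /Rintegral; congr fine; apply: ae_eq_integral => //.
- exact/measurable_EFinP.
- exact/measurable_EFinP.
- by apply: ae_imply fg => x -> _.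
Qed.

End Rintegral_theory.

(** * Hopping operators *)

Section measurable_seqs_composition.
Context d (T : measurableType d) d1 (X : measurableType d1).
Hypothesis meq : measurable_fun setT (fun p : T * T => p.1 == p.2).

Lemma measurable_fun_cat (f g : X -> seqs T) :
  measurable_fun setT f -> measurable_fun setT g ->
  measurable_fun setT (fun x => f x ++ g x : seqs T).
Proof.
move=> mf mg; apply: (measurableT_comp (@measurable_seqs_cat _ T) (g := fun x => (f x, g x))).
exact: measurable_fun_pair.
Qed.

Lemma measurable_fun_filter (f : X -> T) (g : X -> seqs T) :
  measurable_fun setT f -> measurable_fun setT g ->
  measurable_fun setT (fun x => [seq z <- g x | z != f x] : seqs T).
Proof.
move=> mf mg; apply: (measurableT_comp (measurable_seqs_filter meq) (g := fun x => (f x, g x))).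
exact: measurable_fun_pair.
Qed.

Lemma measurable_fun_undup_sum (R : realType) (g : X * T -> R) (f : X -> seqs T) :
  measurable_fun setT g -> measurable_fun setT f ->
  measurable_fun setT (fun x => \sum_(y <- undup (f x)) g (x, y)).
Proof.
move=> mg mf.
apply: (@measurableT_comp _ _ _ _ _ _ _ _ (fun x => (x, undup (f x) : seqs T))
  (measurable_seqs_sum mg)).
apply: measurable_fun_pair => //.
by apply: (measurableT_comp (measurable_seqs_undup meq)).
Qed.

Lemma measurable_fun_fst d2 d3 (Y : measurableType d2) (Z : measurableType d3)
    (f : X -> Y * Z) :
  measurable_fun setT f -> measurable_fun setT (fun x => (f x).1).
Proof. by move=> mf; exact: measurableT_comp measurable_fst mf. Qed.

Lemma measurable_fun_snd d2 d3 (Y : measurableType d2) (Z : measurableType d3)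
    (f : X -> Y * Z) :
  measurable_fun setT f -> measurable_fun setT (fun x => (f x).2).
Proof. by move=> mf; exact: measurableT_comp measurable_snd mf. Qed.

End measurable_seqs_composition.

Ltac measurable_coordinates := repeat first
  [ exact: measurable_id | exact: measurable_cst
  | apply: measurable_fun_pair | apply: measurable_fun_cat
  | apply: measurable_seqs_cons
  | apply: measurable_fun_filter; [exact: measurable_fun_eq_rV|idtac|idtac]
  | match goal with
    | |- measurable_fun _ (fun x => fst (@?f x)) => apply: (measurable_fun_fst (f := f))
    | |- measurable_fun _ (fun x => snd (@?f x)) => apply: (measurable_fun_snd (f := f))
    end ].

Section hop_operator.
Context (R : realType) (d : nat).
Hypothesis d_gt0 : (0 < d)%N.
Local Notation T := 'rV[R]_d.
Local Notation Gamma0 := (Gamma0 R d).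
Local Notation mu := (@lebesgue_rV R d).
Local Notation Lambda := (poisson_seqs mu).

(** The common form of the two operators ([Lren_hop], [LV_hop]): a jump
to [y] is weighted by [p y], which depends on the points around it, and by [q y],
which depends on the added points. *)
Definition hop (a : T -> R) (p q : T -> Gamma0 -> R) (k : Gamma0 -> R)
    (eta : Gamma0) : R :=
  \sum_(y <- eta) (\int[lebesgue_rV]_x
      (a (x - y) * p y (x |` (eta `\ y))%fset *
       (\int[lebesgue_poisson]_xi
          (q y xi * k (xi `|` (x |` (eta `\ y)))%fset))))
  - \int[lebesgue_poisson]_xi
      (k (xi `|` eta)%fset *
       \sum_(x <- eta) (\int[lebesgue_rV]_y (a (x - y) * p y eta * q y xi))).

Variables (a : T -> R) (p q : T -> Gamma0 -> R).
Hypothesis ma : measurable_fun setT a.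
Hypothesis mp : measurable_fun setT (fun r : T * seqs T => p r.1 (conf r.2)).
Hypothesis mq : measurable_fun setT (fun r : T * seqs T => q r.1 (conf r.2)).

Lemma measurable_fun_compB d1 (X : measurableType d1) (f g : X -> T) :
  measurable_fun setT f -> measurable_fun setT g ->
  measurable_fun setT (fun x => a (f x - g x)).
Proof.
move=> mf mg; apply: (measurableT_comp ma (g := fun x => f x - g x)).
apply: (measurableT_comp (@measurable_rVB R d) (g := fun x => (f x, g x))).
exact: measurable_fun_pair.
Qed.

Lemma measurable_fun_conf2 (u : T -> Gamma0 -> R) d1 (X : measurableType d1)
    (f : X -> T) (g : X -> seqs T) :
  measurable_fun setT (fun r : T * seqs T => u r.1 (conf r.2)) ->
  measurable_fun setT f -> measurable_fun setT g ->
  measurable_fun setT (fun x => u (f x) (conf (g x))).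
Proof.
move=> mu' mf mg; apply: (measurableT_comp mu' (g := fun x => (f x, g x))).
exact: measurable_fun_pair.
Qed.

Lemma measurable_fun_conf1 (k : Gamma0 -> R) d1 (X : measurableType d1)
    (g : X -> seqs T) :
  measurable_fun setT k -> measurable_fun setT g ->
  measurable_fun setT (fun x => k (conf (g x))).
Proof.
by move=> /measurable_fun_conf mk mg; exact: (measurableT_comp mk mg).
Qed.

(** The operator [hop] with configurations replaced by sequences; [undup] and the
filter make it independent of their order and multiplicities. *)
Definition hop_seqs (k : Gamma0 -> R) (s : seqs T) : R :=
  \sum_(y <- undup s) (\int[mu]_x (a (x - y) * p y (conf (x :: [seq z <- s | z != y])) *
     \int[Lambda]_xi (q y (conf xi) * k (conf (xi ++ x :: [seq z <- s | z != y])))))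
  - \int[Lambda]_xi (k (conf (xi ++ s)) *
      \sum_(y <- undup s) \int[mu]_z (a (y - z) * p z (conf s) * q z (conf xi))).

Lemma hop_conf (k : Gamma0 -> R) (s : seqs T) : measurable_fun setT k ->
  hop a p q k (conf s) = hop_seqs k s.
Proof.
move=> mk; rewrite /hop /hop_seqs; congr (_ - _).
  rewrite (perm_big _ (perm_conf s))/=; apply: eq_bigr => y _.
  apply: eq_Rintegral => x _.
  rewrite -conf_filter -conf_cons; congr (_ * _).
  rewrite Rintegral_lebesgue_poisson//.
    by apply: eq_Rintegral => xi _; rewrite conf_cat.
  apply/measurable_fun_conf.
  rewrite (_ : _ \o _ = fun xi : seqs T => q y (conf xi) *
     k (conf (xi ++ x :: [seq z <- s | z != y]))); last first.
    by apply/funext => xi /=; rewrite conf_cat.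
  apply: measurable_funM.
    by apply: (measurable_fun_conf2 mq) => //; exact: measurable_cst.
  apply: measurable_fun_conf1 => //.
  by apply: measurable_fun_cat => //; exact: measurable_cst.
rewrite Rintegral_lebesgue_poisson//.
  by apply: eq_Rintegral => xi _; rewrite conf_cat (perm_big _ (perm_conf s)).
apply/measurable_fun_conf.
rewrite (_ : _ \o _ = fun xi : seqs T => k (conf (xi ++ s)) *
    \sum_(y <- undup s) \int[mu]_z (a (y - z) * p z (conf s) * q z (conf xi))); last first.
  by apply/funext => xi /=; rewrite conf_cat (perm_big _ (perm_conf s)).
apply: measurable_funM.
  apply: measurable_fun_conf1 => //.
  by apply: measurable_fun_cat => //; exact: measurable_cst.
apply: measurable_sum => y.
apply: (measurable_Rintegral_r mu (f := fun r : T * seqs T =>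
  a (y - r.1) * p r.1 (conf s) * q r.1 (conf r.2))).
apply: measurable_funM; last exact: mq.
apply: measurable_funM.
  by apply: measurable_fun_compB => //; exact: measurable_fst.
by apply: (measurable_fun_conf2 mp) => //; exact: measurable_fst.
Qed.

Lemma measurable_hop (k : Gamma0 -> R) :
  measurable_fun setT k -> measurable_fun setT (hop a p q k).
Proof.
move=> mk; apply/measurable_fun_conf.
rewrite (_ : _ \o _ = hop_seqs k); last first.
  by apply/funext => s /=; rewrite hop_conf.
apply: measurable_funB.
  pose F (r : seqs T * T) := \int[mu]_x (a (x - r.2) * p r.2 (conf (x :: [seq z <- r.1 | z != r.2])) *
     \int[Lambda]_xi (q r.2 (conf xi) * k (conf (xi ++ x :: [seq z <- r.1 | z != r.2])))).
  suff mF : measurable_fun setT F.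
    exact: (measurable_fun_undup_sum (@measurable_fun_eq_rV R d) mF).
  apply: (measurable_Rintegral_l mu (f := fun w : (seqs T * T) * T =>
    a (w.2 - w.1.2) * p w.1.2 (conf (w.2 :: [seq z <- w.1.1 | z != w.1.2])) *
     \int[Lambda]_xi (q w.1.2 (conf xi) * k (conf (xi ++ w.2 :: [seq z <- w.1.1 | z != w.1.2]))))).
  apply: measurable_funM.
    apply: measurable_funM.
      by apply: measurable_fun_compB; measurable_coordinates.
    by apply: (measurable_fun_conf2 mp); measurable_coordinates.
  apply: (measurable_Rintegral_l Lambda (f := fun v : ((seqs T * T) * T) * seqs T =>
    q v.1.1.2 (conf v.2) * k (conf (v.2 ++ v.1.2 :: [seq z <- v.1.1.1 | z != v.1.1.2])))).
  apply: measurable_funM.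
    by apply: (measurable_fun_conf2 mq); measurable_coordinates.
  by apply: measurable_fun_conf1 => //; measurable_coordinates.
apply: (measurable_Rintegral_l Lambda (f := fun w : seqs T * seqs T => k (conf (w.2 ++ w.1)) *
      \sum_(y <- undup w.1) \int[mu]_z (a (y - z) * p z (conf w.1) * q z (conf w.2)))).
apply: measurable_funM.
  by apply: measurable_fun_conf1 => //; measurable_coordinates.
pose F (r : (seqs T * seqs T) * T) :=
  \int[mu]_z (a (r.2 - z) * p z (conf r.1.1) * q z (conf r.1.2)).
suff mF : measurable_fun setT F.
  exact: (measurable_fun_undup_sum (@measurable_fun_eq_rV R d) mF measurable_fst).
apply: (measurable_Rintegral_l mu (f := fun w : ((seqs T * seqs T) * T) * T =>
  a (w.1.2 - w.2) * p w.2 (conf w.1.1.1) * q w.2 (conf w.1.1.2))).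
apply: measurable_funM; last first.
  by apply: (measurable_fun_conf2 mq); measurable_coordinates.
apply: measurable_funM; first by apply: measurable_fun_compB; measurable_coordinates.
by apply: (measurable_fun_conf2 mp); measurable_coordinates.
Qed.

End hop_operator.

(** * Integrability of the jumps *)

Section jump_integrals.
Context (R : realType) (d : nat).
Hypothesis d_gt0 : (0 < d)%N.
Local Notation T := 'rV[R]_d.
Local Notation mu := (@lebesgue_rV R d).
Local Notation Lambda := (poisson_seqs mu).

Lemma measurable_seqs_prod_at (g : T -> R) (w : T -> T) :
  measurable_fun setT g -> measurable_fun setT w ->
  measurable_fun setT (fun r : T * seqs T => \prod_(z <- r.2) g (w r.1 - z)).
Proof.
move=> mg mw.
have mh : measurable_fun setT (fun p : T * T => g (p.1 - p.2)).
  by apply: (measurableT_comp mg); exact: measurable_rVB.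
apply: (@measurableT_comp _ _ _ _ _ _ _ _ (fun r : T * seqs T => (w r.1, r.2))
  (measurable_seqs_prod mh)).
apply: measurable_fun_pair; last exact: measurable_snd.
exact: measurableT_comp mw measurable_fst.
Qed.

(** The Poisson integral of the product is [exp c] wherever it is centred. *)
Lemma integral_jump (b g : T -> R) (w : T -> T) (beta c : R) :
  measurable_fun setT b -> measurable_fun setT g -> measurable_fun setT w ->
  (forall x, 0 <= b x) -> (forall x, 0 <= g x) ->
  (\int[mu]_x (b x)%:E = beta%:E)%E ->
  (forall y, \int[mu]_z (g (y - z))%:E = c%:E)%E ->
  (\int[(mu \x Lambda)%E]_r (b r.1 * \prod_(z <- r.2) g (w r.1 - z))%:E =
   (beta * expR c)%:E)%E.
Proof.
move=> mb mg mw b0 g0 ib ig.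
have mgx x : measurable_fun setT (fun z : T => g (w x - z)).
  by apply: (measurable_fun_compB mg) => //; exact: measurable_cst.
rewrite (fubini_tonelli1 (fun r : T * seqs T =>
   (b r.1 * \prod_(z <- r.2) g (w r.1 - z))%:E)); last 2 first.
- apply/measurable_EFinP; apply: measurable_funM; last exact: (measurable_seqs_prod_at mg mw).
  exact: measurableT_comp mb measurable_fst.
- by move=> r; rewrite lee_fin mulr_ge0// prodr_ge0.
rewrite /fubini_F /=.
under eq_integral => x _.
  under eq_integral do rewrite EFinM.
  rewrite ge0_integralZl ?lee_fin//; last 2 first.
  - apply/measurable_EFinP; exact: (measurable_seqs_prod1 (mgx x)).
  - by move=> xi _; rewrite lee_fin prodr_ge0.
  rewrite (ge0_integral_poisson_seqs_prod (mgx x) _ (ig (w x)))//.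
  rewrite muleC.
  over.
rewrite ge0_integralZl_EFin//; last 2 first.
- by move=> x _; rewrite lee_fin.
- exact/measurable_EFinP.
by rewrite ib -EFinM mulrC.
Qed.

Lemma integrable_jump (b g : T -> R) (w : T -> T) (beta c C : R)
    (u : T * seqs T -> R) :
  measurable_fun setT b -> measurable_fun setT g -> measurable_fun setT w ->
  (forall x, 0 <= b x) -> (forall x, 0 <= g x) ->
  (\int[mu]_x (b x)%:E = beta%:E)%E ->
  (forall y, \int[mu]_z (g (y - z))%:E = c%:E)%E ->
  measurable_fun setT u -> 0 <= C ->
  {ae (mu \x Lambda)%E, forall r, `|u r| <= C * \prod_(z <- r.2) g (w r.1 - z)} ->
  (mu \x Lambda)%E.-integrable setT (fun r => (b r.1 * u r)%:E) /\
  `|\int[(mu \x Lambda)%E]_r (b r.1 * u r)| <= C * (beta * expR c).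
Proof.
move=> mb mg mw b0 g0 ib ig mu' C0 uC.
have mbu : measurable_fun setT (fun r : T * seqs T => b r.1 * u r).
  by apply: measurable_funM => //; exact: measurableT_comp mb measurable_fst.
have mbP : measurable_fun setT (fun r : T * seqs T =>
    b r.1 * \prod_(z <- r.2) g (w r.1 - z)).
  apply: measurable_funM; last exact: (measurable_seqs_prod_at mg mw).
  exact: measurableT_comp mb measurable_fst.
have le : (\int[(mu \x Lambda)%E]_r `|(b r.1 * u r)%:E| <=
    (C * (beta * expR c))%:E)%E.
  rewrite EFinM -(integral_jump mb mg mw b0 g0 ib ig) -ge0_integralZl ?lee_fin//; last 2 first.
  - exact/measurable_EFinP.
  - by move=> r _; rewrite lee_fin mulr_ge0// prodr_ge0.
  apply: ae_ge0_le_integral => //.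
  - by apply: measurableT_comp => //; exact/measurable_EFinP.
  - by move=> r _; rewrite -EFinM lee_fin !mulr_ge0// prodr_ge0.
  - apply: measurable_funeM; exact/measurable_EFinP.
  apply: ae_imply uC => r ur _.
  rewrite -EFinM abse_EFin lee_fin normrM ger0_norm// mulrCA ler_wpM2l//.
split.
  apply/integrableP; split; first exact/measurable_EFinP.
  by apply: le_lt_trans le _; rewrite ltry.
rewrite -lee_fin; apply: le_trans le.
exact: le_normr_Rintegral_ereal.
Qed.

Variables (a psi : T -> R) (alpha c : R).
Hypothesis ma : measurable_fun setT a.
Hypothesis a0 : forall x, 0 <= a x.
Hypothesis a_in : (forall y, \int[mu]_x (a (x - y))%:E = alpha%:E)%E.
Hypothesis a_out : (forall y, \int[mu]_x (a (y - x))%:E = alpha%:E)%E.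
Hypothesis mpsi : measurable_fun setT psi.
Hypothesis psi0 : forall x, 0 <= psi x.
Hypothesis psi_c : (forall y, \int[mu]_z (psi (y - z))%:E = c%:E)%E.

Variable r : rel T.
Hypothesis mr : measurable_fun setT (fun p : T * T => r p.1 p.2).
Hypothesis rsym : symmetric r.
Hypothesis rneq : forall x y, r x y -> x != y.
Hypothesis ae_r : forall y, {ae mu, forall z, r z y}.

(** Gain term: [y] is the target of a jump from [r.1], and the points [r.2] are
added; [U] contains the weights and the function that the operator is applied to. *)
Definition jump_in (U : T -> seqs T -> seqs T -> R) (s : seqs T) (y : T)
  (r : T * seqs T) : R := a (r.1 - y) * U y (r.1 :: rem y s) r.2.

(** Loss term: [y] is about to jump to [r.1], around which the weights are centred. *)
Definition jump_out (U : T -> seqs T -> seqs T -> R) (s : seqs T) (y : T)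
  (r : T * seqs T) : R := a (y - r.1) * U r.1 s r.2.

Definition measurable3 (U : T -> seqs T -> seqs T -> R) :=
  measurable_fun setT (fun r : T * (seqs T * seqs T) => U r.1 r.2.1 r.2.2).

(** The bound that [hop_kernel] inherits from a function of weight [th] outside
of the null set [N] of sequences. The factor [kappa] allows for a difference of two
operators, where the number of points of the configuration enters. *)
Definition jump_bounded (N : set (seqs T)) (th B : R) (kappa : nat -> R)
    (U : T -> seqs T -> seqs T -> R) :=
  forall y zeta xi, ~ N (xi ++ zeta) -> all (r y) (xi ++ zeta) ->
    `|U y zeta xi| <=
    B * expR (- (th * (size (xi ++ zeta))%:R)) * kappa (size zeta) *
    \prod_(z <- xi) psi (y - z).

(** The integral of the bound in [jump_bounded] over all jumps of one point of a
configuration with [n] points, computed by [integral_jump]. *)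
Definition jump_cost (th B : R) (kappa : nat -> R) (n : nat) : R :=
  B * kappa n * expR (- (th * n%:R)) * (alpha * expR (c * expR (- th))).

Definition integrable_jumps U (C : R) s := forall y, y \in s ->
  ((mu \x Lambda)%E.-integrable setT (fun r => (jump_in U s y r)%:E) /\
   `|\int[(mu \x Lambda)%E]_r jump_in U s y r| <= C) /\
  ((mu \x Lambda)%E.-integrable setT (fun r => (jump_out U s y r)%:E) /\
   `|\int[(mu \x Lambda)%E]_r jump_out U s y r| <= C).

(** The additional points bring factors [exp (- th)], which are absorbed by the
product over these points; this is how the constant [exp (c * exp (- th))] arises. *)
Lemma weight_prod (th : R) (xi zeta : seq T) (y : T) :
  expR (- (th * (size (xi ++ zeta))%:R)) * \prod_(z <- xi) psi (y - z) =
  expR (- (th * (size zeta)%:R)) * \prod_(z <- xi) (expR (- th) * psi (y - z)).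
Proof.
rewrite big_split/= big_const_seq count_predT iter_mulr_1 -expRM_natl mulrA -expRD.
by congr (expR _ * _); rewrite size_cat natrD mulrDr -mulr_natl; ring.
Qed.

Lemma pairwise_in (s : seq T) (y z : T) :
  pairwise r s -> y \in s -> z \in s -> y != z -> r y z.
Proof.
elim: s => // x s ih /= /andP[xs ss]; rewrite !inE.
move=> /orP[/eqP->|ys] /orP[/eqP->|zs] yz.
- by rewrite eqxx in yz.
- by move/allP : xs; exact.
- by rewrite rsym; move/allP : xs; exact.
- exact: ih.
Qed.

Lemma pairwise_uniq_rel (s : seq T) : pairwise r s -> uniq s.
Proof. by rewrite uniq_pairwise; apply: sub_pairwise => x y; exact: rneq. Qed.

Lemma all_pairwise_out (s xi : seq T) (x : T) :
  pairwise r (xi ++ x :: s) -> all (r x) (xi ++ s).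
Proof.
move=> ps; have us := pairwise_uniq_rel ps.
apply/allP => z zs; apply: (pairwise_in ps).
- by rewrite mem_cat mem_head orbT.
- by move: zs; rewrite !mem_cat inE => /orP[->//|->]; rewrite !orbT.
- move: us; rewrite -cat1s uniq_catCA cat1s cons_uniq => /andP[+ _].
  by apply: contraNneq => ->.
Qed.

Lemma all_pairwise_in (s xi : seq T) (x y : T) : y \in s ->
  pairwise r (xi ++ x :: s) -> all (r y) (xi ++ x :: rem y s).
Proof.
move=> ys ps; have us := pairwise_uniq_rel ps.
have : perm_eq (xi ++ x :: s) (y :: (xi ++ x :: rem y s)).
  apply/permP => P; rewrite /= !count_cat /=.
  by rewrite (permP (perm_to_rem ys) P) /= [RHS]addnCA; congr addn; rewrite addnCA.
move=> pe; apply/allP => z zs; apply: (pairwise_in ps).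
- by rewrite (perm_mem pe) mem_head.
- by rewrite (perm_mem pe) inE zs orbT.
- move: us; rewrite (perm_uniq pe) cons_uniq => /andP[yn _].
  by apply/eqP => yz; move: yn; rewrite {1}yz zs.
Qed.

(** For almost every configuration, almost every jump leads to a configuration that is
outside of [N] and whose points are pairwise related by [r]; there, [jump_bounded]
applies. *)
Lemma ae_integrable_jumps U N th B kappa : measurable3 U ->
  measurable N -> Lambda N = 0%E -> 0 <= B -> (forall n, 0 <= kappa n) ->
  jump_bounded N th B kappa U ->
  {ae Lambda, forall s : seqs T, integrable_jumps U (jump_cost th B kappa (size s)) s}.
Proof.
move=> mU mN N0 B0 kappa0 UN.
have := ae_cat_product (@measurable_fun_eq_rV R d) mN N0.
have mM := measurableC (measurable_pairwise mr).
have M0 := poisson_seqs_not_pairwise mr ae_r.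
have := ae_insert_product mM M0.
apply: ae_imply2 => s Ms [Nout Nin] y ys.
pose g x := expR (- th) * psi x.
have mg : measurable_fun setT g by apply: measurable_funM => //; exact: measurable_cst.
have g0 x : 0 <= g x by rewrite mulr_ge0// expR_ge0.
have gc (x : T) : (\int[mu]_z (g (x - z))%:E = (expR (- th) * c)%:E)%E.
  under eq_integral do rewrite EFinM.
  rewrite ge0_integralZl ?lee_fin ?expR_ge0//; last 2 first.
  - apply/measurable_EFinP; apply: (measurable_fun_compB mpsi) => //; exact: measurable_cst.
  - by move=> z _; rewrite lee_fin.
  by rewrite psi_c.
have C0 : 0 <= B * kappa (size s) * expR (- (th * (size s)%:R)).
  by rewrite !mulr_ge0// expR_ge0.
have mf1 : measurable_fun setT (fun w : T * seqs T => w.2 ++ w.1 :: s : seqs T).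
  by measurable_coordinates.
have ae_of (f : T * seqs T -> seqs T) (P : set (T * seqs T)) : measurable_fun setT f ->
    (mu \x Lambda)%E [set w | N (f w)] = 0%E ->
    (forall w, pairwise r (w.2 ++ w.1 :: s) -> ~ N (f w) -> P w) ->
    {ae (mu \x Lambda)%E, forall w, P w}.
  move=> mf f0 fP; have mNf := measurable_preimage mf mN.
  have mMf := measurable_preimage mf1 mM.
  have /(measure0P (mu \x Lambda)%E mNf) := f0.
  have /(measure0P (mu \x Lambda)%E mMf) := Ms.
  by apply: ae_imply2 => w /= /contrapT pw; exact: fP.
have sizeE x : size (x :: rem y s) = size s.
  by rewrite /= size_rem// prednK//; case: (s) ys.
rewrite /jump_cost [c * _]mulrC; split.
- apply: (@integrable_jump (fun x => a (x - y)) g (fun=> y) _ _ _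
    (fun w => U y (w.1 :: rem y s) w.2)) => //.
  + by apply: measurable_fun_compB => //; exact: measurable_cst.
  + apply: (measurableT_comp mU (g := fun w : T * seqs T => (y, (w.1 :: rem y s : seqs T, w.2)))).
    by measurable_coordinates.
  + apply: (ae_of (fun w => w.2 ++ w.1 :: rem y s)) (Nin y ys) _.
      by measurable_coordinates.
    move=> w pw /UN /(_ (all_pairwise_in ys pw)) /le_trans; apply.
    rewrite mulrAC -(mulrA B) weight_prod sizeE /g.
    by rewrite le_eqVlt; apply/orP; left; apply/eqP; ring.
- apply: (@integrable_jump (fun x => a (y - x)) g id _ _ _
    (fun w => U w.1 s w.2)) => //.
  + by apply: measurable_fun_compB => //; exact: measurable_cst.
  + apply: (measurableT_comp mU (g := fun w : T * seqs T => (w.1, (s, w.2)))).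
    by measurable_coordinates.
  + apply: (ae_of (fun w => w.2 ++ s)) Nout _.
      by measurable_coordinates.
    move=> w pw /UN /(_ (all_pairwise_out pw)) /le_trans; apply.
    rewrite mulrAC -(mulrA B) weight_prod /g.
    by rewrite le_eqVlt; apply/orP; left; apply/eqP; ring.
Qed.

End jump_integrals.

Lemma ae_all_seq d (X : measurableType d) (R : realType)
    (m : {measure set X -> \bar R}) (I : eqType) (s : seq I) (P : I -> set X) :
  (forall i, i \in s -> {ae m, forall x, P i x}) ->
  {ae m, forall x, forall i, i \in s -> P i x}.
Proof.
elim: s => [_|i s ih h]; first exact: aeW.
have h1 := ih (fun j js => h j (@mem_behead _ (i :: s) j js)).
move: (h i (mem_head _ _)) h1; apply: ae_imply2 => x Pi Ps j.
by rewrite inE => /orP[/eqP->//|]; exact: Ps.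
Qed.

Section hop_as_jumps.
Context (R : realType) (d : nat).
Hypothesis d_gt0 : (0 < d)%N.
Local Notation T := 'rV[R]_d.
Local Notation Gamma0 := (Gamma0 R d).
Local Notation mu := (@lebesgue_rV R d).
Local Notation Lambda := (poisson_seqs mu).

(** The operator [hop], with the iterated integrals replaced by integrals over
the product space. *)
Definition jumps (a : T -> R) (U : T -> seqs T -> seqs T -> R) (s : seqs T) : R :=
  \sum_(y <- s) (\int[(mu \x Lambda)%E]_r jump_in a U s y r -
                 \int[(mu \x Lambda)%E]_r jump_out a U s y r).

Lemma jumps_le a U C (s : seqs T) : integrable_jumps a U C s ->
  `|jumps a U s| <= (size s)%:R * (2 * C).
Proof.
move=> h; apply: le_trans (ler_norm_sum _ _ _) _.
rewrite [leRHS](_ : _ = \sum_(y <- s) (2 * C)); last first.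
  by rewrite big_const_seq iter_addr_0 count_predT mulr_natl.
rewrite big_seq [leRHS]big_seq; apply: ler_sum => y ys.
have [[_ h1] [_ h2]] := h y ys.
by apply: le_trans (ler_normB _ _) _; rewrite mulr_natl mulr2n lerD.
Qed.

Lemma jumpsD a U1 U2 (c C1 C2 : R) (s : seqs T) :
  integrable_jumps a U1 C1 s -> integrable_jumps a U2 C2 s ->
  jumps a (fun y zeta xi => U1 y zeta xi + c * U2 y zeta xi) s =
  jumps a U1 s + c * jumps a U2 s.
Proof.
move=> h1 h2; rewrite /jumps mulr_sumr -big_split/=.
rewrite big_seq [RHS]big_seq; apply: eq_bigr => y ys.
have [[i1 _] [j1 _]] := h1 y ys; have [[i2 _] [j2 _]] := h2 y ys.
have lin (f g : T * seqs T -> R) :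
    (mu \x Lambda)%E.-integrable setT (EFin \o f) ->
    (mu \x Lambda)%E.-integrable setT (EFin \o g) ->
    \int[(mu \x Lambda)%E]_r (f r + c * g r) =
    \int[(mu \x Lambda)%E]_r f r + c * \int[(mu \x Lambda)%E]_r g r.
  move=> fi gi; have cgi := integrableZl measurableT c gi.
  by rewrite RintegralD// RintegralZl.
have -> : \int[(mu \x Lambda)%E]_r jump_in a
    (fun y zeta xi => U1 y zeta xi + c * U2 y zeta xi) s y r =
    \int[(mu \x Lambda)%E]_r (jump_in a U1 s y r + c * jump_in a U2 s y r).
  by apply: eq_Rintegral => r _; rewrite /jump_in; ring.
have -> : \int[(mu \x Lambda)%E]_r jump_out a
    (fun y zeta xi => U1 y zeta xi + c * U2 y zeta xi) s y r =
    \int[(mu \x Lambda)%E]_r (jump_out a U1 s y r + c * jump_out a U2 s y r).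
  by apply: eq_Rintegral => r _; rewrite /jump_out; ring.
by rewrite !lin//; ring.
Qed.

Variables (a : T -> R) (p q : T -> Gamma0 -> R) (k : Gamma0 -> R).
Hypothesis ma : measurable_fun setT a.
Hypothesis mp : measurable_fun setT (fun r : T * seqs T => p r.1 (conf r.2)).
Hypothesis mq : measurable_fun setT (fun r : T * seqs T => q r.1 (conf r.2)).
Hypothesis mk : measurable_fun setT k.

Definition hop_kernel (y : T) (zeta xi : seqs T) : R :=
  p y (conf zeta) * q y (conf xi) * k (conf (xi ++ zeta)).

Lemma measurable_hop_kernel : measurable3 hop_kernel.
Proof.
apply: measurable_funM; last first.
  by apply: measurable_fun_conf1 => //; measurable_coordinates.
apply: measurable_funM.
  by apply: (measurable_fun_conf2 mp); measurable_coordinates.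
by apply: (measurable_fun_conf2 mq); measurable_coordinates.
Qed.

Lemma measurable_jump_in (s : seqs T) (y : T) :
  measurable_fun setT (jump_in a hop_kernel s y).
Proof.
apply: measurable_funM; first by apply: (measurable_fun_compB ma); measurable_coordinates.
apply: (measurableT_comp measurable_hop_kernel
  (g := fun r : T * seqs T => (y, (r.1 :: rem y s : seqs T, r.2)))).
by measurable_coordinates.
Qed.

Lemma measurable_jump_out (s : seqs T) (y : T) :
  measurable_fun setT (jump_out a hop_kernel s y).
Proof.
apply: measurable_funM; first by apply: (measurable_fun_compB ma); measurable_coordinates.
apply: (measurableT_comp measurable_hop_kernel
  (g := fun r : T * seqs T => (r.1, (s, r.2)))).
by measurable_coordinates.
Qed.

Lemma hop_in_jumps (s : seqs T) (y : T) :
  (mu \x Lambda)%E.-integrable setT (fun r => (jump_in a hop_kernel s y r)%:E) ->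
  \int[mu]_x (a (x - y) * p y (conf (x :: rem y s)) *
     \int[Lambda]_xi (q y (conf xi) * k (conf (xi ++ x :: rem y s)))) =
  \int[(mu \x Lambda)%E]_r jump_in a hop_kernel s y r.
Proof.
move=> hi; have mj := measurable_jump_in s y.
rewrite (Rintegral_prod_l mj)//.
apply: ae_eq_Rintegral.
- apply: measurable_funM.
    apply: measurable_funM; first by apply: (measurable_fun_compB ma); measurable_coordinates.
    by apply: (measurable_fun_conf2 mp); measurable_coordinates.
  apply: (measurable_Rintegral_l Lambda (f := fun v : T * seqs T =>
    q y (conf v.2) * k (conf (v.2 ++ v.1 :: rem y s)))).
  apply: measurable_funM.
    by apply: (measurable_fun_conf2 mq); measurable_coordinates.
  by apply: measurable_fun_conf1 => //; measurable_coordinates.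
- exact: (measurable_Rintegral_l Lambda mj).
- apply: ae_imply (ae_integrable1 hi) => x hx.
  rewrite -integrable_RintegralZl.
    by apply: eq_Rintegral => xi _; rewrite /jump_in /hop_kernel/=; ring.
  apply: eq_integrable hx => // xi _ /=.
  by rewrite /jump_in /hop_kernel/= !mulrA.
Qed.

Lemma hop_out_jumps (s : seqs T) (C : R) : integrable_jumps a hop_kernel C s ->
  \int[Lambda]_xi (k (conf (xi ++ s)) *
      \sum_(y <- s) \int[mu]_z (a (y - z) * p z (conf s) * q z (conf xi))) =
  \sum_(y <- s) \int[(mu \x Lambda)%E]_r jump_out a hop_kernel s y r.
Proof.
move=> h.
have mj y := measurable_jump_out s y.
have ji y : y \in s -> (mu \x Lambda)%E.-integrable setT
    (EFin \o jump_out a hop_kernel s y) by move=> /h[_ []].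
have jr y : y \in s -> Lambda.-integrable setT
    (EFin \o (fun xi => \int[mu]_z jump_out a hop_kernel s y (z, xi))).
  by move=> ys; exact: (integrable_Rintegral_r (mj y) (ji y ys)).
transitivity (\int[Lambda]_xi \sum_(y <- s) \int[mu]_z jump_out a hop_kernel s y (z, xi)).
  apply: ae_eq_Rintegral.
  - apply: measurable_funM.
      by apply: measurable_fun_conf1 => //; measurable_coordinates.
    apply: measurable_sum => y.
    apply: (measurable_Rintegral_r mu (f := fun r : T * seqs T =>
      a (y - r.1) * p r.1 (conf s) * q r.1 (conf r.2))).
    apply: measurable_funM; last exact: mq.
    apply: measurable_funM.
      by apply: (measurable_fun_compB ma); measurable_coordinates.
    by apply: (measurable_fun_conf2 mp); measurable_coordinates.
  - by apply: measurable_sum => y; exact: (measurable_Rintegral_r mu (mj y)).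
  - have := ae_all_seq (fun y ys => ae_integrable2 (ji y ys)).
    apply: ae_imply => xi hxi; rewrite mulr_sumr big_seq [RHS]big_seq.
    apply: eq_bigr => y ys; rewrite -integrable_RintegralZl.
      by apply: eq_Rintegral => z _; rewrite /jump_out /hop_kernel/=; ring.
    apply: eq_integrable (hxi y ys) => // z _ /=.
    by congr EFin; rewrite /jump_out /hop_kernel/=; ring.
rewrite (Rintegral_sum jr).2 big_seq [RHS]big_seq.
by apply: eq_bigr => y ys; rewrite (Rintegral_prod_r (mj y) (ji y ys)).
Qed.

(** Fubini's theorem, in both orders: the gain term integrates first over the
added points, the loss term first over the target of the jump. *)
Lemma hop_jumps (s : seqs T) (C : R) : uniq s ->
  integrable_jumps a hop_kernel C s ->
  hop a p q k (conf s) = jumps a hop_kernel s.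
Proof.
move=> us h; rewrite hop_conf// /hop_seqs /jumps sumrB undup_id//; congr (_ - _).
  rewrite big_seq [RHS]big_seq; apply: eq_bigr => y ys.
  by rewrite -rem_filter//; apply: hop_in_jumps; have [[]] := h y ys.
exact: hop_out_jumps h.
Qed.

End hop_as_jumps.

(** * Hopping operators between spaces of different weights *)

(** The price of the sum over the points of a configuration: [1 + x <= exp x] at
[x = delta * n - 1]. *)
Lemma natr_expR_le (R : realType) (delta : R) (n : nat) : 0 < delta ->
  n%:R * expR (- (delta * n%:R)) <= (expR 1 * delta)^-1.
Proof.
move=> d0; rewrite expRN ler_pdivrMr ?expR_gt0// mulrC ler_pdivlMr ?mulr_gt0 ?expR_gt0//.
rewrite mulrC -mulrA mulrC -ler_pdivlMr ?expR_gt0// -expRN -expRD.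
by apply: le_trans (expR_ge1Dx _); rewrite addrC subrK.
Qed.

Lemma natr_succ_expR_le (R : realType) (delta : R) (n : nat) : 0 < delta ->
  n%:R * (n%:R + 1) * expR (- (delta * n%:R)) <=
  (expR 1 * (delta / 2))^-1 * ((expR 1 * (delta / 2))^-1 + 1).
Proof.
move=> d0; have d20 : 0 < delta / 2 by rewrite divr_gt0.
(* Half of the exponential for each of the two factors. *)
rewrite [delta * _](_ : _ = delta / 2 * n%:R + delta / 2 * n%:R); last by field.
rewrite opprD expRD mulrACA; apply: ler_pM.
- by rewrite mulr_ge0// expR_ge0.
- by rewrite mulr_ge0 ?addr_ge0// expR_ge0.
- exact: natr_expR_le.
rewrite mulrDl mul1r lerD ?natr_expR_le//.
rewrite -[leRHS]expR0 ler_expR oppr_le0; apply: mulr_ge0 => //; exact: ltW.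
Qed.

Section hop_estimates.
Context (R : realType) (d : nat).
Hypothesis d_gt0 : (0 < d)%N.
Local Notation T := 'rV[R]_d.
Local Notation Gamma0 := (Gamma0 R d).
Local Notation mu := (@lebesgue_rV R d).
Local Notation Lambda := (poisson_seqs mu).

Variables (a : T -> R) (alpha : R).
Hypothesis ma : measurable_fun setT a.
Hypothesis a0 : forall x, 0 <= a x.
Hypothesis a_in : (forall y, \int[mu]_x (a (x - y))%:E = alpha%:E)%E.
Hypothesis a_out : (forall y, \int[mu]_x (a (y - x))%:E = alpha%:E)%E.
Variable r : rel T.
Hypothesis mr : measurable_fun setT (fun p : T * T => r p.1 p.2).
Hypothesis rsym : symmetric r.
Hypothesis rneq : forall x y, r x y -> x != y.
Hypothesis ae_r : forall y, {ae mu, forall z, r z y}.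

(** The integral does not depend on [y] by translation invariance; this form spares
the change of variables. *)
Definition bounding_weight (psi : T -> R) (c : R) : Prop :=
  [/\ measurable_fun setT psi, forall x, 0 <= psi x
    & (forall y, \int[mu]_z (psi (y - z))%:E = c%:E)%E].

(** Repetitions are excluded because [conf] forgets them, and unrelated points
because an essential bound of [phi] only concerns almost all pairs. *)
Definition weight_le (psi : T -> R) (kappa : nat -> R) (w : T -> seqs T -> seqs T -> R) :=
  forall y (zeta xi : seq T), uniq (xi ++ zeta) -> all (r y) (xi ++ zeta) ->
    `|w y zeta xi| <= kappa (size zeta) * \prod_(z <- xi) psi (y - z).

Lemma ae_integrable_weight w psi c kappa th B (k : Gamma0 -> R) :
  measurable3 w -> bounding_weight psi c -> (forall n, 0 <= kappa n) ->
  weight_le psi kappa w -> measurable_fun setT k -> 0 <= B -> Kbound th B k ->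
  {ae Lambda, forall s : seqs T, uniq s /\
    integrable_jumps a (fun y zeta xi => w y zeta xi * k (conf (xi ++ zeta)))
      (jump_cost alpha c th B kappa (size s)) s}.
Proof.
move=> mw [mpsi psi0 psic] kappa0 wle mk B0 kB.
pose G : set (seqs T) := [set s | uniq s /\
  `|k (conf s)| <= B * expR (- (th * (size s)%:R))].
have mG : measurable G.
  apply: measurableI; first exact: (measurable_uniq_seqs (@measurable_fun_eq_rV R d)).
  have mn : measurable_fun setT (fun s : seqs T => `|k (conf s)|).
    by apply: measurableT_comp => //; exact/measurable_fun_conf.
  have mB : measurable_fun setT (fun s : seqs T => B * expR (- (th * (size s)%:R))).
    exact: (measurable_fun_size (fun n => B * expR (- (th * n%:R)) : R)).
  have := measurable_fun_ler mn mB.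
  by move/(_ measurableT [set true] I); congr measurable; rewrite setTI.
have uae : {ae Lambda, forall s, uniq s}.
  have := poisson_seqs_not_uniq (@measurable_fun_eq_rV R d) (fun z => lebesgue_rV_set1 z d_gt0).
  move/(measure0P Lambda (measurableC (measurable_uniq_seqs (@measurable_fun_eq_rV R d)))).
  by apply: ae_imply => s /= /contrapT.
have G0 : Lambda (~` G) = 0%E.
  apply/(measure0P Lambda (measurableC mG)).
  by move: uae kB; apply: ae_imply2 => s us ks /= nG; apply: nG.
have mU : measurable3 (fun y zeta xi => w y zeta xi * k (conf (xi ++ zeta))).
  apply: measurable_funM => //.
  by apply: measurable_fun_conf1 => //; measurable_coordinates.
have jb : jump_bounded psi r (~` G) th B kappa
    (fun y zeta xi => w y zeta xi * k (conf (xi ++ zeta))).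
  move=> y zeta xi /contrapT[u kle] yr.
  by rewrite normrM mulrC -mulrA ler_pM//; exact: wle.
have h := ae_integrable_jumps ma a0 a_in a_out mpsi psi0 psic mr rsym rneq ae_r
  mU (measurableC mG) G0 B0 kappa0 jb.
by move: uae h; apply: ae_imply2.
Qed.

(** Almost everywhere, [hop] is given by absolutely convergent integrals, so that it
can be estimated and depends linearly on its argument and on its weights. *)
Lemma ae_hop (p q : T -> Gamma0 -> R) psi c kappa th B (k : Gamma0 -> R) :
  measurable_fun setT (fun r : T * seqs T => p r.1 (conf r.2)) ->
  measurable_fun setT (fun r : T * seqs T => q r.1 (conf r.2)) ->
  bounding_weight psi c -> (forall n, 0 <= kappa n) ->
  weight_le psi kappa (fun y zeta xi => p y (conf zeta) * q y (conf xi)) ->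
  measurable_fun setT k -> 0 <= B -> Kbound th B k ->
  {ae Lambda, forall s : seqs T,
    integrable_jumps a (hop_kernel p q k) (jump_cost alpha c th B kappa (size s)) s /\
    hop a p q k (conf s) = jumps a (hop_kernel p q k) s}.
Proof.
move=> mp mq hpsi kappa0 wle mk B0 kB.
have mw : measurable3 (fun y zeta xi => p y (conf zeta) * q y (conf xi)).
  apply: measurable_funM.
    by apply: (measurable_fun_conf2 mp); measurable_coordinates.
  by apply: (measurable_fun_conf2 mq); measurable_coordinates.
have := ae_integrable_weight mw hpsi kappa0 wle mk B0 kB.
apply: ae_imply => s [us js]; split => //.
exact: (hop_jumps d_gt0 ma mp mq mk us js).
Qed.

(** Each of the [n] points of a configuration has a gain and a loss term, and
[natr_expR_le] trades the factor [n] for the loss of weight. *)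
Lemma Kbound_hop (p q : T -> Gamma0 -> R) psi c th B th2 (k : Gamma0 -> R) :
  measurable_fun setT (fun r : T * seqs T => p r.1 (conf r.2)) ->
  measurable_fun setT (fun r : T * seqs T => q r.1 (conf r.2)) ->
  bounding_weight psi c ->
  weight_le psi (fun=> 1) (fun y zeta xi => p y (conf zeta) * q y (conf xi)) ->
  measurable_fun setT k -> 0 <= B -> Kbound th B k -> th2 < th ->
  Kbound th2 (2 * alpha * expR (c * expR (- th)) / (expR 1 * (th - th2)) * B)
    (hop a p q k).
Proof.
move=> mp mq hpsi wle mk B0 kB th2th.
have := ae_hop mp mq hpsi (fun=> ler01) wle mk B0 kB.
apply: ae_imply => s [js ->]; apply: le_trans (jumps_le js) _.
rewrite /jump_cost mulr1.
have alpha0 : 0 <= alpha.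
  by rewrite -lee_fin -(a_in 0); apply: integral_ge0 => x _; rewrite lee_fin.
have := natr_expR_le (size s) (_ : 0 < th - th2); rewrite subr_gt0 => /(_ th2th) h.
have E : expR (- (th * (size s)%:R)) =
    expR (- ((th - th2) * (size s)%:R)) * expR (- (th2 * (size s)%:R)).
  by rewrite -expRD; congr expR; ring.
rewrite E.
rewrite [leLHS](_ : _ = ((size s)%:R * expR (- ((th - th2) * (size s)%:R))) *
   (2 * alpha * expR (c * expR (- th)) * B * expR (- (th2 * (size s)%:R)))); last by ring.
rewrite [leRHS](_ : _ = (expR 1 * (th - th2))^-1 *
   (2 * alpha * expR (c * expR (- th)) * B * expR (- (th2 * (size s)%:R)))); last by ring.
by rewrite ler_wpM2r// !mulr_ge0// expR_ge0.
Qed.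

Lemma hop_linear (p q : T -> Gamma0 -> R) psi c th B1 B2 (k1 k2 : Gamma0 -> R) (b : R) :
  measurable_fun setT (fun r : T * seqs T => p r.1 (conf r.2)) ->
  measurable_fun setT (fun r : T * seqs T => q r.1 (conf r.2)) ->
  bounding_weight psi c ->
  weight_le psi (fun=> 1) (fun y zeta xi => p y (conf zeta) * q y (conf xi)) ->
  measurable_fun setT k1 -> measurable_fun setT k2 -> 0 <= B1 -> 0 <= B2 ->
  Kbound th B1 k1 -> Kbound th B2 k2 ->
  {ae Lambda, forall s, hop a p q (fun eta => k1 eta + b * k2 eta) (conf s) =
    hop a p q k1 (conf s) + b * hop a p q k2 (conf s)}.
Proof.
move=> mp mq hpsi wle mk1 mk2 B10 B20 kB1 kB2.
have mk : measurable_fun setT (fun eta => k1 eta + b * k2 eta).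
  by apply: measurable_funD => //; apply: measurable_funM => //; exact: measurable_cst.
have B0 : 0 <= B1 + `|b| * B2 by rewrite addr_ge0// mulr_ge0.
have kB : Kbound th (B1 + `|b| * B2) (fun eta => k1 eta + b * k2 eta).
  move: kB1 kB2; apply: ae_imply2 => s h1 h2.
  rewrite mulrDl -mulrA; apply: le_trans (ler_normD _ _) _.
  by rewrite normrM lerD// ler_wpM2l.
have h1 := ae_hop mp mq hpsi (fun=> ler01) wle mk1 B10 kB1.
have h2 := ae_hop mp mq hpsi (fun=> ler01) wle mk2 B20 kB2.
have h := ae_hop mp mq hpsi (fun=> ler01) wle mk B0 kB.
have h12 : {ae Lambda, forall s, jumps a (hop_kernel p q (fun eta => k1 eta + b * k2 eta)) s =
    hop a p q k1 (conf s) + b * hop a p q k2 (conf s)}.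
  move: h1 h2; apply: ae_imply2 => s [i1 ->] [i2 ->].
  rewrite -(jumpsD b i1 i2); congr jumps.
  by apply/funext => y; apply/funext => zeta; apply/funext => xi; rewrite /hop_kernel; ring.
by move: h h12; apply: ae_imply2 => s [_ ->].
Qed.

(** As in [Kbound_hop], for the difference of the weights; its bound has an
additional factor [n + 1], so that [n * (n + 1)] has to be absorbed by the loss of
weight. *)
Lemma Kbound_hopB (p q p' q' : T -> Gamma0 -> R) psi c psi2 c2 (e th th2 B : R) (k : Gamma0 -> R) :
  measurable_fun setT (fun r : T * seqs T => p r.1 (conf r.2)) ->
  measurable_fun setT (fun r : T * seqs T => q r.1 (conf r.2)) ->
  measurable_fun setT (fun r : T * seqs T => p' r.1 (conf r.2)) ->
  measurable_fun setT (fun r : T * seqs T => q' r.1 (conf r.2)) ->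
  bounding_weight psi c -> bounding_weight psi2 c2 -> 0 <= e ->
  weight_le psi (fun=> 1) (fun y zeta xi => p y (conf zeta) * q y (conf xi)) ->
  weight_le psi (fun=> 1) (fun y zeta xi => p' y (conf zeta) * q' y (conf xi)) ->
  weight_le psi2 (fun n => e * (n%:R + 1)) (fun y zeta xi =>
    p y (conf zeta) * q y (conf xi) + -1 * (p' y (conf zeta) * q' y (conf xi))) ->
  measurable_fun setT k -> 0 <= B -> Kbound th B k -> th2 < th ->
  Kbound th2 (2 * alpha * expR (c2 * expR (- th)) *
     ((expR 1 * ((th - th2) / 2))^-1 * ((expR 1 * ((th - th2) / 2))^-1 + 1)) * B * e)
    (fun eta => hop a p q k eta - hop a p' q' k eta).
Proof.
move=> mp mq mp' mq' hpsi hpsi2 e0 wle wle' wle2 mk B0 kB th2th.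
have mw (p0 q0 : T -> Gamma0 -> R) : measurable_fun setT (fun r : T * seqs T => p0 r.1 (conf r.2)) ->
    measurable_fun setT (fun r : T * seqs T => q0 r.1 (conf r.2)) ->
    measurable3 (fun y zeta xi => p0 y (conf zeta) * q0 y (conf xi)).
  move=> m1 m2; apply: measurable_funM.
    by apply: (measurable_fun_conf2 m1); measurable_coordinates.
  by apply: (measurable_fun_conf2 m2); measurable_coordinates.
have mw2 : measurable3 (fun y zeta xi =>
    p y (conf zeta) * q y (conf xi) + -1 * (p' y (conf zeta) * q' y (conf xi))).
  apply: measurable_funD; first exact: mw.
  by apply: measurable_funM; [exact: measurable_cst|exact: mw].
have kappa0 n : 0 <= e * (n%:R + 1) by rewrite mulr_ge0// addr_ge0.
have h1 := ae_hop mp mq hpsi (fun=> ler01) wle mk B0 kB.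
have h2 := ae_hop mp' mq' hpsi (fun=> ler01) wle' mk B0 kB.
have h3 := ae_integrable_weight mw2 hpsi2 kappa0 wle2 mk B0 kB.
have h12 : {ae Lambda, forall s, hop a p q k (conf s) - hop a p' q' k (conf s) =
    jumps a (fun y zeta xi => (p y (conf zeta) * q y (conf xi) +
      -1 * (p' y (conf zeta) * q' y (conf xi))) * k (conf (xi ++ zeta))) s}.
  move: h1 h2; apply: ae_imply2 => s [i1 ->] [i2 ->].
  transitivity (jumps a (hop_kernel p q k) s + -1 * jumps a (hop_kernel p' q' k) s).
    by rewrite mulN1r.
  rewrite -(jumpsD (-1) i1 i2); congr jumps.
  by apply/funext => y; apply/funext => zeta; apply/funext => xi; rewrite /hop_kernel; ring.
move: h12 h3; apply: ae_imply2 => s -> [_ js]; apply: le_trans (jumps_le js) _.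
have alpha0 : 0 <= alpha.
  by rewrite -lee_fin -(a_in 0); apply: integral_ge0 => x _; rewrite lee_fin.
have := natr_succ_expR_le (size s) (_ : 0 < th - th2); rewrite subr_gt0 => /(_ th2th) h.
have E : expR (- (th * (size s)%:R)) =
    expR (- ((th - th2) * (size s)%:R)) * expR (- (th2 * (size s)%:R)).
  by rewrite -expRD; congr expR; ring.
rewrite /jump_cost E.
rewrite [leLHS](_ : _ = ((size s)%:R * ((size s)%:R + 1) * expR (- ((th - th2) * (size s)%:R))) *
   (2 * alpha * expR (c2 * expR (- th)) * B * e * expR (- (th2 * (size s)%:R)))); last by ring.
rewrite [leRHS](_ : _ = ((expR 1 * ((th - th2) / 2))^-1 * ((expR 1 * ((th - th2) / 2))^-1 + 1)) *
   (2 * alpha * expR (c2 * expR (- th)) * B * e * expR (- (th2 * (size s)%:R)))); last by ring.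
by rewrite ler_wpM2r// !mulr_ge0// expR_ge0.
Qed.

End hop_estimates.

(** * The weights of the two operators *)

Section product_estimates.
Context (R : realType) (I : Type).
Implicit Types (s : seq I) (t f g psi : I -> R).

Lemma prod_le1 s t : (forall i, 0 <= t i <= 1) -> 0 <= \prod_(i <- s) t i <= 1.
Proof.
move=> t01; elim: s => [|i s /andP[h0 h1]]; first by rewrite big_nil ler01 lexx.
rewrite big_cons; have /andP[t0 t1] := t01 i.
by rewrite mulr_ge0// mulr_ile1.
Qed.

Lemma normr_prod_le s f psi : (forall i, `|f i| <= psi i) ->
  `|\prod_(i <- s) f i| <= \prod_(i <- s) psi i.
Proof.
move=> fpsi; elim: s => [|i s ih]; first by rewrite !big_nil normr1.
by rewrite !big_cons normrM ler_pM.
Qed.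
End product_estimates.

Section product_estimates_eq.
Context (R : realType) (I : eqType).
Implicit Types (s : seq I) (t f g psi : I -> R).

(** Changing the factors to [1] one at a time. *)
Lemma one_sub_prod_le s t (e : R) : (forall i, 0 <= t i <= 1) ->
  (forall i, i \in s -> 1 - t i <= e) -> 1 - \prod_(i <- s) t i <= (size s)%:R * e.
Proof.
move=> t01; elim: s => [|i s ih] te; first by rewrite big_nil subrr mul0r.
rewrite big_cons /= -natr1 mulrDl mul1r.
have := ih (fun j js => te j (@mem_behead _ (i :: s) j js)).
have := te i (mem_head _ _).
have /andP[p0 p1] := prod_le1 s t01; have /andP[t0 t1] := t01 i.
nra.
Qed.

(** Replacing the factors [g i] by [f i] one at a time. *)
Lemma normr_prodB_le s f g psi (e : R) : 0 <= e ->
  (forall i, `|f i| <= psi i) -> (forall i, `|g i| <= psi i) ->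
  (forall i, i \in s -> `|f i - g i| <= e * psi i) ->
  `|\prod_(i <- s) f i - \prod_(i <- s) g i| <=
  (size s)%:R * e * \prod_(i <- s) psi i.
Proof.
move=> e0 fpsi gpsi; elim: s => [|i s ih] fg.
  by rewrite !big_nil subrr normr0 mul0r mul0r.
rewrite !big_cons /= -natr1.
have {}ih := ih (fun j js => fg j (@mem_behead _ (i :: s) j js)).
have {}fg := fg i (mem_head _ _).
rewrite (_ : _ - _ = f i * (\prod_(j <- s) f j - \prod_(j <- s) g j) +
  (f i - g i) * \prod_(j <- s) g j); last by ring.
apply: le_trans (ler_normD _ _) _; rewrite !normrM.
rewrite [leRHS](_ : _ = psi i * ((size s)%:R * e * \prod_(j <- s) psi j) +
  (e * psi i) * \prod_(j <- s) psi j); last by ring.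
by rewrite lerD// ler_pM// normr_prod_le.
Qed.

End product_estimates_eq.

Section renormalized_factor.
Context (R : realType).
Implicit Types u eps K : R.

Lemma expRN_le_quadratic u : 0 <= u -> expR (- u) <= 1 - u + u ^+ 2.
Proof.
move=> u0; rewrite expRN.
have u1 : 0 < 1 + u by rewrite ltr_pwDl.
apply: (@le_trans _ _ (1 + u)^-1).
  by rewrite lef_pV2 ?posrE ?expR_gt0//; exact: expR_ge1Dx.
rewrite -[leLHS]mul1r ler_pdivrMr//.
by rewrite [leRHS](_ : _ = 1 + u ^+ 3); [rewrite lerDl exprn_ge0|ring].
Qed.

Lemma expRN_bounds u : 0 <= u -> 0 <= expR (- u) <= 1 /\ 1 - expR (- u) <= u.
Proof.
move=> u0; rewrite expR_ge0 /= -[X in _ <= X]expR0 ler_expR oppr_le0 u0; split => //.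
by have := expR_ge1Dx (- u); rewrite lerBlDr addrC -lerBlDr.
Qed.

Lemma renormalized_factor_le eps u : 0 < eps -> 0 <= u ->
  `|eps^-1 * (expR (- (eps * u)) - 1)| <= u.
Proof.
move=> e0 u0; have eu0 : 0 <= eps * u by rewrite mulr_ge0// ltW.
have [/andP[h0 h1] h2] := expRN_bounds eu0.
rewrite normrM gtr0_norm ?invr_gt0// mulrC ler_pdivrMr// ler0_norm ?subr_le0//.
by rewrite opprB [leRHS]mulrC.
Qed.

(** The error of the linear approximation is quadratic in [eps * u]; one factor [u]
is bounded by [K], and the other is kept, as it is to be integrated. *)
Lemma renormalized_factorB_le eps u K : 0 < eps -> 0 <= u -> u <= K ->
  `|eps^-1 * (expR (- (eps * u)) - 1) - - u| <= eps * K * u.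
Proof.
move=> e0 u0 uK; have eu0 : 0 <= eps * u by rewrite mulr_ge0// ltW.
rewrite opprK (_ : _ + u = eps^-1 * (expR (- (eps * u)) - 1 + eps * u)); last first.
  by rewrite [RHS]mulrDr mulKf// gt_eqF.
have [_ h2] := expRN_bounds eu0; have h3 := expRN_le_quadratic eu0.
rewrite normrM gtr0_norm ?invr_gt0// mulrC ler_pdivrMr// ger0_norm; last by lra.
apply: (@le_trans _ _ ((eps * u) ^+ 2)); first by lra.
rewrite expr2 [leRHS](_ : _ = (eps * K) * (eps * u)); last by ring.
by rewrite ler_wpM2r// ler_pM2l.
Qed.

End renormalized_factor.

Section concrete_weights.
Context (R : realType) (d : nat).
Local Notation T := 'rV[R]_d.
Local Notation Gamma0 := (Gamma0 R d).
Local Notation mu := (@lebesgue_rV R d).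
Local Notation Lambda := (poisson_seqs mu).

Lemma econf_conf (f : T -> R) (s : seq T) :
  econf f (conf s) = \prod_(z <- undup s) f z.
Proof. by rewrite /econf (perm_big _ (perm_conf s)). Qed.

Lemma measurable_econf (f : T -> T -> R) :
  measurable_fun setT (fun p : T * T => f p.1 p.2) ->
  measurable_fun setT (fun w : T * seqs T => econf (f w.1) (conf w.2)).
Proof.
move=> mf.
rewrite (_ : (fun _ => _) = fun w : T * seqs T => \prod_(z <- undup w.2) f w.1 z); last first.
  by apply/funext => w; rewrite econf_conf.
apply: (@measurableT_comp _ _ _ _ _ _ _ _
  (fun w : T * seqs T => (w.1, undup w.2 : seqs T)) (measurable_seqs_prod mf)).
apply: measurable_fun_pair; first exact: measurable_fst.
apply: (measurableT_comp (measurable_seqs_undup (@measurable_fun_eq_rV R d))).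
exact: measurable_snd.
Qed.

Lemma integral_symmetric (f : T -> R) (c : R) : measurable_fun setT f ->
  (forall x, 0 <= f x) -> (forall x, f x = f (- x)) ->
  (\int[mu]_x (f x)%:E = c%:E)%E ->
  (forall y, \int[mu]_x (f (x - y))%:E = c%:E)%E /\
  (forall y, \int[mu]_x (f (y - x))%:E = c%:E)%E.
Proof.
move=> mf f0 fs fc.
have h y : (\int[mu]_x (f (x - y))%:E = c%:E)%E.
  rewrite -fc; apply: (ge0_integral_lebesgue_rV_shift (- y) (f := EFin \o f)).
    exact/measurable_EFinP.
  by move=> x /=; rewrite lee_fin.
split=> // y; rewrite -(h y); apply: eq_integral => x _.
by rewrite (fs (y - x)) opprB.
Qed.

Variables (phi : T -> R) (K c : R).
Hypothesis mphi : measurable_fun setT phi.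
Hypothesis phi0 : forall x, 0 <= phi x.
Hypothesis phi_sym : forall x, phi x = phi (- x).
Hypothesis d_gt0 : (0 < d)%N.
Hypothesis K0 : 0 <= K.
Hypothesis phiK : {ae mu, forall x, phi x <= K}.
Hypothesis phi_c : (\int[mu]_x (phi x)%:E = c%:E)%E.

(** Almost every pair of points is regular; on regular pairs the essential
bound of [phi] holds pointwise. *)
Definition regular_pair : rel T := fun x y => (x != y) && (phi (x - y) <= K).

Lemma measurable_regular_pair :
  measurable_fun setT (fun p : T * T => regular_pair p.1 p.2).
Proof.
apply: measurable_and; first by apply: measurable_neg; exact: measurable_fun_eq_rV.
apply: measurable_fun_ler; last exact: measurable_cst.
by apply: (measurable_fun_compB mphi); measurable_coordinates.
Qed.

Lemma regular_pair_sym : symmetric regular_pair.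
Proof. by move=> x y; rewrite /regular_pair eq_sym phi_sym opprB. Qed.

Lemma regular_pair_neq x y : regular_pair x y -> x != y.
Proof. by case/andP. Qed.

Lemma ae_regular_pair y : {ae mu, forall z, regular_pair z y}.
Proof.
have m1 : measurable [set x | K < phi x].
  have := measurable_fun_ltr (measurable_cst K) mphi.
  by move/(_ measurableT [set true] I); congr measurable; rewrite setTI.
have n1 : mu [set x | K < phi x] = 0%E.
  apply/(measure0P mu m1); apply: ae_imply phiK => x.
  by rewrite leNgt => /negP.
have mt : measurable_fun setT (fun z : T => z + - y) := @measurable_rV_shift R d (- y).
have m2 := measurable_preimage mt m1.
have n2 : mu [set z | K < phi (z - y)] = 0%E.
  rewrite -[X in mu X]setIT -integral_indic//.
  transitivity (\int[mu]_x (\1_[set x | K < phi x] (x + - y))%:E)%E.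
    by apply: eq_integral => x _; rewrite !indicE !mem_setE.
  rewrite (ge0_integral_lebesgue_rV_shift (- y) (f := EFin \o \1_[set x | K < phi x])).
  - by rewrite integral_indic// setIT.
  - by apply/measurable_EFinP; exact: measurable_indic.
  - by move=> x /=; rewrite lee_fin.
have /(measure0P mu m2) := n2.
have : {ae mu, forall z, ~ [set y] z}.
  apply/(measure0P mu (measurable_set1_eq (@measurable_fun_eq_rV R d) y)).
  exact: lebesgue_rV_set1.
apply: ae_imply2 => z /= zy zK.
by apply/andP; split; [exact/eqP|rewrite leNgt; exact/negP].
Qed.

Lemma bounding_weight_phi : bounding_weight phi c.
Proof. by split=> //; have [] := integral_symmetric mphi phi0 phi_sym phi_c. Qed.

Lemma bounding_weight_phi2 : bounding_weight (fun x => 2 * phi x) (2 * c).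
Proof.
have [m0 p0 h] := bounding_weight_phi; split.
- by apply: measurable_funM => //; exact: measurable_cst.
- by move=> x; rewrite mulr_ge0.
- move=> y; under eq_integral do rewrite EFinM.
  rewrite ge0_integralZl ?lee_fin//; last 2 first.
  + apply/measurable_EFinP; apply: (measurable_fun_compB mphi) => //; exact: measurable_cst.
  + by move=> z _; rewrite lee_fin.
  by rewrite h -EFinM.
Qed.

Variable eps : R.
Hypothesis eps0 : 0 < eps.

Definition pren (y : T) := econf (taueps phi eps y).
Definition qren (y : T) := econf (fun z => eps^-1 * teps phi eps y z).
Definition pV (y : T) (eta : Gamma0) : R := 1.
Definition qV (y : T) := econf (fun z => - phi (y - z)).

Lemma Lren_hop (a : T -> R) : Lren a phi eps = hop a pren qren.
Proof. by []. Qed.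

Lemma LV_hop (a : T -> R) : LV a phi = hop a pV qV.
Proof.
apply/funext => k; apply/funext => eta; rewrite /LV /hop.
apply: (congr2 (fun x y : R => x - y)).
  by apply: eq_bigr => y _; apply: eq_Rintegral => x _; rewrite /pV mulr1.
apply: eq_Rintegral => xi _; congr (_ * _); apply: eq_bigr => x _.
by apply: eq_Rintegral => y _; rewrite /pV mulr1.
Qed.

Lemma measurable_phiB : measurable_fun setT (fun p : T * T => phi (p.1 - p.2)).
Proof. by apply: (measurable_fun_compB mphi); measurable_coordinates. Qed.

Lemma measurable_teps : measurable_fun setT (fun p : T * T => teps phi eps p.1 p.2).
Proof.
apply: measurable_funB; last exact: measurable_cst.
apply: measurableT_comp => //; apply: measurableT_comp => //.
by apply: measurable_funM; [exact: measurable_cst|exact: measurable_phiB].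
Qed.

Lemma measurable_pren : measurable_fun setT (fun w : T * seqs T => pren w.1 (conf w.2)).
Proof.
apply: measurable_econf.
by apply: measurable_funD; [exact: measurable_teps|exact: measurable_cst].
Qed.

Lemma measurable_qren : measurable_fun setT (fun w : T * seqs T => qren w.1 (conf w.2)).
Proof.
apply: (measurable_econf (f := fun y z => eps^-1 * teps phi eps y z)).
by apply: measurable_funM; [exact: measurable_cst|exact: measurable_teps].
Qed.

Lemma measurable_pV : measurable_fun setT (fun w : T * seqs T => pV w.1 (conf w.2)).
Proof. exact: measurable_cst. Qed.

Lemma measurable_qV : measurable_fun setT (fun w : T * seqs T => qV w.1 (conf w.2)).
Proof.
apply: (measurable_econf (f := fun y z => - phi (y - z))).
by apply: measurableT_comp => //; exact: measurable_phiB.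
Qed.

Lemma taueps01 y z : 0 <= taueps phi eps y z <= 1 /\
  1 - taueps phi eps y z <= eps * phi (y - z).
Proof.
rewrite /taueps /teps subrK; apply: expRN_bounds.
by rewrite mulr_ge0// ltW.
Qed.

Lemma weight_le_ren : weight_le regular_pair phi (fun=> 1)
  (fun y zeta xi => pren y (conf zeta) * qren y (conf xi)).
Proof.
move=> y zeta xi; rewrite cat_uniq => /and3P[uxi _ uzeta] _.
rewrite mul1r normrM /pren /qren !econf_conf !undup_id// -[leRHS]mul1r.
have /andP[p0 p1] := prod_le1 zeta (fun z => (taueps01 y z).1).
rewrite ler_pM//; first by rewrite ger0_norm.
by apply: normr_prod_le => z; exact: renormalized_factor_le.
Qed.

Lemma weight_le_V : weight_le regular_pair phi (fun=> 1)
  (fun y zeta xi => pV y (conf zeta) * qV y (conf xi)).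
Proof.
move=> y zeta xi; rewrite cat_uniq => /and3P[uxi _ uzeta] _.
rewrite mul1r /pV mul1r /qV econf_conf undup_id//.
by apply: normr_prod_le => z; rewrite normrN ger0_norm.
Qed.

(** Each point contributes an error [eps * K], relative to the product of the
bounds of the factors; the number of added points is then absorbed by doubling
[phi]. *)
Lemma weight_le_renB : weight_le regular_pair (fun x => 2 * phi x)
  (fun n => eps * K * (n%:R + 1))
  (fun y zeta xi => pren y (conf zeta) * qren y (conf xi) +
     -1 * (pV y (conf zeta) * qV y (conf xi))).
Proof.
move=> y zeta xi; rewrite cat_uniq all_cat => /and3P[uxi _ uzeta] /andP[rxi rzeta].
rewrite /pV mul1r mulN1r /pren /qren /qV !econf_conf !undup_id//.
pose P := \prod_(z <- zeta) taueps phi eps y z.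
pose Q := \prod_(z <- xi) (eps^-1 * teps phi eps y z).
pose Q0 := \prod_(z <- xi) - phi (y - z); pose F := \prod_(z <- xi) phi (y - z).
rewrite -/P -/Q -/Q0.
have /andP[P0 P1] : 0 <= P <= 1 := prod_le1 zeta (fun z => (taueps01 y z).1).
have rK s z : all (regular_pair y) s -> z \in s -> phi (y - z) <= K.
  by move=> /allP h /h /andP[].
have P2 : 1 - P <= (size zeta)%:R * (eps * K).
  apply: one_sub_prod_le => [z|z zs]; first exact: (taueps01 y z).1.
  by apply: le_trans (taueps01 y z).2 _; rewrite ler_pM2l//; exact: rK zs.
have QF : `|Q| <= F by apply: normr_prod_le => z; exact: renormalized_factor_le.
have F0 : 0 <= F by apply: le_trans QF.
have eK0 : 0 <= eps * K by rewrite mulr_ge0// ltW.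
have Q2 : `|Q - Q0| <= (size xi)%:R * (eps * K) * F.
  apply: normr_prodB_le => // [z|z|z zs].
  - exact: renormalized_factor_le.
  - by rewrite normrN ger0_norm.
  - by apply: renormalized_factorB_le => //; exact: rK zs.
have F2 : \prod_(z <- xi) (2 * phi (y - z)) = 2 ^+ size xi * F.
  by rewrite big_split/= big_const_seq count_predT iter_mulr_1.
rewrite F2 (_ : P * Q - Q0 = (P - 1) * Q + (Q - Q0)); last by ring.
apply: le_trans (ler_normD _ _) _; rewrite normrM ler0_norm ?subr_le0// opprB.
apply: (@le_trans _ _ (((size zeta)%:R + (size xi)%:R) * (eps * K) * F)).
  rewrite [leRHS](_ : _ = (size zeta)%:R * (eps * K) * F +
    (size xi)%:R * (eps * K) * F); last by ring.
  by rewrite lerD// ler_pM// subr_ge0.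
(* [l <= 2 ^ l] for the number [l] of added points. *)
have h : (size zeta)%:R + (size xi)%:R <= ((size zeta)%:R + 1) * 2 ^+ size xi :> R.
  rewrite -natrX -natrD natr1 -natrM ler_nat mulSn addnC leq_add//.
    by rewrite ltnW// ltn_expl.
  by rewrite leq_pmulr// expn_gt0.
rewrite [leRHS](_ : _ = ((size zeta)%:R + 1) * 2 ^+ size xi * (eps * K) * F); last by ring.
by rewrite ler_wpM2r// ler_wpM2r.
Qed.

End concrete_weights.

(** * Norms of functions of configurations *)

Section Kbound_theory.
Context (R : realType) (d : nat).
Local Notation V := (Gamma0 R d -> R).
Implicit Types (f g : V) (th B : R).

Lemma KboundD th B1 B2 f g : Kbound th B1 f -> Kbound th B2 g ->
  Kbound th (B1 + B2) (fun eta => f eta + g eta).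
Proof.
apply: ae_imply2 => s h1 h2; rewrite mulrDl; apply: le_trans (ler_normD _ _) _.
exact: lerD.
Qed.

Lemma KboundZ th B c f : Kbound th B f -> Kbound th (`|c| * B) (fun eta => c * f eta).
Proof. by apply: ae_imply => s h; rewrite normrM -mulrA ler_wpM2l. Qed.

Lemma KboundB th B1 B2 f g : Kbound th B1 f -> Kbound th B2 g ->
  Kbound th (B1 + B2) (fun eta => f eta - g eta).
Proof.
apply: ae_imply2 => s h1 h2; rewrite mulrDl; apply: le_trans (ler_normB _ _) _.
exact: lerD.
Qed.

Lemma Kbound_le th B1 B2 f : B1 <= B2 -> Kbound th B1 f -> Kbound th B2 f.
Proof.
by move=> B12; apply: ae_imply => s h; apply: le_trans h _; rewrite ler_wpM2r// expR_ge0.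
Qed.

Lemma Kbound_theta th1 th2 B f : 0 <= B -> th2 <= th1 -> Kbound th1 B f -> Kbound th2 B f.
Proof.
move=> B0 th21; apply: ae_imply => s h; apply: le_trans h _.
by rewrite ler_wpM2l// ler_expR lerN2 ler_wpM2r.
Qed.

Lemma Kbound_ae th B f g :
  {ae poisson_seqs (@lebesgue_rV R d), forall s, f (conf s) = g (conf s)} ->
  Kbound th B f -> Kbound th B g.
Proof. by apply: ae_imply2 => s ->. Qed.

Lemma Kbound_eq th B f g : f =1 g -> Kbound th B f -> Kbound th B g.
Proof. by move=> fg; apply: Kbound_ae; apply: aeW => s; rewrite fg. Qed.

Lemma Knorm_ge0 th f : (0 <= Knorm th f)%E.
Proof.
apply: (@le_trans _ _ ((expR (th * 0%:R))%:E * nu 0 f)%E).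
  by rewrite /nu -EFinM lee_fin mulr_ge0// expR_ge0.
by apply: ereal_sup_ubound; exists 0%N.
Qed.

(** Membership in the space of weight [th], up to measurability. *)
Definition Kfin th f := exists2 B : R, 0 <= B & Kbound th B f.

Definition Kreal th f : R := fine (Knorm th f).

Lemma Knorm_Kreal th f : Kfin th f -> Knorm th f = (Kreal th f)%:E.
Proof.
move=> [B B0 /(Knorm_le th f B0) h]; rewrite /Kreal fineK//.
by rewrite ge0_fin_numE ?Knorm_ge0//; apply: le_lt_trans h _; rewrite ltry.
Qed.

Lemma Kreal_ge0 th f : 0 <= Kreal th f.
Proof. by rewrite /Kreal fine_ge0// Knorm_ge0. Qed.

Lemma Kbound_Kreal th f : Kfin th f -> Kbound th (Kreal th f) f.
Proof.
by move=> ff; apply/(Knorm_le th f (Kreal_ge0 th f)); rewrite Knorm_Kreal.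
Qed.

Lemma Kreal_le th B f : 0 <= B -> Kbound th B f -> Kreal th f <= B.
Proof.
move=> B0 h; have ff : Kfin th f by exists B.
by rewrite -lee_fin -Knorm_Kreal//; apply/(Knorm_le th f B0).
Qed.

Lemma KfinP th f : (Knorm th f < +oo)%E -> Kfin th f.
Proof.
move=> foo; have fE : Knorm th f = (Kreal th f)%:E.
  by rewrite /Kreal fineK// ge0_fin_numE ?Knorm_ge0.
exists (Kreal th f); first exact: Kreal_ge0.
by apply/(Knorm_le th f (Kreal_ge0 th f)); rewrite -fE.
Qed.

Lemma Kreal_dist th B f g : 0 <= B -> Kfin th f -> Kfin th g ->
  Kbound th B (fun eta => f eta - g eta) -> `|Kreal th f - Kreal th g| <= B.
Proof.
move=> B0 ff gf fg; rewrite ler_norml; apply/andP; split.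
  rewrite lerBrDr addrC lerBlDr; apply: Kreal_le; first by rewrite addr_ge0// Kreal_ge0.
  have := KboundB (Kbound_Kreal ff) fg; apply: Kbound_eq => eta; ring.
rewrite lerBlDr; apply: Kreal_le; first by rewrite addr_ge0// Kreal_ge0.
have := KboundD fg (Kbound_Kreal gf); apply: Kbound_eq => eta; ring.
Qed.

End Kbound_theory.

(** * A mean value inequality *)

Section mean_value.
Context (R : realType).
Implicit Types (u : R -> R) (a b : R).

Definition continuous_on u a b := forall t, a <= t <= b -> forall e, 0 < e ->
  exists2 delta, 0 < delta & forall s, a <= s <= b -> `|s - t| < delta ->
    `|u s - u t| <= e.

Lemma continuous_on_within u a b : continuous_on u a b -> {within `[a, b], continuous u}.
Proof.
move=> cu; apply/subspace_continuousP => t; rewrite /= in_itv/= => tab.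
apply/cvgrPdist_le => e e0; have [delta delta0 h] := cu t tab e e0.
rewrite near_withinE; near=> s; rewrite /= in_itv/= => sab.
by rewrite distrC; apply: h => //; rewrite distrC; near: s; exact: nbhsx_ballx.
Unshelve. all: by end_near. Qed.

(** After adding a small negative slope, the minimum can only be reached at the
right endpoint. The left endpoint, where no derivative is given, is reached by
continuity. *)
Lemma right_derivative_nonincreasing u a b : a <= b -> continuous_on u a b ->
  (forall t, a < t < b -> forall e, 0 < e -> exists2 delta, 0 < delta &
     forall h, 0 < h < delta -> t + h <= b -> u (t + h) - u t <= e * h) ->
  u b <= u a.
Proof.
rewrite le_eqVlt => /orP[/eqP->//|ab] cu du.
(* Away from [a], where a right derivative is available up to the left endpoint. *)
have main a' : a < a' < b -> u b <= u a'.
  move=> /andP[aa' a'b]; apply/ler_addgt0Pr => e e0.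
  pose l := e / (b - a').
  have l0 : 0 < l by rewrite divr_gt0// subr_gt0.
  pose w t := u t - l * (t - a').
  have cw : {within `[a', b], continuous w}.
    apply: within_continuousB.
      apply: continuous_subspaceW (continuous_on_within cu).
      by apply: subset_itvr; rewrite bnd_simp ltW.
    apply: continuous_subspaceT => x.
    by apply: cvgM; [exact: cvg_cst|apply: cvgB; [exact: cvg_id|exact: cvg_cst]].
  have [c] := EVT_min (ltW a'b) cw; rewrite in_itv/= => /andP[a'c cb] cmin.
  have cE : c = b.
    apply/eqP; rewrite eq_le cb/= leNgt; apply/negP => cltb.
    have l20 : 0 < l / 2 by rewrite divr_gt0.
    have [|delta delta0 hd] := du c _ _ l20; first by rewrite cltb (lt_le_trans aa').
    pose h := Num.min (delta / 2) (b - c).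
    have h0 : 0 < h by rewrite lt_min divr_gt0//= subr_gt0.
    have hlt : h < delta.
      by rewrite gt_min; apply/orP; left; rewrite ltr_pdivrMr// ltr_pMr// ltr1n.
    have hb : c + h <= b by rewrite -lerBrDl ge_min lexx orbT.
    have h1 : w c <= w (c + h).
      by apply: cmin; rewrite in_itv/= hb andbT (le_trans a'c)// lerDl ltW.
    have h2 : u (c + h) - u c <= l / 2 * h by apply: hd => //; rewrite h0 hlt.
    move: h1; rewrite /w; nra.
  have := cmin a'; rewrite in_itv/= lexx ltW// => /(_ isT).
  rewrite cE /w subrr mulr0 subr0 /l divfK ?gt_eqF ?subr_gt0//.
  by rewrite lerBlDr.
rewrite leNgt; apply/negP => uab.
have e0 : 0 < (u b - u a) / 2 by rewrite divr_gt0// subr_gt0.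
have [|delta delta0 h] := cu a _ _ e0; first by rewrite lexx ltW.
pose x := Num.min (delta / 2) ((b - a) / 2).
have x0 : 0 < x by rewrite lt_min !divr_gt0// subr_gt0.
have xd : x < delta.
  by rewrite gt_min; apply/orP; left; rewrite ltr_pdivrMr// ltr_pMr// ltr1n.
have xb : a + x < b.
  rewrite -ltrBrDl gt_min; apply/orP; right.
  by rewrite ltr_pdivrMr// ltr_pMr// ?ltr1n// subr_gt0.
have h1 : u b <= u (a + x) by apply: main; rewrite ltrDl x0.
have : `|u (a + x) - u a| <= (u b - u a) / 2.
  apply: h; first by rewrite lerDl !ltW.
  by rewrite addrAC subrr add0r gtr0_norm.
rewrite ler_norml => /andP[_]; lra.
Qed.

End mean_value.

Section mean_value_Kbound.
Context (R : realType) (d : nat).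
Local Notation V := (Gamma0 R d -> R).

Definition Kcontinuous_on th (f : R -> V) (a b : R) :=
  forall t, a <= t <= b -> forall e, 0 < e ->
  exists2 delta, 0 < delta & forall s, a <= s <= b -> `|s - t| < delta ->
    Kbound th e (fun eta => f s eta - f t eta).

Definition Kright_derivative th (f : R -> V) (t b : R) (f' : V) :=
  forall e, 0 < e -> exists2 delta, 0 < delta &
    forall h, 0 < h < delta -> t + h <= b ->
      Kbound th (e * h) (fun eta => f (t + h) eta - f t eta - h * f' eta).

(** The upper right derivative of the norm of [f] is at most [g'], hence at most
that of [g]. This replaces the integration of [f'] in a Banach space. *)
Lemma Kbound_mean_value th (f f' : R -> V) (g g' : R -> R) (a b : R) : a <= b ->
  (forall t, a <= t <= b -> Kfin th (f t)) ->
  Kcontinuous_on th f a b -> continuous_on g a b ->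
  (forall t, a < t < b -> Kright_derivative th f t b (f' t)) ->
  (forall t, a < t < b -> 0 <= g' t) ->
  (forall t, a < t < b -> Kbound th (g' t) (f' t)) ->
  (forall t h, a < t < b -> 0 < h -> t + h <= b -> g t + h * g' t <= g (t + h)) ->
  0 <= g a -> 0 <= g b -> Kbound th (g a) (f a) -> Kbound th (g b) (f b).
Proof.
move=> ab ff cf cg df g'0 f'g' gconv ga0 gb0 fa.
pose u t := Kreal th (f t) - g t.
have cu : continuous_on u a b.
  move=> t tab e e0; have e20 : 0 < e / 2 by rewrite divr_gt0.
  have [d1 d10 h1] := cf t tab _ e20; have [d2 d20 h2] := cg t tab _ e20.
  exists (Num.min d1 d2); first by rewrite lt_min d10.
  move=> s sab; rewrite lt_min => /andP[sd1 sd2].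
  have k1 := Kreal_dist (ltW e20) (ff s sab) (ff t tab) (h1 s sab sd1).
  have k2 := h2 s sab sd2.
  rewrite /u (_ : _ - _ = (Kreal th (f s) - Kreal th (f t)) - (g s - g t)); last by ring.
  by apply: le_trans (ler_normB _ _) _; lra.
have : u b <= u a.
  apply: (right_derivative_nonincreasing ab cu) => t tab e e0.
  have [delta delta0 hd] := df t tab e e0; exists delta => // h hdelta htb.
  have /andP[h0 _] := hdelta; have /andP[ta tb] := tab.
  have tab' : a <= t <= b by rewrite !ltW.
  have thab : a <= t + h <= b by rewrite htb andbT (le_trans (ltW ta))// lerDl ltW.
  have k1 : Kbound th (e * h + h * g' t) (fun eta => f (t + h) eta - f t eta).
    have := KboundD (hd h hdelta htb) (KboundZ h (f'g' t tab)).
    rewrite gtr0_norm//; apply: Kbound_eq => eta; ring.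
  have eh0 : 0 <= e * h + h * g' t.
    by apply: addr_ge0; apply: mulr_ge0; rewrite ?g'0 ?(ltW e0) ?(ltW h0).
  have := Kreal_dist eh0 (ff _ thab) (ff _ tab') k1.
  rewrite ler_norml => /andP[_ k2]; have := gconv t h tab h0 htb.
  by rewrite /u; lra.
have := Kreal_le ga0 fa; rewrite /u => h1 h2.
have bb : a <= b <= b by rewrite ab lexx.
by apply: Kbound_le (Kbound_Kreal (ff b bb)); lra.
Qed.

End mean_value_Kbound.

(** * Elementary estimates *)

Section elementary_estimates.
Context (R : realType).
Implicit Types (t h b rho : R).

(** [(1 + 1 / m) ^ m <= e], from [1 + x <= exp x]. *)
Lemma succ_ratio_le (m : nat) : ((m%:R + 1) / m%:R) ^+ m <= expR 1 :> R.
Proof.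
case: m => [|m]; first by rewrite expr0 -[leLHS]expR0 ler_expR.
have m0 : 0 < m.+1%:R :> R by rewrite ltr0n.
have -> : expR 1 = expR (m.+1%:R^-1) ^+ m.+1 :> R.
  by rewrite -expRM_natl divff ?gt_eqF.
apply: lerXn2r; rewrite ?nnegrE ?expR_ge0 ?divr_ge0 ?addr_ge0//.
by apply: le_trans (expR_ge1Dx _); rewrite mulrDl mul1r divff ?gt_eqF.
Qed.

Lemma geometric_small (C rho e : R) : 0 <= C -> 0 <= rho < 1 -> 0 < e ->
  exists N0, forall N, (N0 <= N)%N -> C * rho ^+ N <= e.
Proof.
move=> C0 /andP[rho0 rho1] e0.
have : geometric C rho @ \oo --> (0 : R).
  by apply: cvg_geometric; rewrite ger0_norm.
move=> /cvgrPdist_le/(_ e e0)[N0 _ h]; exists N0 => N NN0.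
have := h N NN0; rewrite /geometric/= sub0r normrN ger0_norm//.
by rewrite mulr_ge0// exprn_ge0.
Qed.

Lemma linear_small (C e : R) : 0 <= C -> 0 < e -> exists2 k : R, 0 < k & C * k <= e.
Proof.
move=> C0 e0; exists (e / (C + 1)); first by rewrite divr_gt0// ltr_wpDl.
have C1 : 0 < C + 1 by rewrite ltr_wpDl.
rewrite mulrA ler_pdivrMr// [leRHS]mulrC; apply: ler_wpM2r; first exact: ltW.
by rewrite lerDl.
Qed.

(** Convexity of the power. *)
Lemma exprD_ge (q : nat) (x h : R) : 0 <= x -> 0 <= h ->
  x ^+ q.+1 + h * (q.+1%:R * x ^+ q) <= (x + h) ^+ q.+1.
Proof.
move=> x0 h0; elim: q => [|q ih]; first by rewrite !expr1 expr0 !mulr1.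
rewrite [leRHS]exprS; apply: (@le_trans _ _
    ((x + h) * (x ^+ q.+1 + h * (q.+1%:R * x ^+ q)))); last first.
  by rewrite ler_wpM2l// addr_ge0.
rewrite -[q.+2%:R]natr1 !exprS.
have h1 : 0 <= h * h * (q.+1%:R * x ^+ q).
  by rewrite !mulr_ge0// exprn_ge0.
set y := x ^+ q in h1 *; set n := q.+1%:R in h1 *.
nra.
Qed.

(** Differentiability of a monomial, with a remainder that is uniform on bounded
sets. *)
Lemma monomial_taylor b (j : nat) : exists2 C : R, 0 <= C &
  forall t h, 0 <= t -> 0 <= h -> t + h <= b ->
    `|(t + h) ^+ j - t ^+ j - h * (j%:R * t ^+ j.-1)| <= C * h ^+ 2.
Proof.
elim: j => [|j [C C0 hC]].
  by exists 0 => // t h *; rewrite !expr0 subrr mul0r mulr0 subr0 normr0 mul0r.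
exists (`|b| * C + j%:R * `|b| ^+ j.-1).
  by rewrite addr_ge0// mulr_ge0// exprn_ge0.
move=> t h t0 h0 thb.
have E : j%:R * t ^+ j.-1 * t = j%:R * t ^+ j.
  by case: (j) => [|i]; rewrite ?mul0r//= exprSr mulrA.
rewrite (_ : _ - _ = (t + h) * ((t + h) ^+ j - t ^+ j - h * (j%:R * t ^+ j.-1)) +
    j%:R * t ^+ j.-1 * h ^+ 2); last first.
  rewrite /= -natr1 !exprS.
  transitivity ((t + h) * (t + h) ^+ j - t * t ^+ j - h * t ^+ j - h * (j%:R * t ^+ j)).
    by ring.
  rewrite -E; ring.
have bb : b <= `|b| by exact: ler_norm.
have tb : t + h <= `|b| by exact: le_trans bb.
have t1b : t <= `|b| by apply: le_trans tb; rewrite lerDl.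
apply: le_trans (ler_normD _ _) _; rewrite [leRHS]mulrDl lerD//.
  rewrite normrM -mulrA ger0_norm ?addr_ge0// ler_pM ?addr_ge0//.
  exact: hC.
rewrite ger0_norm; last by rewrite !mulr_ge0// ?exprn_ge0.
rewrite ler_wpM2r ?sqr_ge0// ler_wpM2l//.
by apply: lerXn2r; rewrite ?nnegrE.
Qed.

End elementary_estimates.

(** * Taylor expansion at the initial time *)

Section taylor_expansion.
Context (R : realType) (d : nat).
Local Notation V := (Gamma0 R d -> R).
Local Notation Lambda := (poisson_seqs (@lebesgue_rV R d)).
Variables (L : V -> V) (th0 th M : R) (r0 : V) (B0 : R).
Hypothesis th_lt : th < th0.
Hypothesis M0 : 0 < M.
Hypothesis B00 : 0 <= B0.
Hypothesis mr0 : measurable_fun setT r0.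
Hypothesis r0B : Kbound th0 B0 r0.
Hypothesis Lmeas : forall k, measurable_fun setT k -> measurable_fun setT (L k).
Hypothesis Lbound : forall t1 t2 B k, th <= t2 -> t2 < t1 -> t1 <= th0 -> 0 <= B ->
  measurable_fun setT k -> Kbound t1 B k ->
  Kbound t2 (M / (expR 1 * (t1 - t2)) * B) (L k).
Hypothesis Llin : forall k1 k2 b, measurable_fun setT k1 -> measurable_fun setT k2 ->
  Kfin th k1 -> Kfin th k2 ->
  {ae Lambda, forall s, L (fun eta => k1 eta + b * k2 eta) (conf s) =
     L k1 (conf s) + b * L k2 (conf s)}.

(** [taylor j] is [L ^ j r0 / j!]. *)
Fixpoint taylor (j : nat) : V :=
  if j is i.+1 then fun eta => i.+1%:R^-1 * L (taylor i) eta else r0.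

Lemma measurable_taylor j : measurable_fun setT (taylor j).
Proof.
elim: j => //= j ih; apply: measurable_funM; first exact: measurable_cst.
exact: Lmeas.
Qed.

(** By induction on [j], at all weights [t] at the same time: the last of the [j]
applications of [L] is given the share [1 / j] of the total loss of weight. *)
Lemma Kbound_taylor j t : th <= t < th0 ->
  Kbound t (B0 * (M / (th0 - t)) ^+ j) (taylor j).
Proof.
elim: j t => [|j ih] t /andP[tht tth0].
  by rewrite expr0 mulr1; exact: Kbound_theta (ltW tth0) r0B.
have D0 : 0 < th0 - t by rewrite subr_gt0.
rewrite /=; case: j ih => [_|j ih].
  have e1 : 1 <= expR 1 :> R by rewrite -[leLHS]expR0 ler_expR.
  have := KboundZ 1%:R^-1 (Lbound tht tth0 (lexx _) B00 mr0 r0B).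
  apply: Kbound_le; rewrite invr1 normr1 mul1r expr1 mulrC ler_wpM2l//.
  apply: ler_wpM2l; first exact: ltW.
  rewrite lef_pV2 ?posrE ?mulr_gt0 ?expR_gt0//.
  by rewrite ler_peMl// ltW.
pose m : R := j.+1%:R.
have m0 : 0 < m by rewrite ltr0n.
have m10 : 0 < m + 1 by rewrite addr_gt0.
(* The last application of [L] gets the share [1 / (m + 1)] of the loss, the others
   the rest; the constant is then multiplied by [((m + 1) / m) ^ m / e]. *)
pose t1 := t + (th0 - t) / (m + 1).
have E1 : t1 - t = (th0 - t) / (m + 1) by rewrite /t1; ring.
have E2 : th0 - t1 = (th0 - t) * (m / (m + 1)).
  by rewrite /t1; field; rewrite gt_eqF.
have tt1 : t < t1 by rewrite -subr_gt0 E1 divr_gt0.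
have t1th0 : t1 < th0 by rewrite -subr_gt0 E2 mulr_gt0// divr_gt0.
have ht1 : th <= t1 < th0 by rewrite (le_trans tht (ltW tt1)).
have q0 : 0 <= B0 * (M / (th0 - t1)) ^+ j.+1.
  by rewrite mulr_ge0// exprn_ge0// divr_ge0 ?ltW// subr_gt0.
have := KboundZ j.+2%:R^-1 (Lbound tht tt1 (ltW t1th0) q0 (measurable_taylor _) (ih _ ht1)).
apply: Kbound_le.
rewrite ger0_norm// E1 E2 -[j.+2%:R]natr1 -/m.
have Mq : M / ((th0 - t) * (m / (m + 1))) = M / (th0 - t) * ((m + 1) / m).
  by field; rewrite !gt_eqF.
rewrite Mq exprMn.
rewrite [leLHS](_ : _ = B0 * (M / (th0 - t)) ^+ j.+2 *
    (((m + 1) / m) ^+ j.+1 / expR 1)); last first.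
  by rewrite [in RHS]exprSr; field; rewrite !gt_eqF// expR_gt0.
rewrite ler_piMr//; first by rewrite mulr_ge0// exprn_ge0// divr_ge0// ltW.
by rewrite ler_pdivrMr ?expR_gt0// mul1r; exact: succ_ratio_le.
Qed.

Lemma Kfin_taylor j : Kfin th (taylor j).
Proof.
exists (B0 * (M / (th0 - th)) ^+ j).
  by rewrite mulr_ge0// exprn_ge0// divr_ge0 ?ltW// subr_gt0.
by apply: Kbound_taylor; rewrite lexx.
Qed.

Definition taylor_sum (N : nat) (t : R) : V := fun eta => \sum_(j < N) t ^+ j * taylor j eta.

Lemma taylor_sumS N t :
  taylor_sum N.+1 t = fun eta => taylor_sum N t eta + t ^+ N * taylor N eta.
Proof. by apply/funext => eta; rewrite /taylor_sum big_ord_recr. Qed.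

Lemma measurable_taylor_sum N t : measurable_fun setT (taylor_sum N t).
Proof.
apply: measurable_sum => j.
by apply: measurable_funM; [exact: measurable_cst|exact: measurable_taylor].
Qed.

Lemma Kfin_taylor_sum N t : Kfin th (taylor_sum N t).
Proof.
elim: N => [|N [B BB ih]].
  exists 0 => //; apply: aeW => s.
  by rewrite /taylor_sum big_ord0 normr0 mul0r.
have [B1 B10 h] := Kfin_taylor N.
exists (B + `|t ^+ N| * B1); first by rewrite addr_ge0// mulr_ge0.
by rewrite taylor_sumS; apply: KboundD => //; exact: KboundZ.
Qed.

(** The sum of [B0 * rho ^ j] over [j >= N]. *)
Definition taylor_tail (rho : R) (N : nat) : R := B0 / (1 - rho) * rho ^+ N.

Lemma taylor_tail_ge0 rho N : 0 <= rho < 1 -> 0 <= taylor_tail rho N.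
Proof.
move=> /andP[rho0 rho1]; rewrite mulr_ge0 ?exprn_ge0// divr_ge0// subr_ge0.
exact: ltW.
Qed.

Lemma Kbound_taylor_sumB rho t N m : 0 <= rho < 1 -> 0 <= t ->
  t * (M / (th0 - th)) <= rho ->
  Kbound th (taylor_tail rho N)
    (fun eta => taylor_sum (N + m) t eta - taylor_sum N t eta).
Proof.
move=> /andP[rho0 rho1] t0 trho.
have rho10 : 0 < 1 - rho by rewrite subr_gt0.
suff : Kbound th (B0 / (1 - rho) * rho ^+ N * (1 - rho ^+ m))
    (fun eta => taylor_sum (N + m) t eta - taylor_sum N t eta).
  apply: Kbound_le; rewrite ler_piMr//.
    by rewrite taylor_tail_ge0// rho0.
  by rewrite gerBl exprn_ge0.
elim: m => [|m ih].
  rewrite addn0 expr0 subrr mulr0; apply: aeW => s.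
  by rewrite subrr normr0 mul0r.
have hth : th <= th < th0 by rewrite lexx.
have hq0 : 0 <= M / (th0 - th) by rewrite divr_ge0// ltW// subr_gt0.
have := KboundD ih (KboundZ (t ^+ (N + m)) (Kbound_taylor (N + m) hth)).
rewrite addnS taylor_sumS => h.
apply: Kbound_le; last by apply: Kbound_eq h => eta; ring.
rewrite ger0_norm ?exprn_ge0//.
apply: (@le_trans _ _ (B0 / (1 - rho) * rho ^+ N * (1 - rho ^+ m) + B0 * rho ^+ (N + m))).
  rewrite lerD2l mulrCA -exprMn ler_wpM2l//.
  by apply: lerXn2r; rewrite ?nnegrE// mulr_ge0.
rewrite exprD exprS le_eqVlt; apply/orP; left; apply/eqP.
by field; rewrite gt_eqF.
Qed.

Lemma L_taylor_sum N t : {ae Lambda, forall s, L (taylor_sum N t) (conf s) =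
  \sum_(j < N) t ^+ j * L (taylor j) (conf s)}.
Proof.
elim: N => [|N ih].
  have E : taylor_sum 0 t = fun eta => taylor_sum 0 t eta + -1 * taylor_sum 0 t eta.
    by apply/funext => eta; rewrite /taylor_sum big_ord0 mulr0 addr0.
  have := Llin (-1) (measurable_taylor_sum 0 t) (measurable_taylor_sum 0 t)
    (Kfin_taylor_sum 0 t) (Kfin_taylor_sum 0 t).
  rewrite -E; apply: ae_imply => s ->.
  by rewrite big_ord0 mulN1r subrr.
have := Llin (t ^+ N) (measurable_taylor_sum N t) (measurable_taylor N)
  (Kfin_taylor_sum N t) (Kfin_taylor N).
by move: ih; apply: ae_imply2 => s ih; rewrite taylor_sumS => ->; rewrite ih big_ord_recr.
Qed.

(** The derivative of a partial sum is the image by [L] of the previous one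
([L_taylor_sum]). *)
Lemma taylor_sum_derivative b N : exists2 C, 0 <= C &
  forall t h, 0 <= t -> 0 <= h -> t + h <= b ->
  Kbound th (C * h ^+ 2) (fun eta => taylor_sum N.+1 (t + h) eta - taylor_sum N.+1 t eta -
     h * \sum_(j < N) t ^+ j * L (taylor j) eta).
Proof.
elim: N => [|N [C C0 ih]].
  exists 0 => // t h *; apply: aeW => s.
  by rewrite /taylor_sum !big_ord1 big_ord0 !expr0 subrr mulr0 subr0 normr0 !mul0r.
have [C1 C10 h1] := monomial_taylor b N.+1; have [B BB kB] := Kfin_taylor N.+1.
exists (C + C1 * B); first by rewrite addr_ge0// mulr_ge0.
move=> t h t0 h0 thb.
have k1 := KboundZ ((t + h) ^+ N.+1 - t ^+ N.+1 - h * (N.+1%:R * t ^+ N)) kB.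
have k2 := KboundD (ih t h t0 h0 thb) k1.
have : Kbound th ((C + C1 * B) * h ^+ 2) (fun eta =>
     taylor_sum N.+1 (t + h) eta - taylor_sum N.+1 t eta -
     h * (\sum_(j < N) t ^+ j * L (taylor j) eta) +
     ((t + h) ^+ N.+1 - t ^+ N.+1 - h * (N.+1%:R * t ^+ N)) * taylor N.+1 eta).
  apply: Kbound_le k2; rewrite [leRHS]mulrDl lerD2l mulrAC ler_wpM2r//.
  exact: h1.
apply: Kbound_eq => eta; rewrite (taylor_sumS N.+1) big_ord_recr /=.
rewrite (taylor_sumS N.+1 t) /=.
have n0 : N.+1%:R != 0 :> R by rewrite pnatr_eq0.
by move: n0; move: (N.+1%:R : R) => n n0; field.
Qed.

End taylor_expansion.

(** * A solution is the sum of its Taylor series *)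

Section solution_is_taylor_series.
Context (R : realType) (d : nat).
Local Notation V := (Gamma0 R d -> R).
Local Notation Lambda := (poisson_seqs (@lebesgue_rV R d)).
Variables (L : V -> V) (th0 th th' M M1 : R) (r0 : V) (B0 : R).
Hypothesis th_lt : th < th0.
Hypothesis th'_lt : th' < th.
Hypothesis M0 : 0 < M.
Hypothesis M10 : 0 < M1.
Hypothesis B00 : 0 <= B0.
Hypothesis mr0 : measurable_fun setT r0.
Hypothesis r0B : Kbound th0 B0 r0.
Hypothesis Lmeas : forall k, measurable_fun setT k -> measurable_fun setT (L k).
Hypothesis Lbound : forall t1 t2 B k, th <= t2 -> t2 < t1 -> t1 <= th0 -> 0 <= B ->
  measurable_fun setT k -> Kbound t1 B k ->
  Kbound t2 (M / (expR 1 * (t1 - t2)) * B) (L k).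
Hypothesis Lbound1 : forall t1 t2 B k, th' <= t2 -> t2 < t1 -> t1 <= th -> 0 <= B ->
  measurable_fun setT k -> Kbound t1 B k ->
  Kbound t2 (M1 / (expR 1 * (t1 - t2)) * B) (L k).
Hypothesis Llin : forall k1 k2 b, measurable_fun setT k1 -> measurable_fun setT k2 ->
  Kfin th k1 -> Kfin th k2 ->
  {ae Lambda, forall s, L (fun eta => k1 eta + b * k2 eta) (conf s) =
     L k1 (conf s) + b * L k2 (conf s)}.

Variables (k : R -> V) (T rho : R).
Hypothesis T0 : 0 <= T.
Hypothesis rho01 : 0 <= rho < 1.
Hypothesis Trho : T * (M / (th0 - th)) <= rho.
Hypothesis km : forall t, 0 <= t <= T -> measurable_fun setT (k t).
Hypothesis kf : forall t, 0 <= t <= T -> Kfin th (k t).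
Hypothesis kc : Kcontinuous_on th k 0 T.
Hypothesis kd : forall t, 0 < t < T -> Kright_derivative th k t T (L (k t)).
Hypothesis k0 : {ae Lambda, forall s, k 0 (conf s) = r0 (conf s)}.

Local Notation S := (taylor_sum L r0).
Local Notation tail := (taylor_tail B0 rho).
Let mS := measurable_taylor_sum mr0 Lmeas.
Let fS := Kfin_taylor_sum th_lt M0 B00 mr0 r0B Lmeas Lbound.

Definition taylor_remainder (N : nat) (t : R) : V := fun eta => k t eta - S N t eta.
Local Notation w := taylor_remainder.

Let Trho_t t : 0 <= t <= T -> t * (M / (th0 - th)) <= rho.
Proof.
move=> /andP[_ tT]; apply: le_trans Trho; apply: ler_wpM2r => //.
by rewrite divr_ge0 ?ltW// subr_gt0.
Qed.

Let Kbound_S t N : 0 <= t <= T -> Kbound th (tail 0) (S N t).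
Proof.
move=> tT; have /andP[t0 _] := tT.
have := Kbound_taylor_sumB th_lt M0 B00 mr0 r0B Lmeas Lbound 0 N rho01 t0 (Trho_t tT).
by apply: Kbound_eq => eta; rewrite add0n /taylor_sum [X in _ - X]big_ord0 subr0.
Qed.

(** The norm of a solution is continuous on a compact interval. *)
Lemma solution_bounded : exists2 W, 0 <= W & forall t, 0 <= t <= T -> Kbound th W (k t).
Proof.
have cu : continuous_on (fun t => Kreal th (k t)) 0 T.
  move=> t tT e e0; have [delta delta0 h] := kc tT e0; exists delta => // s sT st.
  by apply: Kreal_dist; [exact: ltW|exact: kf|exact: kf|exact: h].
have [c cT cmax] := EVT_max T0 (continuous_on_within cu).
exists (Kreal th (k c)); first exact: Kreal_ge0.
move=> t tT; apply: Kbound_le (Kbound_Kreal (kf tT)).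
by apply: cmax; rewrite in_itv.
Qed.

Lemma remainder_bounded : exists2 W, 0 <= W &
  forall N t, 0 <= t <= T -> Kbound th W (w N t).
Proof.
have [W W0 kW] := solution_bounded; exists (W + tail 0).
  by rewrite addr_ge0// taylor_tail_ge0.
by move=> N t tT; apply: KboundB; [exact: kW|exact: Kbound_S].
Qed.

Lemma remainder_measurable N t : 0 <= t <= T -> measurable_fun setT (w N t).
Proof. by move=> tT; apply: measurable_funB; [exact: km|exact: mS]. Qed.

Lemma L_remainder N t : 0 <= t <= T -> {ae Lambda, forall s,
  L (w N t) (conf s) = L (k t) (conf s) -
    \sum_(j < N) t ^+ j * L (taylor L r0 j) (conf s)}.
Proof.
move=> tT.
have h1 := Llin (-1) (km tT) (mS N t) (kf tT) (fS N t).
have h2 := L_taylor_sum th_lt M0 B00 mr0 r0B Lmeas Lbound Llin N t.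
have E : w N t = fun eta => k t eta + -1 * S N t eta.
  by apply/funext => eta; rewrite /taylor_remainder mulN1r.
by rewrite E; move: h1 h2; apply: ae_imply2 => s -> ->; rewrite mulN1r.
Qed.

(** The relation [w_(N+1)' = L w_N] holds because it does for the solution and for the
partial sums. *)
Lemma remainder_right_derivative N t : 0 < t < T ->
  Kright_derivative th (w N.+1) t T (L (w N t)).
Proof.
move=> tT e e0; have e20 : 0 < e / 2 by rewrite divr_gt0.
have /andP[t0 tltT] := tT; have tT' : 0 <= t <= T by rewrite !ltW.
have [d1 d10 h1] := kd tT e20.
have [C C0 hC] := taylor_sum_derivative th_lt M0 B00 mr0 r0B Lmeas Lbound T N.
have [d2 d20 h2] := linear_small C0 e20.
exists (Num.min d1 d2); first by rewrite lt_min d10.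
move=> h /andP[h0]; rewrite lt_min => /andP[hd1 hd2] thT.
have k1 : Kbound th (e / 2 * h) (fun eta => k (t + h) eta - k t eta - h * L (k t) eta).
  by apply: h1 => //; rewrite h0.
have k2 := hC t h (ltW t0) (ltW h0) thT.
have k3 := KboundB k1 k2.
apply: (@Kbound_le _ _ _ (e / 2 * h + C * h ^+ 2)).
  rewrite [leRHS](_ : _ = e / 2 * h + e / 2 * h); last by field.
  rewrite lerD2l expr2 mulrA ler_wpM2r ?(ltW h0)//.
  by apply: le_trans h2; rewrite ler_wpM2l// ltW.
apply: Kbound_ae k3; have := L_remainder N tT'.
by apply: ae_imply => s ->; rewrite /taylor_remainder; ring.
Qed.

Lemma taylor_sum_continuous N : Kcontinuous_on th (S N) 0 T.
Proof.
elim: N => [|N ih].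
  move=> t tT e e0; exists 1 => // s sT _; apply: aeW => x.
  by rewrite /taylor_sum !big_ord0 subrr normr0 mulr_ge0 ?expR_ge0// ltW.
have [B BB kB] := Kfin_taylor th_lt M0 B00 mr0 r0B Lmeas Lbound N.
have cX : continuous_on (fun t : R => t ^+ N) 0 T.
  move=> t tT e e0.
  have := @exprn_continuous R N t.
  move=> /cvgrPdist_le/(_ e e0) [delta /= delta0 h]; exists delta => // s _ st.
  by rewrite distrC; apply: h => /=; rewrite distrC.
move=> t tT e e0; have e20 : 0 < e / 2 by rewrite divr_gt0.
have [d1 d10 h1] := ih t tT _ e20.
have [e1 e10 he1] := linear_small BB e20.
have [d2 d20 h2] := cX t tT _ e10.
exists (Num.min d1 d2); first by rewrite lt_min d10.
move=> s sT; rewrite lt_min => /andP[sd1 sd2].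
have := KboundD (h1 s sT sd1) (KboundZ (s ^+ N - t ^+ N) kB).
move=> kk; apply: Kbound_eq (Kbound_le _ kk).
  by move=> eta; rewrite (taylor_sumS _ _ N s) (taylor_sumS _ _ N t); ring.
rewrite [leRHS](_ : _ = e / 2 + e / 2); last by field.
rewrite lerD2l; apply: le_trans he1; rewrite mulrC ler_wpM2l//.
exact: h2.
Qed.

Lemma remainder_continuous N : Kcontinuous_on th (w N) 0 T.
Proof.
move=> t tT e e0; have e20 : 0 < e / 2 by rewrite divr_gt0.
have [d1 d10 h1] := kc tT e20; have [d2 d20 h2] := taylor_sum_continuous N tT e20.
exists (Num.min d1 d2); first by rewrite lt_min d10.
move=> s sT; rewrite lt_min => /andP[sd1 sd2].
have kk := KboundB (h1 s sT sd1) (h2 s sT sd2).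
apply: Kbound_eq (Kbound_le _ kk); last by rewrite -splitr.
by move=> eta; rewrite /taylor_remainder; ring.
Qed.

(** By induction on [q]: for [q = 0] this is the uniform bound on the remainders,
and each further power is obtained by integrating [w_(N+1)' = L w_N] from [t0], with
the loss of weight distributed as in [Kbound_taylor]. The initial value of
the remainder is bounded by a tail and accounts for [e]. *)
Lemma remainder_decay (W : R) q t0 : 0 <= W ->
  (forall N t, 0 <= t <= T -> Kbound th W (w N t)) ->
  0 <= t0 -> (forall N, Kbound th (tail N) (w N t0)) ->
  forall th2, th' <= th2 < th -> forall e, 0 < e -> exists N0, forall N t,
    (N0 <= N)%N -> t0 <= t <= T ->
    Kbound th2 (W * (2 * M1 * (t - t0) / (th - th2)) ^+ q + e) (w N t).
Proof.
move=> W0 wW t00 wt0; elim: q => [|q ih] th2 /andP[th'2 th2_lt] e e0.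
  exists 0%N => N t _ /andP[t0t tT].
  apply: (@Kbound_le _ _ _ W); first by rewrite expr0 mulr1 lerDl ltW.
  apply: Kbound_theta (ltW th2_lt) _ => //; apply: wW.
  by rewrite (le_trans t00).
pose m : R := q.+1%:R; have m0 : 0 < m by rewrite ltr0n.
have m1 : 1 <= m by rewrite ler1n.
have m10 : 0 < m + 1 by rewrite addr_gt0.
pose D := th - th2; have D0 : 0 < D by rewrite subr_gt0.
(* With [m = q + 1], the operator gets the share [1 / (q + 2)] of the loss, and the
   induction hypothesis the rest. *)
pose th3 := th2 + D / (m + 1).
have E1 : th3 - th2 = D / (m + 1) by rewrite /th3; ring.
have E2 : th - th3 = D * (m / (m + 1)).
  by rewrite /th3 /D; field; rewrite gt_eqF.
have th23 : th2 < th3 by rewrite -subr_gt0 E1 divr_gt0.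
have th3_lt : th3 < th by rewrite -subr_gt0 E2 mulr_gt0// divr_gt0.
pose C := M1 / (expR 1 * (th3 - th2)).
have C0 : 0 < C by rewrite divr_gt0// mulr_gt0 ?expR_gt0// subr_gt0.
have e20 : 0 < e / 2 by rewrite divr_gt0.
have [k1 k10 hk1] := linear_small (mulr_ge0 (ltW C0) T0) e20.
have th'3 : th' <= th3 < th by rewrite th3_lt (le_trans th'2)// ltW.
have [N1 hN1] := ih th3 th'3 k1 k10.
have [N2 hN2] : exists N0, forall N, (N0 <= N)%N -> tail N <= e / 2.
  apply: geometric_small => //; have /andP[_ rho1] := rho01.
  by rewrite divr_ge0// subr_ge0 ltW.
exists (maxn N1 N2).+1 => -[//|N] t; rewrite ltnS geq_max => /andP[NN1 NN2].
move=> /andP[t0t tT]; have tt0 : 0 <= t - t0 by rewrite subr_ge0.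
pose A := 2 * M1; have A0 : 0 < A by rewrite mulr_gt0.
(* By the induction hypothesis [g'] bounds the derivative of the remainder; [g] grows
   faster than [g'] by convexity of the power ([exprD_ge]). *)
pose g s := W * (A * (s - t0) / D) ^+ q.+1 + C * k1 * (s - t0) + e / 2.
pose g' s := C * (W * (A * (s - t0) / (th - th3)) ^+ q + k1).
have inT s : t0 <= s <= t -> 0 <= s <= T.
  by move=> /andP[h1 h2]; rewrite (le_trans t00)// (le_trans h2).
have inT' s : t0 < s < t -> 0 <= s <= T.
  by move=> /andP[/ltW h1 /ltW h2]; apply: inT; rewrite h1.
have gt0E : g t0 = e / 2.
  by rewrite /g subrr !mulr0 mul0r expr0n/= mulr0 !add0r.
have g_ge0 s : t0 <= s -> 0 <= g s.
  move=> ts; have s0 : 0 <= s - t0 by rewrite subr_ge0.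
  apply: addr_ge0; last exact: ltW.
  apply: addr_ge0; last by apply: mulr_ge0 => //; apply: mulr_ge0; exact: ltW.
  apply: mulr_ge0 => //; apply: exprn_ge0; apply: divr_ge0; last exact: ltW.
  by apply: mulr_ge0 => //; exact: ltW.
have g'_ge0 s : t0 < s < t -> 0 <= g' s.
  move=> /andP[/ltW ts _]; have s0 : 0 <= s - t0 by rewrite subr_ge0.
  apply: mulr_ge0; first exact: ltW.
  apply: addr_ge0; last exact: ltW.
  apply: mulr_ge0 => //; apply: exprn_ge0; apply: divr_ge0.
    by apply: mulr_ge0 => //; exact: ltW.
  by rewrite subr_ge0 ltW.
have cg : continuous_on g t0 t.
  move=> s _ e' e'0.
  have gc : {for s, continuous g}.
    apply: cvgD; last exact: cvg_cst.
    apply: cvgD; apply: cvgM; try exact: cvg_cst; last first.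
      by apply: cvgB; [exact: cvg_id|exact: cvg_cst].
    apply: (@continuous_comp _ _ _ (fun s => A * (s - t0) / D) (fun x => x ^+ q.+1)).
      apply: cvgM; last exact: cvg_cst; apply: cvgM; first exact: cvg_cst.
      by apply: cvgB; [exact: cvg_id|exact: cvg_cst].
    exact: exprn_continuous.
  move: gc => /cvgrPdist_le/(_ e' e'0) [delta /= delta0 h]; exists delta => // u _ su.
  by rewrite distrC; apply: h => /=; rewrite distrC.
apply: (@Kbound_le _ _ _ (g t)).
  rewrite /g -addrA [leRHS](_ : _ = W * (A * (t - t0) / D) ^+ q.+1 + (e / 2 + e / 2)).
    rewrite lerD2l lerD2r; apply: le_trans hk1.
    rewrite mulrAC ler_wpM2r ?(ltW k10)// ler_wpM2l ?(ltW C0)//.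
    by apply: le_trans tT; rewrite lerBlDr lerDl.
  by rewrite -splitr -/A -/D.
apply: (@Kbound_mean_value _ _ th2 (w N.+1) (fun s => L (w N s)) g g' t0 t) => //.
- move=> s st; have [B BB kB] : Kfin th (w N.+1 s) by exists W => //; apply/wW/inT.
  by exists B => //; apply: Kbound_theta (ltW th2_lt) kB.
- move=> s st e' e'0; have [delta delta0 h] := remainder_continuous N.+1 (inT _ st) e'0.
  exists delta => // u ut us; apply: Kbound_theta (ltW e'0) (ltW th2_lt) _.
  by apply: h => //; exact: inT.
- move=> s st e' e'0; have /andP[ts st'] := st.
  have sT : 0 < s < T by rewrite (le_lt_trans t00)// (lt_le_trans st').
  have [delta delta0 h] := remainder_right_derivative N sT e'0.
  exists delta => // u ud ut; have /andP[u0 _] := ud.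
  apply: Kbound_theta (ltW th2_lt) _; first by rewrite mulr_ge0// ltW.
  by apply: h => //; exact: le_trans tT.
- move=> s st; have /andP[ts st'] := st.
  apply: Lbound1 => //; try exact: ltW.
  + have := g'_ge0 s st; rewrite /g' pmulr_rge0//.
  + exact: remainder_measurable (inT' _ st).
  + apply: hN1 => //; rewrite ltW//= ; exact: le_trans (ltW st') tT.
- move=> s h /andP[ts _] h0 _; have s0 : 0 < s - t0 by rewrite subr_gt0.
  pose x := A * (s - t0) / D; have x0 : 0 < x by rewrite divr_gt0// mulr_gt0.
  have Eh : A * (s + h - t0) / D = x + A / D * h by rewrite /x; ring.
  have Ah : 0 < A / D * h by rewrite mulr_gt0// divr_gt0.
  have h1 := exprD_ge q (ltW x0) (ltW Ah).
  have h2 : C * (A * (s - t0) / (th - th3)) ^+ q <= A / D * (m * x ^+ q).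
    rewrite E2 (_ : A * (s - t0) / _ = (m + 1) / m * x); last first.
      by rewrite /x; field; rewrite !gt_eqF.
    rewrite exprMn [C * _]mulrA [A / D * _]mulrA ler_wpM2r ?exprn_ge0 ?(ltW x0)//.
    have h3 : ((m + 1) / m) ^+ q <= expR 1.
      apply: le_trans (succ_ratio_le R q.+1); rewrite exprS ler_peMl//.
        by rewrite exprn_ge0// divr_ge0// ltW.
      by rewrite ler_pdivlMr// mul1r -/m lerDl.
    apply: (@le_trans _ _ (C * expR 1)); first by rewrite ler_wpM2l// ltW.
    rewrite /C E1 [leLHS](_ : _ = M1 / D * (m + 1)); last first.
      by field; rewrite !gt_eqF// expR_gt0.
    rewrite /A [leRHS](_ : _ = M1 / D * (2 * m)); last by ring.
    rewrite ler_wpM2l//; first by rewrite divr_ge0// ltW.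
    lra.
  rewrite /g Eh -/x /g'.
  have h4 := ler_wpM2l W0 h1.
  have h5 : W * h * (C * (A * (s - t0) / (th - th3)) ^+ q) <=
            W * h * (A / D * (m * x ^+ q)) by rewrite ler_wpM2l// mulr_ge0// ltW.
  move: h4 h5; rewrite -/m; set X := (x + _) ^+ _; set Y := x ^+ q.+1.
  set Z := x ^+ q; set P := (A * _ / (th - th3)) ^+ q; move: (A / D) => AD.
  nra.
- by rewrite gt0E ltW.
- exact: g_ge0.
- rewrite gt0E; apply: Kbound_theta (ltW th2_lt) _; first exact: ltW.
  by apply: Kbound_le (wt0 _); apply: hN2; exact: leqW.
Qed.

(** By [remainder_decay] the remainders at the time [t] tend to [0] with the weight
[th'], hence almost everywhere, and the bound by the tail, which has the weight [th],
is preserved by pointwise limits. The step does not depend on [t0]. *)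
Lemma remainder_step t0 t : 0 <= t0 -> t0 <= t <= T ->
  t - t0 <= (th - th') / (4 * M1) ->
  (forall N, Kbound th (tail N) (w N t0)) ->
  forall N, Kbound th (tail N) (w N t).
Proof.
move=> t00 t0t tt0 wt0 N; have [W W0 wW] := remainder_bounded.
have /andP[t0t' _] := t0t.
have D0 : 0 < th - th' by rewrite subr_gt0.
(* On an interval of this length, the base of the power in [remainder_decay] is at
   most [1 / 2]. *)
have small e : 0 < e -> exists2 n, (N <= n)%N & Kbound th' e (w n t).
  move=> e0; have e20 : 0 < e / 2 by rewrite divr_gt0.
  have half : 0 <= (2^-1 : R) < 1 by rewrite invr_ge0 ler0n/= invf_lt1// ltr1n.
  have [q hq] := geometric_small W0 half e20.
  have th'th : th' <= th' < th by rewrite lexx.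
  have [N0 hN0] := remainder_decay q W0 wW t00 wt0 th'th e20.
  exists (maxn N N0); first by rewrite leq_maxl.
  apply: Kbound_le (hN0 _ _ (leq_maxr _ _) t0t).
  rewrite [leRHS]splitr lerD2r; apply: le_trans (hq q (leqnn _)).
  rewrite ler_wpM2l//; apply: lerXn2r; rewrite ?nnegrE ?invr_ge0//.
    by rewrite divr_ge0 ?mulr_ge0 ?subr_ge0// ltW.
  rewrite ler_pdivrMr//; move: tt0; rewrite ler_pdivlMr; last by rewrite mulr_gt0.
  lra.
have /choice[n hn] : forall i : nat, exists n, (N <= n)%N /\ Kbound th' i.+1%:R^-1 (w n t).
  move=> i; have [|n Nn hn] := small i.+1%:R^-1; first by rewrite invr_gt0.
  by exists n.
have h1 : {ae Lambda, forall s, forall i,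
    `|w (n i) t (conf s)| <= i.+1%:R^-1 * expR (- (th' * (size s)%:R))}.
  by apply/ae_foralln => i; exact: (hn i).2.
have tT : 0 <= t <= T by move: t0t => /andP[? ->]; rewrite (le_trans t00).
have /andP[t_ge0 _] := tT.
have h2 : {ae Lambda, forall s, forall m, `|S (N + m) t (conf s) - S N t (conf s)| <=
    tail N * expR (- (th * (size s)%:R))}.
  apply/ae_foralln => m.
  exact: (Kbound_taylor_sumB th_lt M0 B00 mr0 r0B Lmeas Lbound N m rho01 t_ge0 (Trho_t tT)).
(* [w N = (S n - S N) + w n], where the first term is bounded by the tail with the
   weight [th], and the second tends to [0] pointwise. *)
move: h1 h2; apply: ae_imply2 => s h1 h2; apply/ler_addgt0Pr => e e0.
pose X := expR (- (th' * (size s)%:R)).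
have [i hi] : exists i : nat, i.+1%:R^-1 * X <= e.
  have := archimedean.Num.Theory.archi_boundP (divr_ge0 (expR_ge0 (- (th' * (size s)%:R))) (ltW e0)).
  set i := Num.bound _ => hi; exists i; rewrite mulrC ler_pdivrMr// mulrC -ler_pdivrMr//.
  by apply: le_trans (ltW hi) _; rewrite ler_nat.
have /subnKC nE := (hn i).1.
have := h2 (n i - N)%N; rewrite nE => h3; have h4 := le_trans (h1 i) hi.
rewrite (_ : w N t (conf s) = (S (n i) t (conf s) - S N t (conf s)) + w (n i) t (conf s)).
  by apply: le_trans (ler_normD _ _) _; exact: lerD.
by rewrite /taylor_remainder; ring.
Qed.

(** The interval is covered by finitely many steps of the length allowed by
[remainder_step]. *)
Lemma solution_taylor t N : 0 <= t <= T ->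
  Kbound th (tail N) (fun eta => k t eta - S N t eta).
Proof.
pose h := (th - th') / (4 * M1).
have h0 : 0 < h by rewrite divr_gt0 ?mulr_gt0// subr_gt0.
have base j : Kbound th (tail j) (w j 0).
  have k0' := k0; case: j => [|j].
    have r0th := Kbound_theta B00 (ltW th_lt) r0B.
    have /andP[rho0 rho1] := rho01.
    have : Kbound th B0 (w 0 0).
      apply: Kbound_ae r0th; move: k0'; apply: ae_imply => s ks.
      by rewrite /taylor_remainder /taylor_sum big_ord0 subr0 ks.
    apply: Kbound_le; rewrite /taylor_tail expr0 mulr1 ler_pdivlMr ?subr_gt0//.
    by rewrite ler_piMr// gerBl.
  apply: ae_imply k0' => s ks; rewrite /taylor_remainder /taylor_sum big_ord_recl/=.
  rewrite expr0 mul1r ks big1 ?addr0 ?subrr ?normr0.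
    by rewrite mulr_ge0 ?expR_ge0// taylor_tail_ge0.
  by move=> i _; rewrite expr0n/= mul0r.
have main n : forall u, 0 <= u <= T -> u <= n%:R * h -> forall j, Kbound th (tail j) (w j u).
  elim: n => [|n ih] u /andP[u0 uT] un j.
    by have -> : u = 0; [apply: le_anti; rewrite u0 andbT -[leRHS](mul0r h)|exact: base].
  have [un'|/ltW un'] := leP u (n%:R * h); first by apply: ih => //; rewrite u0.
  have nh0 : 0 <= n%:R * h by rewrite mulr_ge0// ltW.
  apply: (@remainder_step (n%:R * h)) => //; first by rewrite un'.
    by rewrite lerBlDr -[X in _ <= X + _]mul1r -mulrDl addrC natr1.
  by apply: ih => //; rewrite nh0 (le_trans un').
move=> tT; have /andP[t0 _] := tT.
have := archimedean.Num.Theory.archi_boundP (divr_ge0 t0 (ltW h0)).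
by rewrite ltr_pdivrMr// => /ltW /(main _ _ tT); exact.
Qed.

End solution_is_taylor_series.

(** * Perturbation of the operator *)

Section scale_operators.
Context (R : realType) (d : nat).
Local Notation V := (Gamma0 R d -> R).
Local Notation Lambda := (poisson_seqs (@lebesgue_rV R d)).

(** These operators are not bounded in any space of the scale, but lose arbitrarily
little weight, at a price inversely proportional to the loss. *)
Definition scale_operator (m : R -> R) (L : V -> V) : Prop :=
  [/\ forall k, measurable_fun setT k -> measurable_fun setT (L k),
      forall t1 t2 B k, t2 < t1 -> 0 <= B -> measurable_fun setT k -> Kbound t1 B k ->
        Kbound t2 (m t1 / (expR 1 * (t1 - t2)) * B) (L k) &
      forall t k1 k2 b, measurable_fun setT k1 -> measurable_fun setT k2 ->
        Kfin t k1 -> Kfin t k2 ->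
        {ae Lambda, forall s, L (fun eta => k1 eta + b * k2 eta) (conf s) =
          L k1 (conf s) + b * L k2 (conf s)}].

(** The properties of a classical solution that determine its Taylor expansion, in
terms of bounds on sequences. *)
Definition Ksolution (th T : R) (L : V -> V) (r0 : V) (k : R -> V) : Prop :=
  [/\ forall t, 0 <= t <= T -> measurable_fun setT (k t) /\ Kfin th (k t),
      Kcontinuous_on th k 0 T,
      forall t, 0 < t < T -> Kright_derivative th k t T (L (k t)) &
      {ae Lambda, forall s, k 0 (conf s) = r0 (conf s)}].

Variable m : R -> R.
Hypothesis m_gt0 : forall t, 0 < m t.
Hypothesis m_anti : forall t1 t2, t1 <= t2 -> m t2 <= m t1.

Lemma scale_operator_bound L th : scale_operator m L ->
  forall t1 t2 B k, th <= t2 -> t2 < t1 -> 0 <= B -> measurable_fun setT k ->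
  Kbound t1 B k -> Kbound t2 (m th / (expR 1 * (t1 - t2)) * B) (L k).
Proof.
move=> [_ Lb _] t1 t2 B k tht2 t21 B0 mk kB; apply: Kbound_le (Lb _ _ _ _ t21 B0 mk kB).
rewrite ler_wpM2r// ler_wpM2r ?invr_ge0 ?mulr_ge0 ?expR_ge0 ?subr_ge0 ?(ltW t21)//.
by apply: m_anti; rewrite (le_trans tht2)// ltW.
Qed.

Section one_operator.
Variables (L : V -> V) (th0 : R) (r0 : V) (B0 : R).
Hypothesis sL : scale_operator m L.
Hypothesis B00 : 0 <= B0.
Hypothesis mr0 : measurable_fun setT r0.
Hypothesis r0B : Kbound th0 B0 r0.

Let Lbound th t1 t2 B k : th <= t2 -> t2 < t1 -> t1 <= th0 -> 0 <= B ->
  measurable_fun setT k -> Kbound t1 B k ->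
  Kbound t2 (m th / (expR 1 * (t1 - t2)) * B) (L k).
Proof. by move=> h1 h2 _; exact: scale_operator_bound. Qed.

Lemma scale_measurable_taylor j : measurable_fun setT (taylor L r0 j).
Proof. by have [Lm _ _] := sL; exact: measurable_taylor. Qed.

Lemma scale_Kfin_taylor th j : th < th0 -> Kfin th (taylor L r0 j).
Proof.
move=> th_lt; have [Lm _ _] := sL.
exact: (Kfin_taylor th_lt (m_gt0 th) B00 mr0 r0B Lm (@Lbound th)).
Qed.

Lemma Ksolution_taylor th T k : th < th0 -> 0 <= T ->
  T * (m th / (th0 - th)) < 1 -> Ksolution th T L r0 k ->
  forall N t, 0 <= t <= T -> Kbound th (taylor_tail B0 (T * (m th / (th0 - th))) N)
    (fun eta => k t eta - taylor_sum L r0 N t eta).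
Proof.
move=> th_lt T0 rho1 [kmf kc kd k0] N t tT; have [Lm _ Ll] := sL.
have th'_lt : th - 1 < th by rewrite gtrBl.
have rho01 : 0 <= T * (m th / (th0 - th)) < 1.
  by rewrite rho1 andbT mulr_ge0// divr_ge0// ?(ltW (m_gt0 _))// subr_ge0 ltW.
apply: (@solution_taylor _ _ L th0 th (th - 1) (m th) (m (th - 1)) r0 B0 th_lt th'_lt
  (m_gt0 _) (m_gt0 _) B00 mr0 r0B Lm (@Lbound th) _ (@Ll th) k T _ T0 rho01 (lexx _)) => //.
- by move=> t1 t2 B f h1 h2 _; exact: scale_operator_bound.
- by move=> s /kmf[].
- by move=> s /kmf[].
Qed.

End one_operator.

Variables (L : R -> V -> V) (L0 : V -> V).
Hypothesis sL : forall eps, 0 < eps -> scale_operator m (L eps).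
Hypothesis sL0 : scale_operator m L0.
Hypothesis LB : forall t1 t2, t2 < t1 -> exists2 D, 0 <= D &
  forall eps B k, 0 < eps -> 0 <= B -> measurable_fun setT k -> Kbound t1 B k ->
    Kbound t2 (D * B * eps) (fun eta => L eps k eta - L0 k eta).
Variables (th0 : R) (r0 : V) (B0 : R).
Hypothesis B00 : 0 <= B0.
Hypothesis mr0 : measurable_fun setT r0.
Hypothesis r0B : Kbound th0 B0 r0.

(** By induction on [j]: with [f] and [g] the two [j]-th coefficients, the
difference of the next ones is [L eps (f - g) + (L eps g - L0 g)] up to a factor. *)
Lemma taylor_perturbation j th : th < th0 -> exists2 C, 0 <= C & forall eps, 0 < eps ->
  Kbound th (C * eps) (fun eta => taylor (L eps) r0 j eta - taylor L0 r0 j eta).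
Proof.
elim: j th => [|j ih] th th_lt.
  exists 0 => // eps eps0; apply: aeW => s.
  by rewrite /= subrr normr0 !mul0r.
pose t1 := (th + th0) / 2.
have tht1 : th < t1 by rewrite midf_lt.
have t1_lt : t1 < th0 by rewrite midf_lt.
have [C C0 hC] := ih t1 t1_lt.
have [D D0 hD] := LB tht1.
have [B BB gB] := scale_Kfin_taylor sL0 B00 mr0 r0B j t1_lt.
pose A := m t1 / (expR 1 * (t1 - th)).
have A0 : 0 <= A.
  by rewrite divr_ge0 ?mulr_ge0 ?expR_ge0 ?subr_ge0// ltW.
exists (`|j.+1%:R^-1| * (A * C + D * B)).
  by rewrite mulr_ge0// addr_ge0// mulr_ge0.
move=> eps eps0; have [Lm Lb Ll] := sL eps0.
have mf := scale_measurable_taylor (sL eps0) mr0 j.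
have mg := scale_measurable_taylor sL0 mr0 j.
set f := taylor (L eps) r0 j; set g := taylor L0 r0 j.
have Ceps : 0 <= C * eps by rewrite mulr_ge0// ltW.
have mfg : measurable_fun setT (fun eta => f eta - g eta) by exact: measurable_funB.
(* [L eps f = L eps g + L eps (f - g)] by linearity. *)
have fE : f = fun eta => g eta + 1 * (f eta - g eta).
  by apply/funext => eta; ring.
have fg : Kfin t1 (fun eta => f eta - g eta) by exists (C * eps) => //; exact: hC.
have fin_g : Kfin t1 g by exists B.
have lin := Ll t1 g (fun eta => f eta - g eta) 1 mg mfg fin_g fg.
rewrite -fE in lin.
have h1 := Lb _ _ _ _ tht1 Ceps mfg (hC _ eps0).
have h2 := hD eps B g eps0 BB mg gB.
have := KboundZ j.+1%:R^-1 (KboundD h1 h2); rewrite -/A => h3.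
apply: (@Kbound_le _ _ _ (`|j.+1%:R^-1| * (A * (C * eps) + D * B * eps))).
  by rewrite -[leRHS]mulrA [X in _ <= _ * X]mulrDl [A * (C * eps)]mulrA.
apply: Kbound_ae h3; move: lin; apply: ae_imply => s /= ->.
by rewrite -/f -/g; ring.
Qed.

Lemma taylor_sum_perturbation N T th : th < th0 -> 0 <= T ->
  exists2 C, 0 <= C & forall eps t, 0 < eps -> 0 <= t <= T ->
  Kbound th (C * eps) (fun eta => taylor_sum (L eps) r0 N t eta - taylor_sum L0 r0 N t eta).
Proof.
move=> th_lt T0; elim: N => [|N [C C0 ih]].
  exists 0 => // eps t _ _; apply: aeW => s.
  by rewrite /taylor_sum !big_ord0 subrr normr0 !mul0r.
have [C1 C10 h1] := taylor_perturbation N th_lt.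
exists (C + T ^+ N * C1); first by rewrite addr_ge0// mulr_ge0// exprn_ge0.
move=> eps t eps0 tT; have /andP[t0 tT'] := tT.
have := KboundD (ih eps t eps0 tT) (KboundZ (t ^+ N) (h1 eps eps0)).
move=> h2; apply: Kbound_eq (Kbound_le _ h2).
  by move=> eta; rewrite !taylor_sumS; ring.
rewrite [leRHS]mulrDl lerD2l ger0_norm ?exprn_ge0// -mulrA.
apply: ler_wpM2r; first by rewrite mulr_ge0// ltW.
by apply: lerXn2r; rewrite ?nnegrE.
Qed.

(** The tails of both Taylor series are small uniformly in [eps] and [t], and the
finitely many remaining coefficients converge. *)
Lemma Ksolution_perturbation th T (k : R -> R -> V) (r : R -> V) : th < th0 -> 0 <= T ->
  T * (m th / (th0 - th)) < 1 ->
  (forall eps, 0 < eps -> Ksolution th T (L eps) r0 (k eps)) ->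
  Ksolution th T L0 r0 r ->
  forall e, 0 < e -> exists2 delta, 0 < delta & forall eps t, 0 < eps < delta ->
    0 <= t <= T -> Kbound th e (fun eta => k eps t eta - r t eta).
Proof.
move=> th_lt T0 rho1 ksol rsol e e0.
set rho := T * _ in rho1.
have rho01 : 0 <= rho < 1.
  by rewrite rho1 andbT mulr_ge0// divr_ge0// ?(ltW (m_gt0 _))// subr_ge0 ltW.
have e40 : 0 < e / 4 by rewrite divr_gt0.
have BB : 0 <= B0 / (1 - rho) by rewrite divr_ge0// subr_ge0 ltW.
have [N hN] := geometric_small BB rho01 e40.
have [C C0 hC] := taylor_sum_perturbation N th_lt T0.
have e20 : 0 < e / 2 by rewrite divr_gt0.
have [delta delta0 hdelta] := linear_small C0 e20.
exists delta => // eps t /andP[eps0 epsd] tT.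
have h1 := Ksolution_taylor (sL eps0) B00 mr0 r0B th_lt T0 rho1 (ksol _ eps0) N tT.
have h2 := Ksolution_taylor sL0 B00 mr0 r0B th_lt T0 rho1 rsol N tT.
have h3 := hC eps t eps0 tT.
apply: Kbound_eq (Kbound_le _ (KboundB (KboundD h1 h3) h2)); first by move=> eta; ring.
have := hN N (leqnn _); rewrite /taylor_tail -/rho => h4.
have h5 : C * eps <= e / 2 by apply: le_trans hdelta; rewrite ler_wpM2l// ltW.
lra.
Qed.

End scale_operators.

(** * Convergence of the renormalized solutions *)

Section classical_solutions.
Context (R : realType) (d : nat).
Hypothesis d_gt0 : (0 < d)%N.
Local Notation V := (Gamma0 R d -> R).
Implicit Types (f : V).

Lemma Knorm_cvg0 (I : Type) (F : set_system I) {FF : Filter F} th (u : I -> V) :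
  Knorm th (u i) @[i --> F] --> 0%E ->
  forall e, 0 < e -> \forall i \near F, Kbound th e (u i).
Proof.
move=> u0 e e0; have nb : nbhs (0 : \bar R)%E [set x : \bar R | (x < e%:E)%E].
  by apply: open_nbhs_nbhs; split; [exact: open_ereal_lt_ereal|rewrite /= lte_fin].
have := u0 _ nb; rewrite near_simpl /= => h.
by near=> i; apply/(Knorm_le _ _ (ltW e0))/ltW; near: i.
Unshelve. all: by end_near. Qed.

Lemma classical_Ksolution th b T (L : V -> V) r0 k : T < b ->
  classical_solution th b L r0 k -> Ksolution th T L r0 k.
Proof.
move=> Tb [kK kc [dk [_ kd _ dkL]] k0]; split.
- move=> t /andP[t0 tT].
  have [|[mk /KfinP fk] _] := kK t; last by [].
  by rewrite in_itv/= t0 (le_lt_trans tT).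
- move=> t /andP[t0 tT] e e0.
  have tb : t \in `[0, b[ by rewrite in_itv/= t0 (le_lt_trans tT).
  have := Knorm_cvg0 (FF := within_filter _ (nbhs_filter t)) (kc t tb) e0.
  rewrite near_withinE => /nbhs_ballP[delta /= delta0 h]; exists delta => //.
  move=> s /andP[s0 sT] st; apply: h; first by rewrite /ball/= distrC.
  by rewrite /= in_itv/= s0 (le_lt_trans sT).
- move=> t /andP[t0 tT] e e0.
  have tb : t \in `]0, b[ by rewrite in_itv/= t0 (lt_trans tT).
  have := Knorm_cvg0 (FF := within_filter _ (nbhs_filter 0)) (kd t tb) e0.
  rewrite /dnbhs near_withinE => /nbhs_ballP[delta /= delta0 hd]; exists delta => //.
  move=> h /andP[h0 hdelta] _.
  have h1 : Kbound th e ((h^-1 \*: (k (t + h) \- k t)) \- dk t).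
    apply: hd; last by rewrite gt_eqF.
    by rewrite /ball/= sub0r normrN gtr0_norm.
  have := KboundZ h h1; rewrite gtr0_norm// mulrC => h2.
  apply: Kbound_ae h2; have := ae_lebesgue_poisson d_gt0 (dkL t tb).
  apply: ae_imply => s /= <-; rewrite /GRing.scale/=.
  by field; rewrite gt_eqF.
- exact: (@ae_lebesgue_poisson _ _ d_gt0 (fun eta => k 0 eta = r0 eta) k0).
Qed.

End classical_solutions.

Section concrete_operators.
Context (R : realType) (d : nat).
Local Notation T := 'rV[R]_d.
Local Notation mu := (@lebesgue_rV R d).
Variables (a phi : T -> R) (alpha c K : R).
Hypothesis d_gt0 : (0 < d)%N.
Hypothesis ma : measurable_fun setT a.
Hypothesis mphi : measurable_fun setT phi.
Hypothesis a0 : forall x, 0 <= a x.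
Hypothesis phi0 : forall x, 0 <= phi x.
Hypothesis a_sym : forall x, a x = a (- x).
Hypothesis phi_sym : forall x, phi x = phi (- x).
Hypothesis a_alpha : (\int[mu]_x (a x)%:E = alpha%:E)%E.
Hypothesis phi_c : (\int[mu]_x (phi x)%:E = c%:E)%E.
Hypothesis alpha0 : 0 <= alpha.
Hypothesis K0 : 0 <= K.
Hypothesis phiK : {ae mu, forall x, phi x <= K}.

(** The constant in the bound of the hopping operators; [Tmax] is
[(theta0 - theta) / hop_growth theta]. *)
Definition hop_growth (t : R) : R := 2 * alpha * expR (c * expR (- t)).

Let a_in := (integral_symmetric ma a0 a_sym a_alpha).1.
Let a_out := (integral_symmetric ma a0 a_sym a_alpha).2.
Let mr := measurable_regular_pair K mphi.
Let rsym := regular_pair_sym K phi_sym.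
Let rneq := @regular_pair_neq _ _ phi K.
Let ae_r := ae_regular_pair mphi d_gt0 phiK.
Let bphi := bounding_weight_phi mphi phi0 phi_sym phi_c.
Let bphi2 := bounding_weight_phi2 mphi phi0 phi_sym phi_c.

Lemma scale_hop (p q : T -> Gamma0 R d -> R) :
  measurable_fun setT (fun w : T * seqs T => p w.1 (conf w.2)) ->
  measurable_fun setT (fun w : T * seqs T => q w.1 (conf w.2)) ->
  weight_le (regular_pair phi K) phi (fun=> 1)
    (fun y zeta xi => p y (conf zeta) * q y (conf xi)) ->
  scale_operator hop_growth (hop a p q).
Proof.
move=> mp mq pq; split.
- by move=> k; exact: (measurable_hop d_gt0 ma mp mq).
- move=> t1 t2 B k t21 B00 mk kB.
  exact: (Kbound_hop d_gt0 ma a0 a_in a_out mr rsym rneq ae_r mp mq bphi pq mk B00 kB t21).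
- move=> t k1 k2 b mk1 mk2 [B1 B10 h1] [B2 B20 h2].
  exact: (hop_linear d_gt0 ma a0 a_in a_out mr rsym rneq ae_r b mp mq bphi pq mk1 mk2 B10 B20 h1 h2).
Qed.

Lemma scale_Lren eps : 0 < eps -> scale_operator hop_growth (Lren a phi eps).
Proof.
move=> eps0; rewrite Lren_hop; apply: scale_hop.
- exact: measurable_pren.
- exact: measurable_qren.
- exact: weight_le_ren.
Qed.

Lemma scale_LV : scale_operator hop_growth (LV a phi).
Proof.
rewrite LV_hop; apply: scale_hop.
- exact: measurable_pV.
- exact: measurable_qV.
- exact: weight_le_V.
Qed.

(** The weights differ by [O(eps)], with [phi] replaced by [2 * phi]; this is why
[2 * c] enters the constant. *)
Lemma Lren_LV t1 t2 : t2 < t1 -> exists2 D, 0 <= D &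
  forall eps B k, 0 < eps -> 0 <= B -> measurable_fun setT k -> Kbound t1 B k ->
    Kbound t2 (D * B * eps) (fun eta => Lren a phi eps k eta - LV a phi k eta).
Proof.
move=> t21.
pose E := (expR 1 * ((t1 - t2) / 2))^-1 : R.
have E0 : 0 <= E by rewrite invr_ge0 mulr_ge0 ?expR_ge0// divr_ge0// subr_ge0 ltW.
pose D := 2 * alpha * expR (2 * c * expR (- t1)) * (E * (E + 1)).
have D0 : 0 <= D by rewrite !mulr_ge0 ?expR_ge0// addr_ge0.
exists (D * K); first by rewrite mulr_ge0.
move=> eps B k eps0 B00 mk kB.
have eK : 0 <= eps * K by rewrite mulr_ge0// ltW.
rewrite Lren_hop LV_hop.
have h := (Kbound_hopB d_gt0 ma a0 a_in a_out mr rsym rneq ae_r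
  (measurable_pren mphi eps) (measurable_qren mphi eps)
  (@measurable_pV R d) (measurable_qV mphi) bphi bphi2 eK
  (weight_le_ren phi0 eps0) (weight_le_V phi0)
  (weight_le_renB phi0 K0 eps0) mk B00 kB t21).
apply: Kbound_le h; rewrite -/E -/D.
rewrite le_eqVlt; apply/orP; left; apply/eqP; ring.
Qed.

End concrete_operators.

Lemma Lfun_essentially_bounded d (T : measurableType d) (R : realType)
    (mu : {measure set T -> \bar R}) (f : T -> R) :
  f \in Lfun mu +oo%E -> exists2 K, 0 <= K & {ae mu, forall x, f x <= K}.
Proof.
move=> /sub_Lfun_finLfun; rewrite inE/= /finite_norm => foo.
have N0 : (0 <= 'N[mu]_+oo[EFin \o f])%E by exact: Lnorm_ge0.
pose K := fine ('N[mu]_+oo[EFin \o f])%E.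
have KE : ('N[mu]_+oo[EFin \o f] = K%:E)%E by rewrite /K fineK// ge0_fin_numE.
exists K; first by rewrite /K fine_ge0.
move: KE; rewrite unlock; case: ifPn => [mu0 /eqP|].
  rewrite eq_le => /andP[/ess_supP h _]; apply: ae_imply h => x /=.
  by rewrite lee_fin => h; apply: le_trans h; exact: ler_norm.
by rewrite -leNgt measure_le0 => /eqP m0 _; exact: measure0_ae.
Qed.

Lemma ereal_sup_Knorm_cvg0 (R : realType) d (F : set_system R) {FF : Filter F}
    (I : Type) (A : set I) th (u : R -> I -> Gamma0 R d -> R) :
  A !=set0 ->
  (forall e, 0 < e -> \forall s \near F, forall i, A i -> Kbound th e (u s i)) ->
  ereal_sup [set Knorm th (u s i) | i in A] @[s --> F] --> 0%E.
Proof.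
move=> [i0 Ai0] h.
have sup_ge0 s : (0 <= ereal_sup [set Knorm th (u s i) | i in A])%E.
  apply: le_trans (Knorm_ge0 th (u s i0)) _.
  by apply: ereal_sup_ubound; exists i0.
have sup_le e : 0 < e -> \forall s \near F,
    (ereal_sup [set Knorm th (u s i) | i in A] <= e%:E)%E.
  move=> e0; apply: filterS (h e e0) => s hs.
  by apply: ge_ereal_sup => _ [i Ai <-]; apply/(Knorm_le _ _ (ltW e0)); exact: hs.
apply/fine_cvgP; split.
  apply: filterS (sup_le 1 ltr01) => s hs.
  by rewrite ge0_fin_numE//; apply: le_lt_trans hs _; rewrite ltry.
apply/cvgrPdist_le => e e0; apply: filterS (sup_le e e0) => s hs /=.
rewrite sub0r normrN ger0_norm ?fine_ge0// -lee_fin fineK//.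
by rewrite ge0_fin_numE//; apply: le_lt_trans hs _; rewrite ltry.
Qed.

Theorem theorem4p6 (R : realType) (d : nat) (d_gt0 : (0 < d)%N)
    (a phi : 'rV[R]_d -> R)
    (a_meas : measurable_fun setT a) (phi_meas : measurable_fun setT phi)
    (a_ge0 : forall x, 0 <= a x) (phi_ge0 : forall x, 0 <= phi x)
    (a_sym : forall x, a x = a (- x)) (phi_sym : forall x, phi x = phi (- x))
    (alpha_gt0 : (0 < \int[lebesgue_rV]_x (a x)%:E)%E)
    (alpha_fin : (\int[lebesgue_rV]_x (a x)%:E < +oo)%E)
    (phi_fin : (\int[lebesgue_rV]_x (phi x)%:E < +oo)%E)
    (theta0 theta T : R)
    (T_ge0 : 0 <= T) (T_Tstar : (T%:E < Tstar a phi theta0)%E)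
    (theta_lt : theta < theta0) (T_lt : T < Tmax a phi theta0 theta)
    (phi_L1 : phi \in Lfun lebesgue_rV 1)
    (phi_Loo : phi \in Lfun lebesgue_rV +oo%E)
    (r0 : Gamma0 R d -> R) (r0_K : Kspace theta0 r0)
    (k : R -> R -> Gamma0 R d -> R)
    (k_sol : forall eps : R, 0 < eps ->
       classical_solution theta (Tmax a phi theta0 theta) (Lren a phi eps) r0
         (k eps))
    (r : R -> Gamma0 R d -> R)
    (r_sol :
       classical_solution theta (Tmax a phi theta0 theta) (LV a phi) r0 r) :
  ereal_sup [set Knorm theta (k eps t \- r t) | t in `[0, T]] @[eps --> 0^'+]
    --> 0%E.
Proof.
have [K K0 phiK] := Lfun_essentially_bounded phi_Loo.
have [mr0 /KfinP[B0 B00 r0B]] := r0_K.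
pose alpha := \int[lebesgue_rV]_x a x; pose c := \int[lebesgue_rV]_x phi x.
have a_alpha : (\int[lebesgue_rV]_x (a x)%:E = alpha%:E)%E.
  by rewrite /alpha /Rintegral fineK// ge0_fin_numE// ltW.
have phi_c : (\int[lebesgue_rV]_x (phi x)%:E = c%:E)%E.
  rewrite /c /Rintegral fineK// ge0_fin_numE//.
  by apply: integral_ge0 => x _; rewrite lee_fin.
have alpha0 : 0 < alpha by rewrite -lte_fin -a_alpha.
have c0 : 0 <= c.
  by rewrite /c /Rintegral fine_ge0//; apply: integral_ge0 => x _; rewrite lee_fin.
pose m := hop_growth alpha c.
have m_gt0 t : 0 < m t by rewrite !mulr_gt0 ?expR_gt0.
have m_anti t1 t2 : t1 <= t2 -> m t2 <= m t1.
  move=> t12; rewrite /m /hop_growth ler_wpM2l//; first by rewrite mulr_ge0// ltW.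
  by rewrite ler_expR ler_wpM2l// ler_expR lerN2.
have Tmaxm : Tmax a phi theta0 theta = (theta0 - theta) / m theta.
  by rewrite /Tmax -/alpha -/c [expR (- (c * _))]expRN -mulrA -invfM.
have rho1 : T * (m theta / (theta0 - theta)) < 1.
  rewrite mulrA ltr_pdivrMr ?subr_gt0// mul1r -ltr_pdivlMr//.
  by rewrite -Tmaxm.
have ksol eps : 0 < eps -> Ksolution theta T (Lren a phi eps) r0 (k eps).
  by move=> /k_sol; exact: classical_Ksolution.
have rsol : Ksolution theta T (LV a phi) r0 r.
  exact: classical_Ksolution r_sol.
apply: ereal_sup_Knorm_cvg0; first by exists 0; rewrite /= in_itv/= lexx.
move=> e e0.
have [delta delta0 h] := Ksolution_perturbation m_gt0 m_anti
  (scale_Lren d_gt0 a_meas phi_meas a_ge0 phi_ge0 a_sym phi_sym a_alpha phi_c phiK)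
  (scale_LV d_gt0 a_meas phi_meas a_ge0 phi_ge0 a_sym phi_sym a_alpha phi_c phiK)
  (Lren_LV d_gt0 a_meas phi_meas a_ge0 phi_ge0 a_sym phi_sym a_alpha phi_c (ltW alpha0) K0 phiK)
  B00 mr0 r0B theta_lt T_ge0 rho1 ksol rsol e0.
near=> eps => t; rewrite /= in_itv/= => tT; apply: h => //.
by apply/andP; split; near: eps; [exact: nbhs_right_gt|exact: nbhs_right_lt].
Unshelve. all: by end_near. Qed.
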